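(* Let $A_\Gamma$ be an Artin group such that the intersection of any two parabolic subgroups of $A_\Gamma$ is a parabolic subgroup of $A_\Gamma$ (i.e. $A_\Gamma$ is in the class $\mathcal{A}$). (1) Let $\psi\colon L\to A_\Gamma$ be a (not necessarily continuous) group homomorphism from a locally compact Hausdorff group $L$ into $A_\Gamma$. If $L$ is almost connected, then $\psi(L)$ is contained in a complete parabolic subgroup of $A_\Gamma$. (2) If all complete standard parabolic subgroups of $A_\Gamma$ are $lcH$-slender, then $A_\Gamma$ is $lcH$-slender.
   Context: Let $\Gamma$ be a finite non-empty simplicial graph with vertex set $V(\Gamma)$, edge set $E(\Gamma)$ and an edge-labeling $m\colon E(\Gamma)\to\{2,3,4,\ldots\}$. The Artin group $A_\Gamma$ is the group with generating set $V(\Gamma)$ and relations $vwv\cdots = wvw\cdots$ (both sides alternating words with $m(\{v,w\})$ letters) for each $\{v,w\}\in E(\Gamma)$. For $X\subset V(\Gamma)$, $A_X$ denotes the subgroup of $A_\Gamma$ generated by $X$ (trivial if $X=\emptyset$). A parabolic subgroup of $A_\Gamma$ is a conjugate $gA_Xg^{-1}$ with $g\in A_\Gamma$, $X\subset V(\Gamma)$. A subset $X\subset V(\Gamma)$ is free of infinity if $\{v,w\}\in E(\Gamma)$ for all distinct $v,w\in X$; in this case $A_X$ is called a complete standard parabolic subgroup, and its conjugates are called complete parabolic subgroups. A locally compact Hausdorff group $L$ is almost connected if $L/L^\circ$ is compact, where $L^\circ$ is the connected component of the identity. A discrete group $G$ is $lcH$-slender if every group homomorphism from a locally compact Hausdorff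 group into $G$ (with the discrete topology) is continuous. *)

(* Defs.v *)
From HB Require Import structures.
From mathcomp Require Import all_boot.
From mathcomp Require Import boolp classical_sets topology.

Set Warnings "-redundant-canonical-projection".

Set Implicit Arguments.
Unset Strict Implicit.
Unset Printing Implicit Defensive.

Local Open Scope group_scope.
Local Open Scope classical_set_scope.
Local Open Scope quotient_scope.

(* A word over S is a sequence of signed letters, (s, true)
   standing for s and (s, false) for its inverse. *)

Definition word (S : Type) := seq (S * bool).

Definition letter_inv (S : Type) (a : S * bool) := (a.1, ~~ a.2).

Definition word_inv (S : Type) (u : word S) : word S :=
  rev (map (@letter_inv S) u).

(* The congruence on words generated by the relations u = v for R u v, together
   with free cancellation. *)
Inductive pres_eq (S : Type) (R : word S -> word S -> Prop) :
    word S -> word S -> Prop :=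
| pres_rel u v : R u v -> pres_eq R u v
| pres_cancel a : pres_eq R [:: a; letter_inv a] [::]
| pres_refl u : pres_eq R u u
| pres_sym u v : pres_eq R u v -> pres_eq R v u
| pres_trans u v w : pres_eq R u v -> pres_eq R v w -> pres_eq R u w
| pres_cat u u' v v' :
    pres_eq R u u' -> pres_eq R v v' -> pres_eq R (u ++ v) (u' ++ v').

Section PresentedGroup.
Variables (S : choiceType) (R : word S -> word S -> Prop).

Definition pres_eqb : rel (word S) := fun u v => `[< pres_eq R u v >].

Lemma pres_eqb_refl : reflexive pres_eqb.
Proof. by move=> u; apply/asboolP; exact: pres_refl. Qed.

Lemma pres_eqb_sym : symmetric pres_eqb.
Proof. by move=> u v; apply/asboolP/asboolP; exact: pres_sym. Qed.

Lemma pres_eqb_trans : transitive pres_eqb.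
Proof.
by move=> v u w /asboolP uv /asboolP vw; apply/asboolP; exact: pres_trans vw.
Qed.

Canonical pres_equiv :=
  EquivRel pres_eqb pres_eqb_refl pres_eqb_sym pres_eqb_trans.

Definition presented := {eq_quot pres_equiv}.
HB.instance Definition _ := Choice.on presented.

Definition pres_class (u : word S) : presented := \pi_presented u.

Lemma pres_classP u v : pres_class u = pres_class v <-> pres_eq R u v.
Proof.
by split=> [/eqmodP/asboolP//|uv]; apply/eqmodP/asboolP.
Qed.

Lemma pres_reprK x : pres_class (repr x) = x.
Proof. exact: reprK. Qed.

Lemma pres_eq_repr u : pres_eq R (repr (pres_class u)) u.
Proof. by apply/pres_classP; exact: pres_reprK. Qed.

Lemma letter_invK : involutive (@letter_inv S).
Proof. by case=> s b; rewrite /letter_inv /= negbK. Qed.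

Lemma word_invK : involutive (@word_inv S).
Proof.
by move=> u; rewrite /word_inv map_rev revK -map_comp map_id_in // => a _;
  exact: letter_invK.
Qed.

Lemma pres_eq_catV u : pres_eq R (u ++ word_inv u) [::].
Proof.
elim: u => [|a u IHu]; first exact: pres_refl.
have -> : (a :: u) ++ word_inv (a :: u) =
    [:: a] ++ (u ++ word_inv u) ++ [:: letter_inv a].
  by rewrite /word_inv /= rev_cons -cats1 -!catA.
apply: (pres_trans (v := [:: a] ++ [::] ++ [:: letter_inv a])).
  apply: pres_cat; first exact: pres_refl.
  by apply: pres_cat; [exact: IHu | exact: pres_refl].
exact: pres_cancel.
Qed.

Lemma pres_eq_inv u v : pres_eq R u v -> pres_eq R (word_inv u) (word_inv v).
Proof.
move=> uv; apply: (pres_trans (v := word_inv u ++ (v ++ word_inv v))).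
  rewrite -{1}[word_inv u]cats0; apply: pres_cat; first exact: pres_refl.
  exact/pres_sym/pres_eq_catV.
apply: (pres_trans (v := (word_inv u ++ u) ++ word_inv v)).
  rewrite catA; apply: pres_cat; last exact: pres_refl.
  by apply: pres_cat; [exact: pres_refl | exact: pres_sym].
rewrite -{2}[word_inv v]cat0s; apply: pres_cat; last exact: pres_refl.
by rewrite -{2}[u]word_invK; exact: pres_eq_catV.
Qed.

Definition pres_one : presented := pres_class [::].
Definition pres_inv (x : presented) : presented :=
  pres_class (word_inv (repr x)).
Definition pres_mul (x y : presented) : presented :=
  pres_class (repr x ++ repr y).

Lemma pres_mulE u v : pres_mul (pres_class u) (pres_class v) = pres_class (u ++ v).
Proof. by apply/pres_classP; apply: pres_cat; exact: pres_eq_repr. Qed.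

Lemma pres_invE u : pres_inv (pres_class u) = pres_class (word_inv u).
Proof. by apply/pres_classP/pres_eq_inv; exact: pres_eq_repr. Qed.

Lemma pres_mulA : associative pres_mul.
Proof.
move=> x y z; rewrite -[x]pres_reprK -[y]pres_reprK -[z]pres_reprK.
by rewrite !pres_mulE catA.
Qed.

Lemma pres_mul1 : left_id pres_one pres_mul.
Proof. by move=> x; rewrite -[x]pres_reprK pres_mulE. Qed.

Lemma pres_mulr1 : right_id pres_one pres_mul.
Proof. by move=> x; rewrite -[x]pres_reprK pres_mulE cats0. Qed.

Lemma pres_mulV : left_inverse pres_one pres_inv pres_mul.
Proof.
move=> x; rewrite -[x]pres_reprK pres_invE pres_mulE; apply/pres_classP.
by rewrite -{2}[repr x]word_invK; exact: pres_eq_catV.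
Qed.

Lemma pres_mulrV : right_inverse pres_one pres_inv pres_mul.
Proof.
move=> x; rewrite -[x]pres_reprK pres_invE pres_mulE; apply/pres_classP.
exact: pres_eq_catV.
Qed.

HB.instance Definition _ := isGroup.Build presented
  pres_mulA pres_mul1 pres_mulr1 pres_mulV pres_mulrV.

End PresentedGroup.

Definition is_subgroup (G : groupType) (H : set G) : Prop :=
  [/\ H 1, (forall x y, H x -> H y -> H (x * y)) & (forall x, H x -> H x^-1)].

Definition generated (G : groupType) (A : set G) : set G :=
  smallest (@is_subgroup G) A.

Definition conj_set (G : groupType) (g : G) (H : set G) : set G :=
  [set g * h * g^-1 | h in H].

(* The subgroup generated by A, as a group in its own right. *)
Definition generated_group (G : groupType) (A : set G) : Type :=
  {x : G | x \in generated A}.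

Section GeneratedGroup.
Variables (G : groupType) (A : set G).

Lemma generated_subgroup : is_subgroup (generated A).
Proof.
split.
- by move=> H [[]].
- move=> x y Ax Ay H HA; have [[_ HM _] _] := HA.
  by apply: HM; [exact: Ax | exact: Ay].
- move=> x Ax H HA; have [[_ _ HV] _] := HA.
  by apply: HV; exact: Ax.
Qed.

Lemma generated_closed : group_closed (mem (generated A)).
Proof.
have [A1 AM AV] := generated_subgroup.
split; first exact: mem_set.
by move=> x y /set_mem Ax /set_mem Ay; exact: mem_set (AM _ _ Ax (AV _ Ay)).
Qed.

HB.instance Definition _ := [isSub of generated_group A for @sval _ _].
HB.instance Definition _ := [Choice of generated_group A by <:].
HB.instance Definition _ :=
  SubChoice_isSubGroup.Build G _ (generated_group A)
    generated_closed.

End GeneratedGroup.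

(* Finite non-empty simplicial graphs with an edge labelling in {2, 3, ...}.
   Edges are two-element sets of vertices; the label is a total function on sets
   of vertices, whose values outside the edge set are never used. *)
Record labeledGraph := LabeledGraph {
  vertex :> finType;
  edge : {set {set vertex}};
  label : {set vertex} -> nat;
  vertex_gt0 : (0 < #|vertex|)%N;
  edge_card2 : forall e, e \in edge -> #|e| = 2;
  label_ge2 : forall e, e \in edge -> (2 <= label e)%N
}.

Section Artin.
Variable Gamma : labeledGraph.

Definition alternating (v w : Gamma) (n : nat) : word Gamma :=
  mkseq (fun i => (if odd i then w else v, true)) n.

Definition artin_rel (a b : word Gamma) : Prop :=
  exists v w : Gamma, let e := [set v; w]%SET in
  [/\ e \in edge Gamma, a = alternating v w (label e)
    & b = alternating w v (label e)].

Definition artin : groupType := presented artin_rel.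

Definition artin_gen (v : Gamma) : artin := pres_class artin_rel [:: (v, true)].

Definition standard_gens (X : {set Gamma}) : set artin := artin_gen @` [set` X].

Definition standard_parabolic (X : {set Gamma}) : set artin :=
  generated (standard_gens X).

Definition standard_parabolic_group (X : {set Gamma}) : groupType :=
  generated_group (standard_gens X).

Definition free_of_infinity (X : {set Gamma}) : Prop :=
  {in X &, forall v w, v != w -> [set v; w]%SET \in edge Gamma}.

Definition parabolic (P : set artin) : Prop :=
  exists g X, P = conj_set g (standard_parabolic X).

Definition complete_parabolic (P : set artin) : Prop :=
  exists g X, free_of_infinity X /\ P = conj_set g (standard_parabolic X).

Definition artin_classA : Prop :=
  forall P Q, parabolic P -> parabolic Q -> parabolic (P `&` Q).

End Artin.

HB.mixin Record isTopologicalGroup G of Topological G & Group G := {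
  mulg_continuous : continuous (fun x : G * G => x.1 * x.2);
  invg_continuous : continuous (fun x : G => x^-1)
}.

#[short(type="topGroupType")]
HB.structure Definition TopologicalGroup :=
  {G of Topological G & Group G & isTopologicalGroup G}.

Definition lcH_group (L : topGroupType) : Prop :=
  locally_compact [set: L] /\ hausdorff_space L.

Section CosetSpace.
Variables (L : topGroupType) (H : set L).

(* L / H is the quotient of L by equality of left cosets, so that it is defined
   without proving first that H is a subgroup. *)
Definition left_coset (x : L) : set L := [set x * h | h in H].

Definition coset_eqb : rel L := fun x y => `[< left_coset x = left_coset y >].

Lemma coset_eqb_refl : reflexive coset_eqb.
Proof. by move=> x; apply/asboolP. Qed.

Lemma coset_eqb_sym : symmetric coset_eqb.
Proof. by move=> x y; apply/asboolP/asboolP. Qed.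

Lemma coset_eqb_trans : transitive coset_eqb.
Proof. by move=> y x z /asboolP xy /asboolP yz; apply/asboolP; rewrite xy. Qed.

Canonical coset_equiv :=
  EquivRel coset_eqb coset_eqb_refl coset_eqb_sym coset_eqb_trans.

Definition coset_space : topologicalType :=
  quotient_topology {eq_quot coset_equiv}.

End CosetSpace.

Definition identity_component (L : topGroupType) : set L :=
  connected_component [set: L] 1.

Definition almost_connected (L : topGroupType) : Prop :=
  compact [set: coset_space (@identity_component L)].

Definition lcH_slender (G : groupType) : Prop :=
  forall (L : topGroupType) (psi : {multiplicative L -> G}),
    lcH_group L -> continuous (psi : L -> discrete_topology G).

(* Main.v *)
Require Import Defs.
From Stdlib Require Import Reals.
From HB Require Import structures.
From mathcomp Require Import all_boot all_order all_algebra.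
From mathcomp Require Import generic_quotient.
From mathcomp Require Import boolp classical_sets filter topology Rstruct.
From mathcomp Require Import zify ring lra.

(** Let [psi] be a homomorphism from a locally compact Hausdorff group [L] to the
    Artin group [A], and let [N] be the closure of its kernel.

    _Systems of equations._ Since [A] is countable, Baire's theorem makes [N] open
    ([kernel_closure_open]). The kernel is dense in [N], so every element of
    [psi N] has preimages arbitrarily close to 1. Therefore infinite systems
    [y_i = W_i (y_(i+1))], where the words [W_i] have constants in [psi N], are
    solvable in [psi N]: with small lifts of the constants, the solutions of the
    finite pieces of the system stay in a compact neighbourhood of 1, and they
    accumulate at a solution ([solve_system]).

    _Trees._ If the vertices [s] and [t] are not adjacent, [A] is the sum of
    [A_(V - s)] and [A_(V - t)] amalgamated along [A_(V - s - t)], and it acts on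
    the Bass-Serre tree. The tree is represented by the length of normal forms,
    which satisfies the four-point condition ([amalgam_length]). A hyperbolic
    element [h] of [psi N] would contradict the solvability of systems
    ([no_hyperbolic]). If [psi N] contains elements far from the axis of [h], the
    system [y_i = g_i * y_(i+1) * h ^ b_i * y_(i+1)^-1] with suitable [g_i] and
    [b_i] forces [y_0] to be longer than any bound ([far_case]). Otherwise the
    squares of the elements of [psi N] fix an end of the axis, and the Busemann
    function turns [y_i = h * y_(i+1) ^ (2 n)] into a system of integer equations
    without solution ([line_case]). The first case needs that an element fixing a
    long segment of the axis fixes all of it. That follows from the descending
    chain condition for parabolic subgroups, because the fixators of segments are
    intersections of parabolic subgroups.

    _Parabolic subgroups._ A parabolic subgroup contained in [A_Y] is conjugate by
    an element of [A_Y] to some [A_Z] with [Z] contained in [Y]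
    ([parabolic_inclusion_step]), so proper inclusions lower the rank. To see this,
    [A] is made to act on pairs of a minimal representative of a coset of [W_Y] in
    the Coxeter group [W], given by its geometric representation, and an element
    of [A_Y]. Together with the stability of parabolic subgroups under intersection,
    this provides subsets with parabolic hulls, and a subgroup is contained in the
    hull of one of its finite subsets.

    _Conclusion._ Let all elements of a subgroup be elliptic on all these trees,
    and let [g A_X g^-1] be the hull of a finite subset that contains the subgroup.
    If [s] and [t] in [X] were not adjacent, Serre's lemma ([finite_fixpoint])
    would put the hull into a conjugate of [A_(V - s)] or [A_(V - t)], although it
    contains a conjugate of the hyperbolic element [t s]. So the subgroup lies in a
    complete parabolic subgroup ([elliptic_in_complete]). This applies to [psi N].
    If [L] is almost connected, every element of [L] has a power in [N], so it
    applies to [psi L] too, which is (1). For (2), the restriction of [psi] to the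
    open subgroup [N] takes values in a conjugate of some [A_X] with [X] free of
    infinity, so it is continuous by hypothesis, and the kernel of [psi] is open. *)

Set Implicit Arguments.
Unset Strict Implicit.
Unset Printing Implicit Defensive.

(** * Tree-like length functions *)
Section TreeLengthDef.
Local Open Scope group_scope.
Variable G : groupType.

Definition dist (N : G -> nat) (x y : G) : nat := N (x^-1 * y).

(** The four-point condition characterizes the pseudometrics of subsets of real
    trees: among the three sums of distances of opposite pairs, the two largest are
    equal. *)
Definition tree_length (N : G -> nat) : Prop :=
  [/\ N 1 = 0%N, forall x, N x^-1 = N x &
   forall x y z w, (dist N x y + dist N z w <=
     maxn (dist N x z + dist N y w) (dist N x w + dist N y z))%N].

End TreeLengthDef.

(* [lia] after naming the distances, respectively also the lengths, so that they
   are compared up to conversion. *)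
Ltac name_distances :=
  repeat match goal with |- context [dist ?N ?x ?y] =>
    let A := fresh "A" in set A := (dist N x y); clearbody A
  end.

Ltac dlia :=
  repeat match goal with
  | H : is_true ?P |- _ => match P with context [dist] => move: H end
  | H : @eq nat ?a ?b |- _ =>
      match a with context [dist] => move: H | _ => match b with context [dist] => move: H end end
  end;
  name_distances; lia.

Ltac nlia N := name_distances;
  repeat match goal with |- context [N ?x] =>
    let A := fresh "A" in set A := (N x); clearbody A
  end; lia.

Section TreeLength.
Local Open Scope group_scope.
Variable G : groupType.
Variables (N : G -> nat) (NT : tree_length N).
Local Notation d := (dist N).

Lemma four_point x y z w : (d x y + d z w <= maxn (d x z + d y w) (d x w + d y z))%N.
Proof. by have [_ _] := NT; apply. Qed.

Lemma dist1 x : d 1 x = N x. Proof. by rewrite /dist invg1 mul1g. Qed.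

Lemma distxx x : d x x = 0%N.
Proof. by have [N1 _ _] := NT; rewrite /dist mulVg. Qed.

Lemma dist_sym x y : d x y = d y x.
Proof. by have [_ NV _] := NT; rewrite /dist -NV invgM invgK. Qed.

Lemma distMl g x y : d (g * x) (g * y) = d x y.
Proof. by rewrite /dist invgM -mulgA mulKg. Qed.

Lemma dist_tri y x z : (d x z <= d x y + d y z)%N.
Proof. by have := four_point x z y y; rewrite distxx (dist_sym z y); lia. Qed.

Lemma dist_quad x' y' x y : (d x y <= d x x' + d x' y' + d y y')%N.
Proof.
by have := dist_tri x' x y; have := dist_tri y' x' y; rewrite (dist_sym y y'); lia.
Qed.

Lemma dist_mulr f g : d f (f * g) = N g.
Proof. by rewrite /dist mulKg. Qed.

Lemma length_mul f g : (N (f * g) <= N f + N g)%N.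
Proof. by have := dist_tri f 1 (f * g); rewrite dist_mulr !dist1. Qed.

Lemma dist_eq0 x y z : d x y = 0%N -> d x z = d y z.
Proof. by move=> xy; have := dist_tri y x z; have := dist_tri x y z; rewrite (dist_sym y x); lia. Qed.

Lemma dist_geodesic a b x y :
  (d a x + d x b <= d a b)%N -> (d a y + d y b <= d a b)%N -> d a x = d a y -> d x y = 0%N.
Proof.
move=> ax ay axy; have := four_point x y a b.
rewrite (dist_sym x a) (dist_sym y a); lia.
Qed.

Lemma distX k i j : (i <= j)%N -> d (k ^+ i) (k ^+ j) = N (k ^+ (j - i)).
Proof. by move=> ij; rewrite -{1}(subnKC ij) expgnDr /dist mulKg. Qed.

(** As soon as the square of [k] is longer than [k], the four-point condition for
    four consecutive corners of the orbit of 1 makes every further power longer by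
    the translation length [N (k ^+ 2) - N k]. *)
Lemma length_expg_step k n : (N k < N (k ^+ 2))%N ->
  (N (k ^+ n.+2) = N (k ^+ n.+1) + (N (k ^+ 2) - N k) /\ N k <= N (k ^+ n.+1))%N.
Proof.
move=> hk; elim: n => [|n [e1 e2]]; first by rewrite expg1; split => //; lia.
split; last lia.
have h1 := four_point (k ^+ 0) (k ^+ n.+3) (k ^+ 1) (k ^+ n.+2).
have h2 := four_point (k ^+ 0) (k ^+ n.+2) (k ^+ 1) (k ^+ n.+3).
move: h1 h2; rewrite ![d (k ^+ n.+3) _]dist_sym [d (k ^+ n.+2) (k ^+ 1)]dist_sym.
by rewrite !distX // ?subn1 ?subn0 /= ?subSnn ?expg1; lia.
Qed.

Lemma length_hyperbolicX k n : (N k < N (k ^+ 2))%N ->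
  N (k ^+ n.+1) = (N k + n * (N (k ^+ 2) - N k))%N.
Proof.
move=> hk; elim: n => [|n IH]; first by rewrite expg1; lia.
by have [-> _] := length_expg_step n hk; rewrite IH; lia.
Qed.

(** If the square of [k] is not longer than [k], any growth of the next powers
    would violate the four-point condition, so the orbit of 1 is bounded. *)
Lemma length_ellipticX k n : (N (k ^+ 2) <= N k)%N -> (N (k ^+ n) <= N k)%N.
Proof.
move=> hk; case: n => [|n]; first by have [N1 _ _] := NT; rewrite expg0 N1.
have : (N (k ^+ n.+1) <= N k /\ N (k ^+ n.+2) <= N k)%N; last by case.
elim: n => [|n [IH1 IH2]]; first by rewrite expg1.
split=> //.
have h1 := four_point (k ^+ 0) (k ^+ n.+3) (k ^+ 1) (k ^+ 2).
have h2 := four_point (k ^+ 0) (k ^+ n.+3) (k ^+ 1) (k ^+ n.+2).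
have h3 := four_point (k ^+ 0) (k ^+ n.+2) (k ^+ 1) (k ^+ n.+3).
move: h1 h2 h3; rewrite ![d (k ^+ n.+3) _]dist_sym [d (k ^+ n.+2) (k ^+ 1)]dist_sym.
rewrite !distX // ?subn1 ?subn0 /= ?subSnn ?expg1 ?subSS ?subn0.
lia.
Qed.
End TreeLength.

(** * Axes of hyperbolic elements *)
Section IntPower.
Local Open Scope group_scope.
Variable G : groupType.
Definition powz (h : G) (j : int) : G :=
  match j with Posz n => h ^+ n | Negz n => h ^- n.+1 end.

Lemma powz_nat h (n : nat) : powz h (Posz n) = h ^+ n. Proof. by []. Qed.

Lemma powzN h (n : nat) : powz h (- (Posz n))%R = h ^- n.
Proof. by case: n => [|n] //=; rewrite invg1. Qed.

Lemma powzS h j : powz h (j + 1)%R = powz h j * h.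
Proof.
case: j => n.
  by rewrite (_ : (_ + 1)%R = (Posz n.+1)); [rewrite /= expgSr | lia].
rewrite (_ : (_ + 1)%R = (- (Posz n))%R) ?powzN /=; last lia.
by rewrite -expVgn -expVgn expgSr mulgVK.
Qed.

Lemma powzB1 h j : powz h (j - 1)%R = powz h j * h^-1.
Proof. by rewrite -{2}(GRing.subrK 1%R j) powzS mulgK. Qed.

Lemma powzD h i j : powz h (i + j)%R = powz h i * powz h j.
Proof.
elim/int_ind: j => [|n IH|n IH].
- by rewrite GRing.addr0 mulg1.
- by rewrite (_ : (i + (Posz n.+1))%R = ((i + (Posz n)) + 1)%R) ?powzS ?IH; [rewrite /= expgSr mulgA | lia].
- rewrite (_ : (i + _)%R = ((i - (Posz n)) - 1)%R); last lia.
  rewrite powzB1 IH -mulgA -powzB1; congr (_ * powz h _); lia.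
Qed.

Lemma powz_inv h j : powz h (- j)%R = (powz h j)^-1.
Proof. by apply/esym/mulg1_eq; rewrite -powzD GRing.subrr. Qed.
End IntPower.

Section Axis.
Local Open Scope group_scope.
Variables (G : groupType) (N : G -> nat) (NT : tree_length N).
Local Notation d := (dist N).
Variables (h : G) (l : nat) (Nh : forall n, N (h ^+ n) = (n * l)%N).
Local Notation p := (powz h).

(** The hypothesis on [h] means that 1 lies on the axis of [h], whose translation
    length is [l]. The points [p j] of the orbit of 1 follow each other along the
    axis at distance [l]. *)
Lemma dist_axis i j : d (p i) (p j) = (`|j - i|%N * l)%N.
Proof.
rewrite /dist -powz_inv -powzD.
have [_ NV _] := NT.
have [ij|ij] := boolP (j < i)%R.
  rewrite -NV -powz_inv (_ : (- _)%R = (Posz `|j - i|%N)) ?powz_nat //; lia.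
by rewrite (_ : (_ + j)%R = (Posz `|j - i|%N)) ?powz_nat //; lia.
Qed.

Lemma dist_axis_shift j x : d (p (j + 1)%R) (h * x) = d (p j) x.
Proof. by rewrite (_ : (j + 1)%R = (1 + j)%R) ?powzD ?distMl //; lia. Qed.

Hypothesis l_gt0 : (0 < l)%N.

(** The powers of a conjugate of [h] and those of [h] differ in length by a bounded
    amount, so they have the same growth, and by [length_hyperbolicX] the growth of
    the lengths of the powers is exactly linear from the first power on. *)
Lemma dist_conjX y x n :
  d x ((y * h * y^-1) ^+ n.+1 * x) = (n * l + d x (y * h * y^-1 * x))%N.
Proof.
set z := x^-1 * y; set k := z * h * z^-1.
have dE m : d x ((y * h * y^-1) ^+ m * x) = N (k ^+ m).
  have cE (a b : G) : (a * b * a^-1) ^+ m = a * b ^+ m * a^-1.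
    by rewrite (_ : a * b * a^-1 = b ^ a^-1) -?conjXg ?conjgE invgK ?mulgA.
  by rewrite /dist /k !cE /z invgM invgK !mulgA.
have kE : forall m, (m * l <= N (k ^+ m) + 2 * N z /\ N (k ^+ m) <= m * l + 2 * N z)%N.
  move=> m; have [_ NV _] := NT.
  have e : N (k ^+ m) = d z^-1 (h ^+ m * z^-1).
    rewrite /k (_ : z * h * z^-1 = h ^ z^-1) -?conjXg ?conjgE invgK ?mulgA //.
    by rewrite /dist invgK !mulgA.
  have e1 : d 1 (h ^+ m) = (m * l)%N by rewrite dist1 Nh.
  have e2 : d 1 z^-1 = N z by rewrite dist1 NV.
  have e3 : d (h ^+ m) (h ^+ m * z^-1) = N z by rewrite -{1}[h ^+ m]mulg1 distMl.
  have := dist_quad NT z^-1 (h ^+ m * z^-1) 1 (h ^+ m).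
  have := dist_quad NT 1 (h ^+ m) z^-1 (h ^+ m * z^-1).
  rewrite (dist_sym NT z^-1 1) (dist_sym NT (h ^+ m * z^-1)) e e1 e2 e3; lia.
have hk : (N k < N (k ^+ 2))%N.
  rewrite ltnNge; apply/negP => ell.
  have := length_ellipticX NT (N k + 2 * N z).+1 ell.
  have [+ _] := kE (N k + 2 * N z).+1.
  move: (leq_pmulr (N k + 2 * N z).+1 l_gt0) (N (k ^+ _)) => + M.
  move: (_ * l)%N; lia.
have dE1 : d x (y * h * y^-1 * x) = N k := dE 1%N.
rewrite dE dE1 (length_hyperbolicX NT n hk).
suff -> : (N (k ^+ 2) - N k = l)%N by lia.
set t := (_ - _)%N; pose M := (2 * N z + N k + l).+1.
have := kE M.+1; rewrite (length_hyperbolicX NT _ hk) -/t mulSn.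
have lt_mul a b : (a < b -> M * a + M <= M * b)%N.
  by move=> ab; rewrite addnC -mulnS leq_mul2l ab orbT.
have [tl|tl|//] := ltngtP t l; have := lt_mul _ _ tl; rewrite /M; lia.
Qed.
End Axis.

Section Overlap.
Local Open Scope group_scope.
Variables (G : groupType) (N : G -> nat) (NT : tree_length N).
Local Notation d := (dist N).
Variables (h : G) (l : nat) (Nh : forall n, N (h ^+ n) = (n * l)%N).
Local Notation p := (powz h).

Lemma dist_axis_nat i (n : nat) : d (p i) (p (i + Posz n)%R) = (n * l)%N.
Proof. by rewrite (dist_axis NT Nh) (_ : `|(i + Posz n)%R - i|%N = n) //; lia. Qed.

Hypothesis l_gt0 : (0 < l)%N.

Lemma translation_ge y x : (l <= d x (y * h * y^-1 * x))%N.
Proof.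
have := dist_conjX NT Nh l_gt0 y x 1.
have := dist_tri NT (y * h * y^-1 * x) x ((y * h * y^-1) ^+ 2 * x).
by rewrite expg2 -(mulgA (y * h * y^-1)) distMl; dlia.
Qed.

Variables (m0 : nat).
Hypothesis stable : forall q i, d (q * p i) (p i) = 0%N ->
  d (q * p (i + Posz m0)%R) (p (i + Posz m0)%R) = 0%N -> forall j, d (q * p j) (p j) = 0%N.

(** The ends of a segment of the axis of [h] that [w] moves by [l] only are on the
    axis of [w]. So [w] shifts the segment along itself by one step, forward or
    backward, and one of [h^-1 * w] and [h * w] fixes enough of the axis to fix all
    of it. *)
Lemma axis_overlap y i (M : nat) : let w := y * h * y^-1 in (m0 + 2 <= M)%N ->
  (d (p i) (w * p i) <= l)%N ->
  (d (p (i + Posz M)%R) (w * p (i + Posz M)%R) <= l)%N ->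
  exists e : int, (e = 1%R \/ e = (-1)%R) /\ forall j, d (w * p j) (p (j + e)%R) = 0%N.
Proof.
move=> w leM; set a := p i; set b := p _ => da db.
have ab : d a b = (M * l)%N by rewrite dist_axis_nat.
have aw2 : (d a (w * w * a) >= 2 * l)%N.
  have := dist_conjX NT Nh l_gt0 y a 1; rewrite expg2 -/w => ->.
  by have := translation_ge y a; rewrite -/w; dlia.
have Ml2 : (2 * l <= M * l)%N by rewrite leq_mul2r; lia.
have [up|down] : (M.+1 * l <= d a (w * b) \/ M.+1 * l <= d b (w * a))%N.
- have := four_point NT a (w * w * a) (w * a) (w * b).
  rewrite -(mulgA w w) !distMl ab (dist_sym NT (w * a) a) (dist_sym NT (w * a) b).
  move: aw2; rewrite -(mulgA w w); dlia.
- exists 1%R; split; first by left.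
  have key k : (k.+1 <= M)%N -> d (w * p (i + Posz k)%R) (p (i + Posz k.+1)%R) = 0%N.
    move=> kM; have [r eM] : exists r, M = (k.+1 + r)%N by exists (M - k.+1)%N; lia.
    have e1 : d (p (i + Posz k.+1)%R) b = (r * l)%N.
      by rewrite /b eM (_ : (i + Posz (k.+1 + r))%R = ((i + Posz k.+1) + Posz r)%R) ?dist_axis_nat; lia.
    have e2 : d (p (i + Posz k)%R) b = (r.+1 * l)%N.
      by rewrite /b eM (_ : (i + Posz (k.+1 + r))%R = ((i + Posz k) + Posz r.+1)%R) ?dist_axis_nat; lia.
    have e3 := dist_axis_nat i k.+1; have e4 := dist_axis_nat i k.
    have t1 := dist_tri NT b (p (i + Posz k.+1)%R) (w * b).
    have t2 := dist_tri NT (w * a) a (w * p (i + Posz k)%R).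
    have t3 := dist_tri NT (w * p (i + Posz k)%R) a (w * b).
    move: t1 t2 t3 up; rewrite {1}eM !distMl e1 e2 e4 => t1 t2 t3 up.
    by apply: (dist_geodesic NT (a := a) (b := w * b)); rewrite ?distMl ?e2 ?e3; move: t1 t2 t3 da db up; clear; dlia.
  have fixq k : (k.+1 <= M)%N -> d (h^-1 * w * p (i + Posz k)%R) (p (i + Posz k)%R) = 0%N.
    move=> kM; rewrite -(distMl N h) -mulgA mulVKg -(key _ kM); congr (d _ _).
    by rewrite -[h in h * _]expg1 -powz_nat -powzD; congr (p _); lia.
  have fq0 := fixq 0%N; rewrite GRing.addr0 in fq0.
  move=> j; have := stable (fq0 _) (fixq m0 _) j; rewrite -(distMl N h) -mulgA mulVKg => <-; try lia.
  by congr (d _ _); rewrite -[h in h * _]expg1 -powz_nat -powzD; congr (p _); lia.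
- exists (-1)%R; split; first by right.
  have key k : (k.+1 <= M)%N -> d (w * p (i + Posz k.+1)%R) (p (i + Posz k)%R) = 0%N.
    move=> kM; have [r eM] : exists r, M = (k.+1 + r)%N by exists (M - k.+1)%N; lia.
    have e1 : d (p (i + Posz k.+1)%R) b = (r * l)%N.
      by rewrite /b eM (_ : (i + Posz (k.+1 + r))%R = ((i + Posz k.+1) + Posz r)%R) ?dist_axis_nat; lia.
    have e2 : d (p (i + Posz k)%R) b = (r.+1 * l)%N.
      by rewrite /b eM (_ : (i + Posz (k.+1 + r))%R = ((i + Posz k) + Posz r.+1)%R) ?dist_axis_nat; lia.
    have e3 := dist_axis_nat i k.+1; have e4 := dist_axis_nat i k.
    have t1 := dist_tri NT a (p (i + Posz k)%R) (w * a).
    have t2 := dist_tri NT (w * b) b (w * p (i + Posz k.+1)%R).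
    have t3 := dist_tri NT (w * p (i + Posz k.+1)%R) b (w * a).
    rewrite dist_sym // in e1; rewrite dist_sym // in e2; rewrite dist_sym // in e3; rewrite dist_sym // in e4.
    move: t1 t2 t3 down; rewrite {1}eM !distMl e1 e3 e4 => t1 t2 t3 down.
    by apply: (dist_geodesic NT (a := b) (b := w * a)); rewrite ?distMl ?e2 ?e3; move: t1 t2 t3 da db down; clear; dlia.
  have fixq k : (k.+1 <= M)%N -> d (h * w * p (i + 1 + Posz k)%R) (p (i + 1 + Posz k)%R) = 0%N.
    move=> kM; rewrite -(distMl N h^-1) -mulgA mulKg -(key _ kM); congr (d (w * p _) _); first lia.
    by rewrite -[h in h^-1]expg1 -powzN -powzD; congr (p _); lia.
  have fq0 := fixq 0%N; rewrite GRing.addr0 in fq0.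
  move=> j; have := stable (fq0 _) (fixq m0 _) j; rewrite -(distMl N h^-1) -mulgA mulKg => <-; try lia.
  by congr (d _ _); rewrite -[h in h^-1]expg1 -powzN -powzD; congr (p _); lia.
Qed.
End Overlap.

Section Translates.
Local Open Scope group_scope.
Variables (G : groupType) (N : G -> nat) (NT : tree_length N).
Local Notation d := (dist N).
Variables (h : G) (l : nat) (Nh : forall n, N (h ^+ n) = (n * l)%N).
Local Notation p := (powz h).

Lemma conjgX_mul (a b : G) m : (a * b * a^-1) ^+ m = a * b ^+ m * a^-1.
Proof. by rewrite (_ : a * b * a^-1 = b ^ a^-1) -?conjXg ?conjgE invgK ?mulgA. Qed.

Lemma distVg u x : d (u^-1 * x) x = d x (u * x).
Proof. by rewrite -(distMl N u) mulVKg. Qed.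

Hypothesis l_gt0 : (0 < l)%N.

(** For a point [p j] closest to [x], the path from [x] to [h * x] first goes to
    [p j], then along the axis, and at last away from the axis, again over a
    distance [d x (p j)]. *)
Lemma dist_axis_proj x : exists j, (2 * d x (p j) <= d x (h * x))%N.
Proof.
have exj : exists n, `[< exists j, d x (p j) = n >].
  by exists (d x (p 0%R)); apply/asboolP; exists 0%R.
case: (ex_minnP exj) => m /asboolP[j jm] minm.
have minj k : (d x (p j) <= d x (p k))%N.
  by rewrite jm; apply: minm; apply/asboolP; exists k.
exists j.
have sh k : d (h * x) (p (k + 1)%R) = d x (p k).
  by rewrite dist_sym // dist_axis_shift // dist_sym.
have e1 := dist_axis_nat NT Nh j 1.
have e2 := dist_axis_nat NT Nh (j - 1)%R 1.
have e3 := dist_axis_nat NT Nh (j - 1)%R 2.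
have f1 := four_point NT x (p j) (p (j - 1)%R) (p (j + 1)%R).
have f2 := four_point NT x (h * x) (p j) (p (j + 1)%R).
have f3 := four_point NT x (p (j + 1)%R) (h * x) (p j).
have s1 := sh j; have s2 := sh (j - 1)%R.
have m1 := minj (j + 1)%R; have m2 := minj (j - 1)%R.
have ej : (j - 1 + Posz 1 = j)%R by lia.
have ej1 : (j - 1 + 1 = j)%R by lia.
have ej2 : (j - 1 + Posz 2 = j + 1)%R by lia.
rewrite ej in e2; rewrite ej2 in e3; rewrite ej1 in s2.
have e2' := dist_sym NT (p (j - 1)%R) (p j).
have e1' := dist_sym NT (p (j + 1)%R) (p j).
have s1' := dist_sym NT (h * x) (p (j + 1)%R).
move: e1 e2 e3 f1 f2 f3 s1 s2 m1 m2 e2' e1' s1'.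
rewrite (_ : (j + Posz 1)%R = (j + 1)%R) //.
clear minj minm sh jm; dlia.
Qed.

(** The middle part, of length [b * l], of a geodesic from 1 to [w ^- b] is
    contained in the axis of [w]. *)
Lemma translation_middle y b x : let w := y * h * y^-1 in let D := N (w ^+ b) in
  (0 < b)%N -> (d 1 x + d x (w ^- b) <= D)%N ->
  (D <= b * l + 2 * d 1 x)%N -> (2 * d 1 x <= b * l + D)%N -> (d x (w * x) <= l)%N.
Proof.
move=> w D b0 geo le1 le2.
have [_ NV _] := NT.
set u := w ^+ b; set v := u^-1.
have vv : N (v * v) = (D + b * l)%N.
  rewrite /v -invgM NV -expgnDr /D.
  have e m : N (w ^+ m.+1) = (m * l + d 1 w)%N.
    by rewrite -dist1 -[w ^+ _]mulg1 (dist_conjX NT Nh l_gt0) mulg1.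
  by case: b b0 {u v D geo le1 le2} => // b _; rewrite (_ : (b.+1 + b.+1 = (b + b.+1).+1)%N) ?e; [lia | lia].
have dv : d 1 v = D by rewrite dist1 /v NV.
have dvv : d v (v * v) = D by rewrite -{1}[v]mulg1 distMl.
have dvx : d v (v * x) = d 1 x by rewrite -{1}[v]mulg1 distMl.
have dvvx : d (v * v) (v * x) = d v x by rewrite distMl.
have d1vv : d 1 (v * v) = (D + b * l)%N by rewrite dist1.
have f1 := four_point NT v 1 x (v * v).
have f2 := four_point NT v (v * v) x (v * x).
have gv : (d 1 x + d v x <= D)%N by rewrite (dist_sym NT v).
have le3 : (d x (v * x) <= b * l)%N.
  move: f1 f2; rewrite (dist_sym NT v 1) dv dvv dvx dvvx d1vv (dist_sym NT (v * v) x).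
  have := dist_tri NT x 1 v; rewrite dv (dist_sym NT x v).
  move: gv le1 le2; clearbody D; clear; dlia.
have := le3; rewrite dist_sym // distVg /u /w.
case: (b) b0 => // b' _; rewrite (dist_conjX NT Nh l_gt0) mulSn.
dlia.
Qed.

(** Geodesics from 1 to two nearby points [z] and [v] separate only near their
    ends. *)
Lemma geodesic_middle B J i v x z : (d 1 x = i * l)%N -> (d x z = (J - i) * l)%N ->
  (d 1 z = J * l)%N -> (d v z <= B)%N -> (i <= J)%N -> (B < (J - i) * l)%N ->
  (d 1 x + d x v <= d 1 v)%N.
Proof.
move=> dx dxz dz dvz iJ ltB.
have [r eJ] : exists r, J = (i + r)%N by exists (J - i)%N; lia.
have f := four_point NT x v 1 z.
have t := dist_tri NT v x z.
move: f t; rewrite (dist_sym NT x 1) dx dxz dz (dist_sym NT v 1) eJ.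
move: ltB dvz; rewrite eJ addKn mulnDl; clear; dlia.
Qed.

Variables (m0 : nat).
Hypothesis stable : forall q i, d (q * p i) (p i) = 0%N ->
  d (q * p (i + Posz m0)%R) (p (i + Posz m0)%R) = 0%N -> forall j, d (q * p j) (p j) = 0%N.

Local Notation M := (m0 + 2)%N.

(** The geodesic from 1 to [w ^- b] runs along the axis of [h] for most of its
    length, because its end is near a far point of that axis, and its middle part
    runs along the axis of [w]. So the axes overlap enough for [axis_overlap]. *)
Lemma aligned_of_near y b B j : let w := y * h * y^-1 in
  (2 * M + 1 <= b)%N -> (d (w ^- b) (p j) <= B)%N -> (4 * B + 2 * M + 1 <= `|j|)%N ->
  exists e : int, (e = 1%R \/ e = (-1)%R) /\ forall k, d (w * p k) (p (k + e)%R) = 0%N.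
Proof.
move=> w bM near farj; set J := `|j|%N; set D := N (w ^+ b).
have [_ NV _] := NT.
have dv : d 1 (w ^- b) = D by rewrite dist1 NV.
have d1 k : d 1 (p k) = (`|k|%N * l)%N.
  by rewrite -[1]/(p 0%R) (dist_axis NT Nh) GRing.subr0.
have Dle : (D <= J * l + B)%N.
  by have := dist_tri NT (p j) 1 (w ^- b); rewrite dv d1 (dist_sym NT (p j)); dlia.
(* The number of steps to the middle of the geodesic. *)
pose i0 := (D %/ (2 * l))%N.
have i0l : (2 * (i0 * l) <= D)%N by have := leq_trunc_div D (2 * l); rewrite -/i0; lia.
have i0u : (D < 2 * (i0 * l) + 2 * l)%N.
  have := @ltn_ceil D (2 * l); rewrite -/i0; lia.
have bl : ((2 * M + 1) * l <= b * l)%N by rewrite leq_mul2r bM orbT.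
have JM : (i0 + M + B < J)%N.
  have : (2 * i0 * l <= (J + B) * l)%N.
    by rewrite mulnDl; have := leq_pmulr B l_gt0; lia.
  by rewrite leq_pmul2r // /J; lia.
have mid (k : int) : `|k|%N = i0 \/ `|k|%N = (i0 + M)%N -> `|(j - k)%R|%N = (J - `|k|)%N ->
    (d (p k) (w * p k) <= l)%N.
  move=> ik ejk; have kJ : (`|k| <= J)%N by case: ik => ->; lia.
  apply: (translation_middle (b := b)); rewrite -?/w -?/D ?d1.
  - by lia.
  - rewrite -dv -d1; apply: (@geodesic_middle B J `|k|%N _ _ (p j)) => //.
    + by rewrite (dist_axis NT Nh) ejk.
    + apply: leq_trans (leq_pmulr _ l_gt0); case: ik => ->; lia.
  - by case: ik => ->; lia.
  - by case: ik => ->; lia.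
have [j0|j0] := boolP (0 <= j)%R.
  apply: (axis_overlap NT Nh l_gt0 stable (i := Posz i0) (M := M)) => //.
  - by apply: mid; [left | rewrite /J; lia].
  - by apply: mid; [right | rewrite /J]; lia.
apply: (axis_overlap NT Nh l_gt0 stable (i := (- Posz (i0 + M))%R) (M := M)) => //.
- by apply: mid; [right | rewrite /J]; lia.
- by apply: mid; [left | rewrite /J]; lia.
Qed.

End Translates.

(** * Subgroups leaving the neighbourhoods of an axis *)
Section FarCase.
Local Open Scope group_scope.
Variables (G : groupType) (N : G -> nat) (NT : tree_length N).
Local Notation d := (dist N).
Variables (h : G) (l : nat) (Nh : forall n, N (h ^+ n) = (n * l)%N).
Local Notation p := (powz h).
Hypothesis l_gt0 : (0 < l)%N.
Variables (m0 : nat).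
Hypothesis stable : forall q i, d (q * p i) (p i) = 0%N ->
  d (q * p (i + Posz m0)%R) (p (i + Posz m0)%R) = 0%N -> forall j, d (q * p j) (p j) = 0%N.

Local Notation M := (m0 + 2)%N.

Definition near_bound (B K : nat) : nat := ((4 * (B + K) + 2 * M + 1) * l + B)%N.

(** Let [w = y * h * y^-1], so that [v = g * w ^+ b]. If [v^-1] is near the axis of
    [h], so is [w ^- b]. Either [w ^- b] is not far from 1, which bounds [v]
    independently of [b], or [w] shifts the axis of [h] by [aligned_of_near], and
    then [g^-1] is near the axis too. *)
Lemma near_axis_dichotomy (g y : G) (b B : nat) (j : int) :
  let v := g * y * h ^+ b * y^-1 in
  (2 * M + 1 <= b)%N -> (d v^-1 (p j) <= B)%N ->
  (N v <= near_bound B (N g) \/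
   (N v <= N g + b * l /\ exists k, d g^-1 (p k) <= B))%N.
Proof.
move=> v bM near; have [_ NV _] := NT.
pose w := y * h * y^-1.
have vE : v = g * w ^+ b by rewrite /w conjgX_mul /v !mulgA.
have d1v : d 1 v^-1 = N v by rewrite dist1 NV.
have d1 k : d 1 (p k) = (`|k|%N * l)%N.
  by rewrite -[1]/(p 0%R) (dist_axis NT Nh) GRing.subr0.
have near2 : (d (w ^- b) (p j) <= B + N g)%N.
  have := dist_tri NT v^-1 (w ^- b) (p j).
  have -> : d (w ^- b) v^-1 = N g by rewrite vE invgM -{1}[w ^- b]mulg1 distMl dist1 NV.
  by dlia.
have [farj|] := leqP (4 * (B + N g) + 2 * M + 1) `|j|; last first.
  move=> jsmall; left; rewrite -d1v /near_bound.
  have := dist_tri NT (p j) 1 v^-1; rewrite d1 (dist_sym NT (p j)).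
  have : (`|j| * l <= (4 * (B + N g) + 2 * M + 1) * l)%N by rewrite leq_mul2r ltnW ?orbT.
  dlia.
right; have [e [e1 al]] := aligned_of_near NT Nh l_gt0 stable bM near2 farj.
have alX m k : d (w ^+ m * p k) (p (k + e * Posz m)%R) = 0%N.
  elim: m k => [|m IH] k; first by rewrite mul1g GRing.mulr0 GRing.addr0 distxx.
  rewrite expgSr -mulgA.
  rewrite (dist_eq0 NT (y := w ^+ m * p (k + e)%R)); last by rewrite distMl al.
  by rewrite (_ : (k + e * Posz m.+1 = k + e + e * Posz m)%R) ?IH //; case: e1 => ->; lia.
split.
  have -> : N v = d g^-1 (w ^+ b) by rewrite /dist invgK vE.
  have e2 : d 1 (w ^+ b) = (b * l)%N.
    rewrite dist_sym // -[w ^+ b]mulg1 -[X in _ * X]/(p 0%R) (dist_eq0 NT _ (alX b 0%R)).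
    by rewrite dist_sym // d1; congr (_ * _)%N; case: e1 => ->; lia.
  have := dist_tri NT 1 g^-1 (w ^+ b).
  by rewrite (dist_sym NT _ 1) dist1 NV e2; dlia.
exists (j + e * Posz b)%R.
have -> : d g^-1 (p (j + e * Posz b)%R) = d g^-1 (w ^+ b * p j).
  by rewrite ![d g^-1 _]dist_sym // (dist_eq0 NT _ (alX b j)).
by rewrite -(distMl N (w ^- b)) mulKg -invgM -vE.
Qed.

Variable H : G -> Prop.
Hypothesis far : forall B, exists g, H g /\ forall j, (B < d g^-1 (p j))%N.
Hypothesis solvable : forall (g : nat -> G) (b : nat -> nat), (forall i, H (g i)) ->
  exists y : nat -> G, forall i, y i = g i * y i.+1 * h ^+ (b i) * (y i.+1)^-1.

(** The elements [g i] are chosen successively, far from the axis in comparison with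
    all earlier data, and then the exponents [b i], large in comparison with [g i].
    For a solution [y] and a bound [c] of [N (y 0)], [near_axis_dichotomy] yields
    bounds [T i c] of [N (y i)], whatever the solution is. The choice of [g i.+1]
    and [b i.+1] takes [T i i] into account, and it refutes both alternatives of the
    dichotomy for [i = N (y 0)]. *)
Lemma far_case : False.
Proof.
have [_ NV _] := NT.
have [F FP] := choice far.
(* A state consists of [T i] and of the pair of [g i] and [b i]. *)
pose next (s : (nat -> nat) * (G * nat)) i :=
  let B c := (s.1 c + N s.2.1)%N in
  let g := F (B i) in
  let b := (2 * M + 1 + near_bound (B i) (N g) + N g + 1)%N in
  (fun c => maxn (near_bound (B c) (N g)) (N g + b * l), (g, b)).
pose st := fix st n := if n is m.+1 then next (st m) m else (id, (F 0%N, 1%N)).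
pose T n := (st n).1; pose g n := (st n).2.1; pose b n := (st n).2.2.
have Hg i : H (g i) by case: i => [|i]; exact: (FP _).1.
have b_gt0 i : (0 < b i)%N by case: i => [|i]; rewrite /b //=; lia.
have [y yE] := solvable b Hg.
have near i c : (N (y i) <= c)%N -> exists j, (d (y i.+1)^-1 (p j) <= c + N (g i))%N.
  move=> yc; have [j jP] := dist_axis_proj NT Nh l_gt0 (y i.+1)^-1.
  exists j; set x := (y i.+1)^-1 in jP *.
  have : (d x (h ^+ b i * x) <= c + N (g i))%N.
    have -> : d x (h ^+ b i * x) = d (g i) (y i).
      by rewrite /dist [y i]yE /x invgK !mulgA mulVg mul1g.
    by have := dist_tri NT 1 (g i) (y i); rewrite dist1 (dist_sym NT _ 1) dist1; dlia.
  case: (b i) (b_gt0 i) => // b' _.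
  have := dist_conjX NT Nh l_gt0 1 x b'; rewrite invg1 mul1g mulg1 => ->.
  by dlia.
have bound i c : (N (y 0%N) <= c)%N -> (N (y i) <= T i c)%N.
  move=> y0c; elim: i => [//|i IH].
  have [j jP] := near _ _ IH.
  have := @near_axis_dichotomy (g i.+1) (y i.+2) (b i.+1) _ j _ _; rewrite -yE => /(_ _ _ jP).
  rewrite /T /= -/(T i) -/(g i) -/(g i.+1) -/(b i.+1).
  case; [by rewrite /b /=; lia| |].
    by move=> yb; apply: leq_trans yb _; rewrite leq_maxl.
  by case=> yb _; apply: leq_trans yb _; rewrite leq_maxr.
pose i := N (y 0%N).
have yi := bound i i (leqnn _).
have [j jP] := near _ _ yi.
have bE : b i.+1 = (2 * M + 1 + near_bound (T i i + N (g i)) (N (g i.+1)) + N (g i.+1) + 1)%N by [].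
have gE : g i.+1 = F (T i i + N (g i))%N by [].
have := @near_axis_dichotomy (g i.+1) (y i.+2) (b i.+1) _ j _ _; rewrite -yE => /(_ _ _ jP).
case; first by rewrite bE; lia.
  move=> ub.
  have : (b i.+1 * l <= N (g i.+1) + N (y i.+1))%N.
    have : d (y i.+2)^-1 (h ^+ b i.+1 * (y i.+2)^-1) = d (g i.+1) (y i.+1).
      by rewrite /dist invgK [y i.+1]yE !mulgA mulVg mul1g.
    case: (b i.+1) (b_gt0 i.+1) => // b' _.
    have := dist_conjX NT Nh l_gt0 1 (y i.+2)^-1 b'; rewrite invg1 mul1g mulg1 => -> e.
    have := dist_tri NT 1 (g i.+1) (y i.+1).
    have := translation_ge NT Nh l_gt0 1 (y i.+2)^-1; rewrite invg1 mul1g mulg1.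
    rewrite dist1 (dist_sym NT (g i.+1) 1) dist1 mulSn.
    by move: e; dlia.
  have := leq_pmulr (b i.+1) l_gt0; rewrite bE; lia.
case=> _ [k]; rewrite gE; case: (FP (T i i + N (g i))%N) => _ /(_ k); lia.
Qed.
End FarCase.

(** * Subgroups staying near an axis *)
Section LineCase.
Local Open Scope group_scope.
Variables (G : groupType) (N : G -> nat) (NT : tree_length N).
Local Notation d := (dist N).
Variables (h : G) (l : nat) (Nh : forall n, N (h ^+ n) = (n * l)%N).
Local Notation p := (powz h).
Hypothesis l_gt0 : (0 < l)%N.

Local Notation q n := (p (- Posz n)%R).

(** The Busemann function, normalized at 1, of the end of the axis that the points
    [q n] approach. *)
Definition busemann (x : G) (b : int) : Prop :=
  exists n0 : nat, forall n, (n0 <= n)%N -> (Posz (d x (q n)) = Posz (n * l) + b)%R.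

(** In a tree, rays stay at bounded distance from each other exactly when they have
    the same end. *)
Definition fixes_end (g : G) : Prop :=
  exists C, forall n : nat, (d (g * q n) (q n) <= C)%N.

Lemma dist1_ray n : d 1 (q n) = (n * l)%N.
Proof. by rewrite -[1]/(p 0%R) (dist_axis NT Nh); congr (_ * _)%N; lia. Qed.

(** The difference [d x (q n) - n * l] is nonincreasing in [n] and at least
    [- N x]. *)
Lemma busemann_exists x : exists b, busemann x b.
Proof.
have ge0 n : (n * l <= d x (q n) + N x)%N.
  by have := dist_tri NT x 1 (q n); rewrite dist1_ray dist1; dlia.
have step n : (d x (q n.+1) <= d x (q n) + l)%N.
  have := dist_tri NT (q n) x (q n.+1).
  by rewrite (dist_axis NT Nh) (_ : `|(- Posz n.+1)%R - (- Posz n)%R|%N = 1%N) ?mul1n //; lia.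
pose e n := (d x (q n) + N x - n * l)%N.
have e_dec m n : (m <= n)%N -> (e n <= e m)%N.
  elim: n => [|n IH]; first by rewrite leqn0 => /eqP ->.
  rewrite leq_eqVlt => /orP[/eqP -> //|/IH]; apply: leq_trans.
  by have := step n; have := ge0 n.+1; have := ge0 n; rewrite /e mulSn; dlia.
have exe : exists k, `[< exists n, e n = k >] by exists (e 0%N); apply/asboolP; exists 0%N.
case: (ex_minnP exe) => k /asboolP[n0 en0] mink.
exists (Posz k - Posz (N x))%R; exists n0 => n n0n.
have : e n = k.
  apply/eqP; rewrite eqn_leq -{1}en0 e_dec //=; apply: mink; by apply/asboolP; exists n.
by have := ge0 n; rewrite /e; dlia.
Qed.

Lemma busemann_unique x b c : busemann x b -> busemann x c -> b = c.
Proof.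
move=> [n1 b1] [n2 b2]; have := b1 (n1 + n2)%N (leq_addr _ _).
by rewrite b2 ?leq_addl //; lia.
Qed.

(** Additivity holds because the rays of the [q n] and of the [g^-1 * q n] have the
    same end, so that far out both are seen from [x] in the same direction. *)
Lemma busemannM g x b c : fixes_end g -> busemann g b -> busemann x c -> busemann (g * x) (b + c)%R.
Proof.
move=> [C gC] [n1 b1] [n2 b2]; exists (n1 + n2 + (2 * N x + C).+1)%N => n len.
have {}b1 := b1 n ltac:(lia); have {}b2 := b2 n ltac:(lia).
have nl : (2 * N x + C < n * l)%N by have := leq_pmulr n l_gt0; lia.
have f1 := four_point NT 1 (q n) x (g^-1 * q n).
have f2 := four_point NT 1 (g^-1 * q n) x (q n).
have e1 : d x (g^-1 * q n) = d (g * x) (q n) by rewrite -(distMl N g) mulVKg.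
have e2 : d 1 (g^-1 * q n) = d g (q n) by rewrite -(distMl N g) mulVKg mulg1.
have e3 : (d (g^-1 * q n) (q n) <= C)%N by rewrite -(distMl N g) mulVKg dist_sym.
have t := dist_tri NT x 1 (q n).
have s1 := dist_sym NT (q n) x; have s2 := dist_sym NT (q n) (g^-1 * q n).
have s3 := dist_sym NT (g^-1 * q n) x.
move: f1 f2 s1 s2 s3 e1 e2 t; rewrite !dist1_ray dist1.
by move: nl b1 b2 e3; clear; dlia.
Qed.

Lemma fixes_endM f g : fixes_end f -> fixes_end g -> fixes_end (f * g).
Proof.
move=> [C fC] [D gD]; exists (D + C)%N => n.
have := dist_tri NT (f * q n) (f * g * q n) (q n).
by rewrite -(mulgA f g) distMl; have := fC n; have := gD n; dlia.
Qed.

Lemma fixes_endX g n : fixes_end g -> fixes_end (g ^+ n).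
Proof.
move=> fg; elim: n => [|n IH]; last by rewrite expgS; exact: fixes_endM.
by exists 0%N => n; rewrite mul1g distxx.
Qed.

Lemma fixes_end_axis : fixes_end h.
Proof.
exists l => n; rewrite -[h in h * _]expg1 -powz_nat -powzD (dist_axis NT Nh).
by rewrite (_ : `|_|%N = 1%N) ?mul1n //; lia.
Qed.

Lemma busemann_axis : busemann h (Posz l).
Proof.
exists 0%N => n _; rewrite -[h in d h]expg1 -powz_nat (dist_axis NT Nh).
by rewrite (_ : `|_|%N = n.+1) ?mulSn; lia.
Qed.

Lemma busemannX g b n : fixes_end g -> busemann g b -> busemann (g ^+ n) (b * Posz n)%R.
Proof.
move=> fg gb; elim: n => [|n IH]; first by rewrite GRing.mulr0; exists 0%N => n _; rewrite dist1_ray; lia.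
by rewrite expgS (_ : (b * Posz n.+1)%R = (b + b * Posz n)%R); [exact: busemannM|lia].
Qed.

Variable H : G -> Prop.
Hypothesis HM : forall x y, H x -> H y -> H (x * y).
Hypothesis HV : forall x, H x -> H x^-1.
Hypothesis Hh : H h.
Variable B : nat.
Hypothesis near : forall g, H g -> exists j, (d g (p j) <= B)%N.

(** An element of [H] maps the axis into a neighbourhood of itself, so it fixes or
    exchanges the two ends of the axis. *)
Lemma fixes_end_sq g : H g -> fixes_end (g ^+ 2).
Proof.
move=> Hg; have [_ NV _] := NT.
have HX n : H (h ^+ n.+1) by elim: n => [|n IH]; rewrite ?expg1 // expgS; exact: HM.
have Hp j : H (p j).
  case: j => [[|n]|n]; [|exact: HX|apply: HV; exact: HX].
  by rewrite /= expg0 -(mulVg h); apply: HM => //; exact: HV.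
pose C := (B + (B + N g) * l)%N.
have d1 k : d 1 (p k) = (`|k|%N * l)%N.
  by rewrite -[1]/(p 0%R) (dist_axis NT Nh) GRing.subr0.
have dg k : d g (g * p k) = (`|k|%N * l)%N by rewrite -{1}[g]mulg1 distMl d1.
have alt j : (d (g * p j) (p j) <= C)%N \/ (d (g * p j) (p (- j)%R) <= C)%N.
  have [k gk] := near (HM Hg (Hp j)).
  have kj : (`|k| <= `|j| + (B + N g) /\ `|j| <= `|k| + (B + N g))%N.
    have t1 := dist_quad NT 1 (p k) g (g * p j).
    have t2 := dist_quad NT g (g * p j) 1 (p k).
    rewrite (dist_sym NT (p k)) (dist_sym NT g 1) dg d1 dist1 in t1 t2.
    have e1 : (`|j| * l <= (`|k| + (B + N g)) * l)%N.
      by rewrite mulnDl; have := leq_pmulr (B + N g) l_gt0; move: t1 t2 gk; clear; dlia.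
    have e2 : (`|k| * l <= (`|j| + (B + N g)) * l)%N.
      by rewrite mulnDl; have := leq_pmulr (B + N g) l_gt0; move: t1 t2 gk; clear; dlia.
    by move: e1 e2; rewrite !leq_pmul2r.
  have close i : (`|i - k|%N <= B + N g)%N -> (d (g * p j) (p i) <= C)%N.
    move=> ik; have := dist_tri NT (p k) (g * p j) (p i); rewrite (dist_axis NT Nh).
    have : (`|i - k|%N * l <= (B + N g) * l)%N by rewrite leq_mul2r ik orbT.
    by rewrite /C; dlia.
  have [?|?] : (`|j - k|%N <= B + N g)%N \/ (`|(- j)%R - k|%N <= B + N g)%N by lia.
    by left; apply: close.
  by right; apply: close.
exists (N (g ^+ 2) + 2 * C)%N => n; set x := q n.
have e : g ^+ 2 * x = g * (g * x) by rewrite expg2 mulgA.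
have [gx|gx] := alt (- Posz n)%R; rewrite -/x ?GRing.opprK in gx.
  by have := dist_tri NT (g * x) (g ^+ 2 * x) x; rewrite {2}e distMl; dlia.
have [gy|gy] := alt (Posz n); last first.
  have := dist_quad NT (g * x) (g * p (Posz n)) (g ^+ 2 * x) x.
  have := dist_tri NT (g * p (Posz n)) (g ^+ 2 * x) x.
  by rewrite {2}e distMl; move: gx gy; rewrite -/x; clear; dlia.
have := dist_quad NT (g ^+ 2) 1 (g ^+ 2 * x) x.
have -> : d (g ^+ 2 * x) (g ^+ 2) = (n * l)%N.
  by rewrite -{2}[g ^+ 2]mulg1 distMl dist_sym // dist1_ray.
rewrite !(dist_sym NT _ 1) dist1_ray dist1.
have := dist_tri NT (p (Posz n)) (g * x) (g * p (Posz n)).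
rewrite distMl (dist_axis NT Nh) (dist_sym NT (p _) (g * _)).
have -> : `|Posz n - (- Posz n)%R|%N = (2 * n)%N by lia.
by move: gx gy; clear; dlia.
Qed.

Hypothesis solvable : forall n, exists y : nat -> G,
  forall i, H (y i) /\ y i = h * (y i.+1 ^+ 2) ^+ n.

(** The Busemann function takes a solution of the system for [n = l.+1] to integers
    with [t i = l + 2 * l.+1 * t i.+1]. None of them is 0, because [2 * l.+1] does
    not divide [l], so their absolute values decrease forever. *)
Lemma line_case : False.
Proof.
have [y yP] := solvable l.+1.
have [t tP] := choice (fun i => busemann_exists (y i)).
have fy i : fixes_end (y i).
  have [_ ->] := yP i; apply: fixes_endM; first exact: fixes_end_axis.
  by apply/fixes_endX/fixes_end_sq; have [] := yP i.+1.
have tE i : t i = (Posz l + t i.+1 * Posz 2 * Posz l.+1)%R.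
  apply: busemann_unique (tP i) _; have [_ ->] := yP i.
  apply: busemannM; [exact: fixes_end_axis | exact: busemann_axis |].
  by apply: busemannX; [exact: fixes_endX | exact: busemannX].
have tn0 i : t i <> 0%R.
  move=> ti; have := tE i; rewrite ti => /esym e0.
  have : (`|t i.+1| * 2 * l.+1 = l)%N by nia.
  by case: `|t i.+1|%N => [|k]; nia.
have dec i : (`|t i.+1| < `|t i|)%N.
  have e := tE i; have := tn0 i.+1; have : (0 < `|t i.+1|)%N by have := tn0 i.+1; lia.
  nia.
have {dec} : forall k i, (`|t i| <= k)%N -> False.
  elim=> [|k IH] i tik; first by have := tn0 i; lia.
  by apply: (IH i.+1); have := dec i; lia.
by move/(_ _ 0%N (leqnn _)).
Qed.
End LineCase.

(** * Elliptic elements *)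
Section Fixpoints.
Local Open Scope group_scope.
Variables (G : groupType) (N : G -> nat) (NT : tree_length N).
Local Notation d := (dist N).

(** By [length_hyperbolicX] and [length_ellipticX], this expresses that the lengths
    of the powers of [g] are bounded. *)
Definition elliptic (g : G) : bool := (N (g ^+ 2) <= N g)%N.

Lemma conjgXV (k g : G) n : (k^-1 * g * k) ^+ n = k^-1 * g ^+ n * k.
Proof. by have := conjgX_mul k^-1 g n; rewrite invgK. Qed.

Lemma length_conj k g : (N (k^-1 * g * k) <= N g + 2 * N k)%N.
Proof.
have := length_mul NT (k^-1 * g) k; have := length_mul NT k^-1 g.
by have [_ -> _] := NT; nlia N.
Qed.

Lemma elliptic_conj k g : elliptic (k^-1 * g * k) = elliptic g.
Proof.
suff imp k' g' : elliptic g' -> elliptic (k'^-1 * g' * k').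
  apply/idP/idP => [/(imp k^-1)|]; last exact: imp.
  by rewrite invgK !mulgA mulgK mulgV mul1g.
move=> ell; rewrite /elliptic leqNgt; apply/negP => hyp.
set a := (N g' + 2 * N k')%N.
have := length_hyperbolicX NT a.+1 hyp.
have := length_conj k' (g' ^+ a.+2); rewrite -conjgXV.
have := length_ellipticX NT a.+2 ell.
set b := (N (_ ^+ 2) - _)%N => e1 e2 e3.
have b0 : (0 < b)%N by rewrite subn_gt0.
have := leq_pmulr a.+1 b0; move: e1 e2; rewrite e3 /a; lia.
Qed.

Hypothesis geodesic : forall g, (0 < N g)%N ->
  exists r, N r = 1%N /\ (N (r^-1 * g)).+1 = N g.

(** A conjugate [f] of minimal length has 1 on its axis: if the square of [f] were
    shorter than [2 * N f], the base point could be moved by one step [r] towards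
    [f], which would shorten [f]. *)
Lemma hyperbolic_axis g : ~~ elliptic g ->
  exists k l, (0 < l)%N /\ forall n, N ((k^-1 * g * k) ^+ n) = (n * l)%N.
Proof.
move=> hyp; have [N1 NV _] := NT.
have exk : exists n, `[< exists k, N (k^-1 * g * k) = n >].
  by exists (N (1^-1 * g * 1)); apply/asboolP; exists 1.
case: (ex_minnP exk) => n /asboolP[k kn] minn; exists k, n.
have {}minn k' : (n <= N (k'^-1 * g * k'))%N by apply: minn; apply/asboolP; exists k'.
set f := k^-1 * g * k in kn *.
have fhyp : (N f < N (f ^+ 2))%N by rewrite ltnNge -/(elliptic f) elliptic_conj.
have n0 : (0 < n)%N.
  rewrite lt0n; apply/eqP => n0; move: fhyp; rewrite kn n0.
  by rewrite expg2; have := length_mul NT f f; rewrite kn n0; nlia N.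
have f2 : N (f ^+ 2) = (2 * n)%N.
  have le2 : (N (f ^+ 2) <= 2 * n)%N.
    by rewrite expg2; have := length_mul NT f f; rewrite kn; nlia N.
  apply/eqP; rewrite eqn_leq le2 /= leqNgt; apply/negP => lt2.
  have fpos : (0 < N f)%N by rewrite kn.
  have [r [r1 rf]] := geodesic fpos.
  suff : (d r (f * r) < n)%N.
    apply/negP; rewrite -leqNgt; have := minn (k * r).
    by rewrite (_ : d r (f * r) = N ((k * r)^-1 * g * (k * r))) // /dist invgM /f !mulgA.
  have d1r : d 1 r = 1%N by rewrite dist1.
  have d1f : d 1 f = n by rewrite dist1.
  have drf : (d r f).+1 = n by rewrite /dist rf kn.
  have dfr : d f (f * r) = 1%N by rewrite dist_mulr.
  have dVf : d f^-1 f = N (f ^+ 2) by rewrite /dist invgK expg2.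
  have d1V : d f^-1 1 = n by rewrite dist_sym // dist1 NV.
  have dVr : d f^-1 r = d 1 (f * r) by rewrite -(distMl N f) mulgV.
  have q1 := four_point NT 1 f r (f * r).
  have q2 := four_point NT f^-1 r 1 f.
  have s1 := dist_sym NT r 1; have s2 := dist_sym NT f r; have s3 := dist_sym NT (f * r) 1.
  have s4 := dist_sym NT f (f * r).
  move: fhyp lt2 n0 d1r d1f drf dfr dVf d1V dVr q1 q2 s1 s2 s3 s4; rewrite kn; clear; dlia.
split=> // -[|m]; first by rewrite expg0 N1.
by rewrite (length_hyperbolicX NT m fhyp) f2 kn; lia.
Qed.

Variables (H0 H1 H2 : set G).
Hypotheses (H1G : is_subgroup H1) (H2G : is_subgroup H2).
Hypotheses (H01 : forall x, H0 x -> H1 x) (H02 : forall x, H0 x -> H2 x).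
Hypothesis length0 : forall g, N g = 0%N <-> H0 g.
Hypothesis length1 : forall g, (N g <= 1)%N <-> H1 g \/ H2 g.

(** The first steps from 1 towards [f] and towards [f^-1] agree, as both lead
    towards the fixed points of [f]. Taking this step shortens [f] at both ends. *)
Lemma elliptic_reduction f r : elliptic f -> (2 <= N f)%N -> N r = 1%N ->
  (N (r^-1 * f)).+1 = N f ->
  (N (r^-1 * f * r)).+2 <= N f /\ (N (r^-1 * f^-1)).+1 = N f.
Proof.
move=> ell f2 r1 rf; have [N1 NV _] := NT.
have d1r : d 1 r = 1%N by rewrite dist1.
have d1f : d 1 f = N f by rewrite dist1.
have drf : (d r f).+1 = N f by rewrite /dist rf.
have dfr : d f (f * r) = 1%N by rewrite dist_mulr.
have dVf : (d f^-1 f <= N f)%N by rewrite /dist invgK -expg2.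
have d1V : d f^-1 1 = N f by rewrite dist_sym // dist1 NV.
have dVr : d f^-1 r = d 1 (f * r) by rewrite -(distMl N f) mulgV.
have q1 := four_point NT 1 f r (f * r).
have q2 := four_point NT f^-1 r 1 f.
have q3 := dist_tri NT r 1 f^-1.
have s1 := dist_sym NT r 1; have s2 := dist_sym NT f r; have s3 := dist_sym NT (f * r) 1.
have s4 := dist_sym NT f (f * r); have s5 := dist_sym NT 1 f^-1; have s6 := dist_sym NT r f^-1.
have -> : N (r^-1 * f * r) = d r (f * r) by rewrite /dist mulgA.
have -> : N (r^-1 * f^-1) = d r f^-1 by [].
move: f2 d1r d1f drf dfr dVf d1V dVr q1 q2 q3 s1 s2 s3 s4 s5 s6; clear; dlia.
Qed.

(** The fixed points of [f] lie beyond the step [r]. If those of [g] did not, and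
    [r] led away from them, then the two sets of fixed points would be separated by
    the base point and [f * g] would be hyperbolic. *)
Lemma elliptic_step f g r : elliptic f -> elliptic g -> elliptic (f * g) ->
  (2 <= N f)%N -> N r = 1%N -> (N (r^-1 * f)).+1 = N f ->
  (N (r^-1 * g * r) <= maxn (N g) 1)%N.
Proof.
move=> ef eg efg f2 r1 rf; have [N1 NV _] := NT.
have [_ rVf] := elliptic_reduction ef f2 r1 rf.
have [g0|g0] := posnP (N g).
  rewrite g0; apply/length1; move/length0: g0 => g0.
  have [_ H1M H1V] := H1G; have [_ H2M H2V] := H2G.
  have /length1[r12|r12] : (N r <= 1)%N by rewrite r1.
    by left; apply: (H1M) => //; apply: (H1M); [exact: H1V | exact: H01].
  by right; apply: (H2M) => //; apply: (H2M); [exact: H2V | exact: H02].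
apply: leq_trans (leq_maxl _ _); rewrite leqNgt; apply/negP => lt.
have dE : N (r^-1 * g * r) = d r (g * r) by rewrite /dist mulgA.
have a1 : d 1 r = 1%N by rewrite dist1.
have a2 : d 1 g = N g by rewrite dist1.
have a3 : d g (g * r) = 1%N by rewrite dist_mulr.
have a4 : d 1 g^-1 = N g by rewrite dist1 NV.
have a5 : d r g^-1 = d 1 (g * r) by rewrite -(distMl N g) mulgV dist_sym.
have q1 := four_point NT r (g * r) 1 g.
have t1 := dist_tri NT 1 r g; have t2 := dist_tri NT 1 r g^-1.
have b1 : (d r f).+1 = N f by rewrite /dist rf.
have b2 : (d r f^-1).+1 = N f by rewrite /dist rVf.
have b3 : d 1 f = N f by rewrite dist1.
have b4 : d 1 f^-1 = N f by rewrite dist1 NV.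
have sum : ((N g).*2 < d r g + d r g^-1)%N.
  have s1 := dist_sym NT r 1; have s2 := dist_sym NT g (g * r); have s3 := dist_sym NT (g * r) 1.
  have s4 := dist_sym NT g r.
  move: lt g0 dE a1 a2 a3 a4 a5 q1 t1 t2 s1 s2 s3 s4; clear; dlia.
have c1 : d f^-1 g = N (f * g) by rewrite /dist invgK.
have c2 : d f g^-1 = N (g * f) by rewrite /dist -invgM NV.
have c3 : N (f * g) = (N f + d r g - 1)%N.
  have q2 := four_point NT f^-1 g 1 r; have q3 := four_point NT f^-1 r 1 g.
  have q4 := four_point NT f^-1 1 r g.
  have s1 := dist_sym NT f^-1 1; have s2 := dist_sym NT r f^-1; have s3 := dist_sym NT g r.
  have s4 := dist_sym NT r 1; have s5 := dist_sym NT g 1.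
  rewrite -c1; move: f2 g0 a1 a2 a4 t1 t2 b2 b4 q2 q3 q4 s1 s2 s3 s4 s5 sum; clear; dlia.
have c4 : N (g * f) = (N f + d r g^-1 - 1)%N.
  have q2 := four_point NT f g^-1 1 r; have q3 := four_point NT f r 1 g^-1.
  have q4 := four_point NT f 1 r g^-1.
  have s1 := dist_sym NT f 1; have s2 := dist_sym NT r f; have s3 := dist_sym NT g^-1 r.
  have s4 := dist_sym NT r 1; have s5 := dist_sym NT g^-1 1.
  rewrite -c2; move: f2 g0 a1 a2 a4 t1 t2 b1 b3 q2 q3 q4 s1 s2 s3 s4 s5 sum; clear; dlia.
have e1 : d 1 (f * g) = N (f * g) by rewrite dist1.
have e2 : d (f * g) f = N g by rewrite dist_sym // -{1}[f]mulg1 distMl dist1.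
have e3 : d 1 (f * g)^-1 = N (f * g) by rewrite dist1 NV.
have e4 : d (f * g)^-1 g^-1 = N f by rewrite invgM -{2}[g^-1]mulg1 distMl dist_sym // dist1 NV.
have e5 : (d (f * g)^-1 (f * g) <= N (f * g))%N by rewrite /dist invgK -expg2.
have q5 := four_point NT (f * g) g^-1 1 f.
have q6 := four_point NT f g^-1 1 (f * g).
have q7 := four_point NT (f * g) (f * g)^-1 1 g^-1.
have q8 := four_point NT (f * g) g^-1 1 (f * g)^-1.
have s1 := dist_sym NT (f * g) 1; have s2 := dist_sym NT g^-1 1; have s3 := dist_sym NT f 1.
have s4 := dist_sym NT f (f * g); have s5 := dist_sym NT g^-1 f.
have s6 := dist_sym NT (f * g)^-1 1; have s7 := dist_sym NT (f * g)^-1 (f * g).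
have s8 := dist_sym NT (f * g)^-1 g^-1; have s9 := dist_sym NT g^-1 (f * g).
have s10 := dist_sym NT f g^-1.
move: f2 g0 sum a4 b3 c1 c2 c3 c4 e1 e2 e3 e4 e5 q5 q6 q7 q8 s1 s2 s3 s4 s5 s6 s7 s8 s9 s10.
by move: t1 t2 a1; clear; nlia N.
Qed.

Lemma ltn_sum_seq (F : seq G) (a b : G -> nat) x : x \in F ->
  (forall y, y \in F -> a y <= b y)%N -> (a x < b x)%N ->
  (\sum_(y <- F) a y < \sum_(y <- F) b y)%N.
Proof.
elim: F => // y F IH; rewrite inE !big_cons => xF le lt.
have ley : (a y <= b y)%N by apply: le; rewrite inE eqxx.
have leF z : z \in F -> (a z <= b z)%N by move=> zF; apply: le; rewrite inE zF orbT.
have [xF'|xF'] := boolP (x \in F); first by have := IH xF' leF lt; lia.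
move: xF; rewrite (negPf xF') orbF => /eqP <-.
suff : (\sum_(z <- F) a z <= \sum_(z <- F) b z)%N by lia.
by rewrite !big_seq; apply: leq_sum => z; exact: leF.
Qed.

(** Serre's lemma. For a base point at which the elements of [F] have minimal total
    length, [elliptic_step] leaves only elements of length at most 1, which fix one
    of the ends of the base edge. The product of an element that fixes only the
    first end and one that fixes only the second end is hyperbolic. *)
Lemma finite_fixpoint (F : seq G) : {in F, forall f, elliptic f} ->
  {in F &, forall f g, elliptic (f * g)} ->
  exists k, {in F, forall f, H1 (k^-1 * f * k)} \/ {in F, forall f, H2 (k^-1 * f * k)}.
Proof.
move=> ell1 ell2; have [N1 NV _] := NT.
pose pot k := (\sum_(f <- F) (N (k^-1 * f * k) - 1))%N.
have exk : exists n, `[< exists k, pot k = n >] by exists (pot 1); apply/asboolP; exists 1.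
case: (ex_minnP exk) => n /asboolP[k kn] minn; exists k.
have {}minn k' : (pot k <= pot k')%N by rewrite kn; apply: minn; apply/asboolP; exists k'.
have ell1k f : f \in F -> elliptic (k^-1 * f * k) by move=> fF; rewrite elliptic_conj ell1.
have ell2k f g : f \in F -> g \in F -> elliptic ((k^-1 * f * k) * (k^-1 * g * k)).
  move=> fF gF; rewrite (_ : _ * _ = k^-1 * (f * g) * k) ?elliptic_conj ?ell2 //.
  by rewrite !mulgA mulgK.
have small f : f \in F -> (N (k^-1 * f * k) <= 1)%N.
  move=> fF; rewrite leqNgt; apply/negP => big.
  have fpos : (0 < N (k^-1 * f * k))%N by apply: leq_trans big.
  have [r [r1 rf]] := geodesic fpos.
  suff : (pot (k * r)%g < pot k)%N by apply/negP; rewrite -leqNgt.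
  have cE g : (k * r)^-1 * g * (k * r) = r^-1 * (k^-1 * g * k) * r by rewrite invgM !mulgA.
  apply: (ltn_sum_seq fF) => [g gF|].
    have := elliptic_step (ell1k _ fF) (ell1k _ gF) (ell2k _ _ fF gF) big r1 rf.
    by rewrite cE; lia.
  by have [] := elliptic_reduction (ell1k _ fF) big r1 rf; rewrite cE; lia.
have [all1|/asboolP] := pselect {in F, forall f, H1 (k^-1 * f * k)}; first by left.
move/asboolP/existsNP => [f /not_implyP[fF nf1]]; right => g gF.
have /length1[//|fH2] := small _ fF.
have /length1[gH1|//] := small _ gF.
apply: contrapT => ng2.
have [H11 H1M H1V] := H1G; have [H21 H2M H2V] := H2G.
set f' := k^-1 * f * k in nf1 fH2 *; set g' := k^-1 * g * k in gH1 ng2 *.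
have far1 (x y : G) : H2 x -> ~ H1 x -> H1 y -> ~ H2 y -> N (x * y) = 2%N.
  move=> x2 x1 y1 y2; apply/eqP; rewrite eqn_leq; apply/andP; split.
    apply: leq_trans (length_mul NT x y) _.
    have /length1 xle : H1 x \/ H2 x by right.
    have /length1 yle : H1 y \/ H2 y by left.
    lia.
  rewrite ltnNge; apply/negP => /length1[xy|xy].
    by apply: x1; rewrite -(mulgK y x); apply: H1M => //; exact: H1V.
  by apply: y2; rewrite -(mulKg x y); apply: H2M => //; exact: H2V.
have lt1 (x : G) : H1 x \/ H2 x -> ~ (H1 x /\ H2 x) -> N x = 1%N.
  move=> /length1 x1 nx; apply/eqP; rewrite eqn_leq x1 /= lt0n; apply/eqP => /length0 x0.
  by apply: nx; split; [exact: H01 | exact: H02].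
have nf : N f' = 1%N by apply: lt1; [right | case].
have ng : N g' = 1%N by apply: lt1; [left | case].
have nfg : N (f' * g') = 2%N by exact: far1.
have nfgV : d f' g'^-1 = 2%N.
  by apply: far1; [exact: H2V|move=> /H1V; rewrite invgK|exact: H1V|move=> /H2V; rewrite invgK].
have := ell2k _ _ fF gF; rewrite -/f' -/g' /elliptic nfg leqNgt => /negP; apply.
have e1 : d (f' * g')^-1 (f' * g') = N ((f' * g') ^+ 2) by rewrite /dist invgK expg2.
have e2 : d (f' * g')^-1 g'^-1 = 1%N.
  by rewrite invgM dist_sym // -{1}[g'^-1]mulg1 distMl dist1 NV.
have e3 : d f' (f' * g') = 1%N by rewrite dist_mulr.
have e4 : d 1 (f' * g') = 2%N by rewrite dist1.
have e5 : d 1 (f' * g')^-1 = 2%N by rewrite dist1 NV.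
have e6 : d 1 f' = 1%N by rewrite dist1.
have e7 : d 1 g'^-1 = 1%N by rewrite dist1 NV.
have q1 := four_point NT f' g'^-1 1 (f' * g').
have q2 := four_point NT (f' * g') g'^-1 1 (f' * g')^-1.
have q3 := four_point NT f' g'^-1 1 (f' * g')^-1.
have s1 := dist_sym NT f' 1; have s2 := dist_sym NT g'^-1 1; have s3 := dist_sym NT (f' * g') 1.
have s4 := dist_sym NT (f' * g')^-1 1; have s5 := dist_sym NT g'^-1 (f' * g').
have s6 := dist_sym NT g'^-1 (f' * g')^-1; have s7 := dist_sym NT (f' * g') (f' * g')^-1.
have s8 := dist_sym NT f' (f' * g')^-1.
rewrite -e1; move: e2 e3 e4 e5 e6 e7 q1 q2 q3 s1 s2 s3 s4 s5 s6 s7 s8 nfgV; clear; dlia.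
Qed.
End Fixpoints.

(** * Subgroups over which systems are solvable *)
Section ConjSet.
Local Open Scope group_scope.
Local Open Scope classical_set_scope.
Variable G : groupType.
Implicit Types (g x : G) (P : set G).

Lemma conj_setE g P x : conj_set g P x = P (g^-1 * x * g).
Proof.
rewrite propeqE; split=> [[y Py <-]|Px]; first by rewrite !mulgA mulVg mul1g mulgVK.
by exists (g^-1 * x * g) => //; rewrite !mulgA mulgV mul1g mulgK.
Qed.

Lemma conj_setM f g P : conj_set f (conj_set g P) = conj_set (f * g) P.
Proof. by apply/funext => x; rewrite !conj_setE invgM !mulgA. Qed.

Lemma conj_set1 P : conj_set 1 P = P.
Proof. by apply/funext => x; rewrite conj_setE invg1 mul1g mulg1. Qed.
End ConjSet.

Section Dichotomy.
Local Open Scope group_scope.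
Local Open Scope classical_set_scope.
Variables (G : groupType) (N : G -> nat) (NT : tree_length N).

(** The length seen from the base point [k]. *)
Lemma tree_length_conj k : tree_length (fun g => N (k^-1 * g * k)).
Proof.
have [N1 NV N4] := NT; split=> [|x|x y z w].
- by rewrite mulg1 mulVg N1.
- by rewrite -NV !invgM !invgK !mulgA.
have e a b : k^-1 * (a^-1 * b) * k = (a * k)^-1 * (b * k) by rewrite invgM !mulgA.
by rewrite /dist !e; exact: N4.
Qed.

Hypothesis geodesic : forall g, (0 < N g)%N ->
  exists r, N r = 1%N /\ (N (r^-1 * g)).+1 = N g.

(* The members of [par] are the parabolic subgroups. *)
Variable par : set (set G).
Hypothesis par_conj : forall g P, par P -> par (conj_set g P).
Hypothesis parI : forall P Q, par P -> par Q -> par (P `&` Q).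
Hypothesis par_dcc : forall P : nat -> set G, (forall n, par (P n)) ->
  (forall n, P n.+1 `<=` P n) -> exists n, forall m, P n `<=` P m.
Hypothesis par_fix : par [set g | N g = 0%N].

Section Stable.
Variables (k h : G) (l : nat).
Local Notation N' := (fun g => N (k^-1 * g * k)).
Local Notation d := (dist N').
Local Notation p := (powz h).
Hypothesis (Nh : forall n, N' (h ^+ n) = (n * l)%N).

Let fixator i := [set q | d (q * p i) (p i) = 0%N].

Lemma par_fixator i : par (fixator i).
Proof.
rewrite (_ : fixator i = conj_set (p i * k) [set g | N g = 0%N]); first exact: par_conj.
apply/funext => q; rewrite conj_setE /fixator /=.
rewrite (dist_sym (tree_length_conj k)) /dist.
by rewrite (_ : (p i * k)^-1 * q * (p i * k) = k^-1 * ((p i)^-1 * (q * p i)) * k) // invgM !mulgA.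
Qed.

Lemma fixator_between q i (m n : nat) : (m <= n)%N ->
  fixator i q -> fixator (i + Posz n)%R q -> fixator (i + Posz m)%R q.
Proof.
move=> mn; rewrite /fixator /= => qi qn.
have NT' := tree_length_conj k.
have ai : d (p i) (p (i + Posz m)%R) = (m * l)%N by rewrite (dist_axis_nat NT' Nh).
have ab : d (p i) (p (i + Posz n)%R) = (n * l)%N by rewrite (dist_axis_nat NT' Nh).
have ib : d (p (i + Posz m)%R) (p (i + Posz n)%R) = ((n - m) * l)%N.
  by rewrite (_ : (i + Posz n = i + Posz m + Posz (n - m)%N)%R) ?(dist_axis_nat NT' Nh); lia.
have nE : (n * l = m * l + (n - m) * l)%N by rewrite -mulnDl subnKC.
have ai' : d (p i) (q * p (i + Posz m)%R) = (m * l)%N by rewrite -(dist_eq0 NT' _ qi) distMl.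
have ib' : d (q * p (i + Posz m)%R) (p (i + Posz n)%R) = ((n - m) * l)%N.
  by rewrite dist_sym // -(dist_eq0 NT' _ qn) distMl dist_sym.
apply: (dist_geodesic NT' (a := p i) (b := p (i + Posz n)%R)).
- by rewrite ai' ib' ab nE.
- by rewrite ai ib ab nE.
- by rewrite ai ai'.
Qed.

Lemma fixator_shift i j q : fixator (i + j)%R q <-> fixator j ((p i)^-1 * q * p i).
Proof.
rewrite /fixator /= powzD -!mulgA.
by rewrite -(distMl N' (p i)^-1) !mulKg.
Qed.

(** The fixators of segments of the axis are intersections of two members of [par].
    By the descending chain condition, they become constant when the segment grows
    to the right, and again when it grows to the left. Translation by powers of [h]
    makes the bound independent of the position of the segment. *)
Lemma fixator_stable : exists m0 : nat, forall q i, d (q * p i) (p i) = 0%N ->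
  d (q * p (i + Posz m0)%R) (p (i + Posz m0)%R) = 0%N -> forall j, d (q * p j) (p j) = 0%N.
Proof.
have [|n|m1 m1P] := par_dcc (P := fun n => fixator 0%R `&` fixator (0 + Posz n)%R).
- by move=> n; apply: parI; exact: par_fixator.
- by move=> q [q0 qn]; split=> //; exact: fixator_between q0 qn.
pose F := fixator 0%R `&` fixator (0 + Posz m1)%R.
have F_pos q n : F q -> fixator (Posz n) q.
  by move=> Fq; have [_] := m1P n q Fq; rewrite GRing.add0r.
have [|n|k1 k1P] := par_dcc (P := fun n => fixator (- Posz n)%R `&` fixator (Posz m1)).
- by move=> n; apply: parI; exact: par_fixator.
- move=> q [qn qm]; split=> //.
  rewrite (_ : (- Posz n = - Posz n.+1 + Posz 1)%R); last lia.
  apply: (fixator_between (n := (n.+1 + m1)%N)) => //.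
  by rewrite (_ : (- Posz n.+1 + _ = Posz m1)%R) //; lia.
have F_neg q n : F q -> fixator (- Posz n)%R q.
  move=> Fq; set q' := p (- Posz k1)%R * q * (p (- Posz k1)%R)^-1.
  have qE : q = (p (- Posz k1)%R)^-1 * q' * p (- Posz k1)%R.
    by rewrite /q' !mulgA mulVg mul1g mulgVK.
  have q'1 : fixator (- Posz k1)%R q'.
    rewrite -[X in fixator X]GRing.addr0; apply/fixator_shift; rewrite -qE.
    by case: Fq.
  have q'2 : fixator (Posz m1) q'.
    rewrite (_ : Posz m1 = (- Posz k1 + Posz (k1 + m1))%R); last lia.
    by apply/fixator_shift; rewrite -qE; exact: F_pos.
  have [] := k1P (k1 + n)%N q' (conj q'1 q'2).
  rewrite (_ : (- Posz (k1 + n)%N = - Posz k1 + - Posz n)%R); last lia.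
  by move=> /fixator_shift; rewrite -qE.
exists m1 => q i qi qm j.
have Fq : F ((p i)^-1 * q * p i).
  split; first by apply/(fixator_shift i 0%R q); rewrite GRing.addr0.
  by apply/(fixator_shift i _ q); rewrite GRing.add0r.
rewrite -/(fixator j q) (_ : j = (i + (j - i))%R); last lia.
apply/fixator_shift; case: (j - i)%R => n; first exact: F_pos.
by rewrite NegzE; exact: F_neg.
Qed.
End Stable.

Variable H : set G.
Hypothesis HG : is_subgroup H.
Hypothesis solvable1 : forall (g c : nat -> G), (forall i, H (g i)) -> (forall i, H (c i)) ->
  exists y : nat -> G, forall i, y i = g i * y i.+1 * c i * (y i.+1)^-1.
Hypothesis solvable2 : forall (g : G) n, H g -> exists y : nat -> G,
  forall i, H (y i) /\ y i = g * (y i.+1 ^+ 2) ^+ n.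

(** Otherwise 1 can be taken on the axis of [h]. Then [far_case] applies if [H]
    contains elements arbitrarily far from the axis, and [line_case] if not. *)
Theorem no_hyperbolic h : H h -> elliptic N h.
Proof.
move=> Hh; have [H1 HM HV] := HG.
have [//|/(hyperbolic_axis NT geodesic)[k [l [l0 kl]]]] := boolP (elliptic N h).
pose N' g := N (k^-1 * g * k).
have NT' : tree_length N' := tree_length_conj k.
have Nh n : N' (h ^+ n) = (n * l)%N by rewrite /N' -conjgXV.
have [m0 stable] := fixator_stable Nh.
have HX n : H (h ^+ n) by elim: n => [|n IH]; rewrite ?expg0 // expgS; exact: HM.
have [far|] := pselect (forall B, exists g, H g /\ forall j, (B < dist N' g^-1%g (powz h j))%N).
  exfalso; apply: (far_case NT' Nh l0 stable far) => g b gH.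
  by apply: solvable1 => // i; exact: HX.
move=> /existsNP[B nB]; exfalso; apply: (line_case NT' Nh l0 HM HV Hh (B := B)).
- move=> g Hg; apply: contrapT => nj; apply: nB; exists g^-1; split; first exact: HV.
  move=> j; rewrite invgK ltnNge; apply/negP => gj; apply: nj; by exists j.
- by move=> n; exact: solvable2.
Qed.
End Dichotomy.

(** * Normal forms in amalgamated sums *)
Section CommonPrefix.
Variable T : eqType.
Implicit Types u v w : seq T.

Fixpoint common_prefix u v : nat :=
  if u is x :: u' then
    if v is y :: v' then if x == y then (common_prefix u' v').+1 else 0 else 0
  else 0.

Lemma common_prefix_sym u v : common_prefix u v = common_prefix v u.
Proof. by elim: u v => [|x u IH] [|y v] //=; rewrite eq_sym IH. Qed.

Lemma common_prefix_ultra u v w :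
  minn (common_prefix u v) (common_prefix v w) <= common_prefix u w.
Proof.
elim: u v w => [|x u IH] [|y v] [|z w] //=; rewrite ?min0n ?minn0 //.
have [->|xy] := eqVneq x y; last by rewrite min0n.
by have [_|yz] := eqVneq y z; [rewrite minnSS ltnS | rewrite minn0].
Qed.

Lemma common_prefix_cat s u v :
  common_prefix (s ++ u) (s ++ v) = size s + common_prefix u v.
Proof. by elim: s => //= x s ->; rewrite eqxx. Qed.

Lemma common_suffix u v : exists a b s, [/\ u = a ++ s, v = b ++ s &
  [\/ a = [::], b = [::] | exists a' x b' y, [/\ a = rcons a' x, b = rcons b' y & x != y]]].
Proof.
elim/last_ind: u v => [|u x IH] v; first by exists [::], v, [::]; split; rewrite ?cats0 //; apply: Or31.
case/lastP: v => [|v y]; first by exists (rcons u x), [::], [::]; split; rewrite ?cats0 //; apply: Or32.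
have [<-|xy] := eqVneq x y.
  have [a [b [s [-> -> H]]]] := IH v; exists a, b, (rcons s x).
  by rewrite !rcons_cat.
exists (rcons u x), (rcons v y), [::]; split; rewrite ?cats0 //; apply: Or33.
by exists u, x, v, y.
Qed.
End CommonPrefix.

Section Amalgam.
Local Open Scope group_scope.
Local Open Scope classical_set_scope.
Variables (G : groupType) (H0 : set G) (H : bool -> set G).

(** The mapping property of [G] as the sum of [H true] and [H false] amalgamated
    along [H0], for the groups of permutations of the elements that satisfy [I]. *)
Definition extends_actions : Prop :=
  forall (Z : Type) (I : Z -> Prop) (rho : bool -> G -> Z -> Z),
    (forall i x z, H i x -> I z -> I (rho i x z)) ->
    (forall i z, I z -> rho i 1 z = z) ->
    (forall i x y z, H i x -> H i y -> I z -> rho i (x * y) z = rho i x (rho i y z)) ->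
    (forall x z, H0 x -> I z -> rho true x z = rho false x z) ->
  exists act : G -> Z -> Z, [/\ forall g z, I z -> I (act g z),
    forall z, I z -> act 1 z = z,
    forall f g z, I z -> act (f * g) z = act f (act g z) &
    forall i x z, H i x -> I z -> act x z = rho i x z].

Hypothesis H0G : is_subgroup H0.
Hypothesis HG : forall i, is_subgroup (H i).
Hypothesis H0H : forall i, H0 `<=` H i.
Hypothesis generatedH : forall P : set G, is_subgroup P -> (forall i, H i `<=` P) -> forall x, P x.
Hypothesis amalgam : extends_actions.

Let H01 : H0 1. Proof. by case: H0G. Qed.
Let H0M x y : H0 x -> H0 y -> H0 (x * y). Proof. by case: H0G => _ + _; exact. Qed.
Let H0V x : H0 x -> H0 x^-1. Proof. by case: H0G => _ _; exact. Qed.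
Let HM i x y : H i x -> H i y -> H i (x * y). Proof. by case: (HG i) => _ + _; exact. Qed.
Let HV i x : H i x -> H i x^-1. Proof. by case: (HG i) => _ _; exact. Qed.
Let H0_mulr h x : H0 h -> H0 (h * x) -> H0 x.
Proof. by move=> hH /(H0M (H0V hH)); rewrite mulgA mulVg mul1g. Qed.

Definition coset_rep (x : G) : G := xget 1 [set y | H0 (y * x^-1)].

Lemma coset_repP x : H0 (coset_rep x * x^-1).
Proof.
by have := @xgetPex _ 1 [set y | H0 (y * x^-1)]; apply; exists x; rewrite /= mulgV.
Qed.

Lemma coset_rep_eq x y : H0 (x * y^-1) -> coset_rep x = coset_rep y.
Proof.
move=> xy; congr xget; apply/seteqP; split=> z /= zx.
  by have := H0M zx xy; rewrite mulgA mulgVK.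
by have := H0M zx (H0V xy); rewrite invgM invgK mulgA mulgVK.
Qed.

Lemma coset_repM h x : H0 h -> coset_rep (h * x) = coset_rep x.
Proof. by move=> hH; apply: coset_rep_eq; rewrite mulgK. Qed.

Lemma coset_repK x : coset_rep (coset_rep x) = coset_rep x.
Proof. exact/coset_rep_eq/coset_repP. Qed.

Local Notation syllable := (bool * G)%type.
Implicit Types (r : syllable) (l : seq syllable) (z : G * seq syllable).

Definition first_type l := if l is r :: _ then Some r.1 else None.
Definition alternates : rel syllable := [rel r r' | r.1 != r'.1].
Definition alternating_word l : Prop :=
  {in l, forall r, H r.1 r.2 /\ ~ H0 r.2} /\ sorted alternates l.
Definition evalw l : G := foldr (fun r g => r.2 * g) 1 l.

Lemma evalw_cat l l' : evalw (l ++ l') = evalw l * evalw l'.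
Proof. by elim: l => [|r l IH] /=; [rewrite mul1g | rewrite IH mulgA]. Qed.

Lemma alternates_path r l : path alternates r l = (first_type l != Some r.1) && sorted alternates l.
Proof. by case: l => //= r' l; congr (_ && _); rewrite eq_sym. Qed.

Lemma alternating_cons r l : alternating_word (r :: l) <->
  [/\ H r.1 r.2, ~ H0 r.2, first_type l != Some r.1 & alternating_word l].
Proof.
split=> [[lH]|[rH r0 lr [lH sl]]].
  rewrite /= alternates_path => /andP[lr sl]; have [] := lH r; first by rewrite inE eqxx.
  by split=> //; split=> // r' r'l; apply: lH; rewrite inE r'l orbT.
split; last by rewrite /= alternates_path lr.
by move=> r'; rewrite inE => /orP[/eqP ->|/lH].
Qed.

(** The element [h * r_1 * ... * r_k] is represented by [h] in [H0] and the list of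
    the syllables [r_i], each of which is the chosen representative of its right
    coset of [H0]. *)
Definition normal l : Prop := alternating_word l /\ {in l, forall r, coset_rep r.2 = r.2}.
Definition normal_form z : Prop := H0 z.1 /\ normal z.2.

(** In [detach i z], the first component is the largest left factor of [z] in
    [H i]. Left multiplication by an element of [H i] changes this factor only, so
    that the actions of the two subgroups on normal forms agree on [H0]. This is
    van der Waerden's way to the uniqueness of normal forms. *)
Definition detach i z := if z.2 is r :: l then if r.1 == i then (z.1 * r.2, l) else z else z.
Definition attach i z :=
  if `[< H0 z.1 >] then z else (z.1 * (coset_rep z.1)^-1, (i, coset_rep z.1) :: z.2).
Definition left_mul i x z := let w := detach i z in attach i (x * w.1, w.2).

Lemma detach_id i z : first_type z.2 != Some i -> detach i z = z.
Proof. by rewrite /detach; case: z => h [|r l] //= ri; case: eqP => // e; rewrite e eqxx in ri. Qed.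

Lemma normal_detach i z : normal_form z ->
  [/\ H i (detach i z).1, normal (detach i z).2 & first_type (detach i z).2 != Some i].
Proof.
case: z => h [|r l] [hH nl]; rewrite /detach /=; first by split=> //; exact: H0H hH.
have [aw cr] := nl; have /alternating_cons[rH r0 lr aw'] := aw.
case: eqP => [ri|/eqP ri]; split=> //=.
- by rewrite -ri; apply: HM => //; exact: H0H hH.
- by split=> // r' r'l; apply: cr; rewrite inE r'l orbT.
- by rewrite -ri.
- exact: H0H hH.
Qed.

Lemma normal_attach i z : H i z.1 -> normal z.2 -> first_type z.2 != Some i ->
  normal_form (attach i z).
Proof.
case: z => y l /= yH nl li; rewrite /attach /=; case: asboolP => y0; first by [].
have cy := coset_repP y; have cH : H i (coset_rep y).
  by have := HM (H0H i cy) yH; rewrite mulgVK.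
split; first by have := H0V cy; rewrite invgM invgK.
split=> /=; last by move=> r; rewrite inE => /orP[/eqP -> /=|/nl.2//]; exact: coset_repK.
apply/alternating_cons; split=> //=; last exact: nl.1.
by move=> c0; apply: y0; have := H0M (H0V cy) c0; rewrite invgM invgK mulgVK.
Qed.

Lemma attachK i z : first_type z.2 != Some i -> detach i (attach i z) = z.
Proof.
case: z => y l /= li; rewrite /attach /=; case: asboolP => y0; first exact: detach_id.
by rewrite /detach /= eqxx mulgVK.
Qed.

Lemma detachK i z : normal_form z -> attach i (detach i z) = z.
Proof.
case: z => h [|r l] [/= hH [aw cr]]; have att l' : attach i (h, l') = (h, l').
- by rewrite /attach /=; case: asboolP.
- exact: att.
- by rewrite /attach /=; case: asboolP.
rewrite /detach /=; case: eqP => [ri|_]; last exact: att.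
have /alternating_cons[_ r0 _ _] := aw; rewrite /attach /=.
case: asboolP => [/(H0_mulr hH)//|_]; rewrite coset_repM // (cr r) ?inE ?eqxx // mulgK -ri.
by rewrite -surjective_pairing.
Qed.

Definition eval z := z.1 * evalw z.2.

Lemma eval_detach i z : eval (detach i z) = eval z.
Proof. by case: z => h [|r l] //; rewrite /detach /=; case: eqP => // _; rewrite /eval /= mulgA. Qed.

Lemma eval_attach i z : eval (attach i z) = eval z.
Proof. by rewrite /attach; case: asboolP => // _; rewrite /eval /= mulgA mulgVK. Qed.

Lemma eval_left_mul i x z : eval (left_mul i x z) = x * eval z.
Proof. by rewrite eval_attach -(eval_detach i z) /eval /= mulgA. Qed.

Lemma normal_left_mul i x z : H i x -> normal_form z -> normal_form (left_mul i x z).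
Proof. by move=> xH /(normal_detach i)[yH nl li]; apply: normal_attach => //; exact: HM. Qed.

Lemma left_mul1 i z : normal_form z -> left_mul i 1 z = z.
Proof. by move=> nz; rewrite /left_mul mul1g -surjective_pairing detachK. Qed.

Lemma left_mulM i x y z : H i x -> H i y -> normal_form z ->
  left_mul i (x * y) z = left_mul i x (left_mul i y z).
Proof.
by move=> xH yH /(normal_detach i)[_ _ li]; rewrite /left_mul attachK //= mulgA.
Qed.

Lemma left_mul0 i x z : H0 x -> normal_form z -> left_mul i x z = (x * z.1, z.2).
Proof.
case: z => h [|r l] xH [hH [aw cr]]; rewrite /left_mul /detach /=.
  by rewrite /attach /=; case: asboolP => // -[]; exact: H0M.
have /alternating_cons[_ r0 _ _] := aw.
case: eqP => [ri|_] /=; rewrite /attach /=; case: asboolP => //.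
- by rewrite mulgA => xhr; case: r0; apply: H0_mulr xhr; exact: H0M.
- move=> _; rewrite mulgA coset_repM; last exact: H0M.
  by rewrite (cr r) ?inE ?eqxx // mulgK -ri -surjective_pairing.
- by case; exact: H0M.
Qed.

Lemma normalize_exists : exists nf : G -> G * seq syllable,
  [/\ forall g, normal_form (nf g), forall g, eval (nf g) = g,
      nf 1 = (1, [::]) & forall i x g, H i x -> nf (x * g) = left_mul i x (nf g)].
Proof.
have [||||act [actI act1 actM actH]] := @amalgam _ normal_form left_mul.
- exact: normal_left_mul.
- exact: left_mul1.
- exact: left_mulM.
- by move=> x z xH nz; rewrite !left_mul0.
exists (fun g => act g (1, [::])); split.
- by move=> g; exact: actI.
- suff ev g : forall z, normal_form z -> eval (act g z) = g * eval z.
    by move=> g; rewrite ev // /eval /= !mulg1.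
  apply: (generatedH (P := [set g | forall z, normal_form z -> eval (act g z) = g * eval z])).
    split=> /= [z nz|x y xP yP z nz|x xP z nz]; first by rewrite act1 // mul1g.
      by rewrite actM // xP ?yP ?mulgA //; exact: actI.
    apply: (mulgI x); rewrite -xP; last exact: actI.
    by rewrite -actM // mulgV act1 // mulgA mulgV mul1g.
  by move=> i x xH z nz; rewrite (actH i) // eval_left_mul.
- by rewrite act1.
- by move=> i x g xH; rewrite actM // (actH i) //; exact: actI.
Qed.

Section Length.
Variable nf : G -> G * seq syllable.
Hypothesis nf_normal : forall g, normal_form (nf g).
Hypothesis nfK : forall g, eval (nf g) = g.
Hypothesis nf1 : nf 1 = (1, [::]).
Hypothesis nf_mul : forall i x g, H i x -> nf (x * g) = left_mul i x (nf g).

Let N g := size (nf g).2.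

Lemma nf_mul0 h g : H0 h -> (nf (h * g)).2 = (nf g).2.
Proof. by move=> hH; rewrite (nf_mul (i := true)) ?left_mul0 //; exact: H0H. Qed.

Lemma nf_mul_first i x g : H i x -> ~ H0 x -> first_type (nf g).2 != Some i ->
  N (x * g) = (N g).+1 /\ first_type (nf (x * g)).2 = Some i.
Proof.
move=> xH x0 gi; rewrite /N (nf_mul _ xH) /left_mul detach_id //.
have [hH _] := nf_normal g; rewrite /attach /=; case: asboolP => // xh0.
by case: x0; have := H0M xh0 (H0V hH); rewrite mulgK.
Qed.

Lemma nf_word l h : alternating_word l -> H0 h ->
  N (evalw l * h) = size l /\ first_type (nf (evalw l * h)).2 = first_type l.
Proof.
move=> + hH; elim: l => [_|r l IH /alternating_cons[rH r0 lr /IH[Nl fl]]].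
  by rewrite /= mul1g -[h]mulg1 /N nf_mul0 // nf1.
by rewrite /= -mulgA -Nl; apply: nf_mul_first => //; rewrite fl.
Qed.

Lemma length_word l h h' : alternating_word l -> H0 h -> H0 h' -> N (h * (evalw l * h')) = size l.
Proof. by move=> aw hH hH'; rewrite /N nf_mul0 //; have [] := nf_word aw hH'. Qed.

Lemma alternates_types l : sorted alternates l = sorted (fun i j => i != j) (map fst l).
Proof. by rewrite sorted_map. Qed.

Definition word_opp l := rev [seq (r.1, r.2^-1) | r <- l].

Lemma word_opp_types l : map fst (word_opp l) = rev (map fst l).
Proof. by rewrite map_rev -map_comp. Qed.

Lemma evalw_opp l : evalw (word_opp l) = (evalw l)^-1.
Proof.
elim: l => [|r l IH]; first by rewrite /= invg1.
by rewrite /word_opp /= rev_cons -cats1 evalw_cat IH invgM /= mulg1.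
Qed.

Lemma sorted_rev_types (s : seq bool) :
  sorted (fun i j => i != j) (rev s) = sorted (fun i j => i != j) s.
Proof. by rewrite rev_sorted; apply: eq_sorted => i j; rewrite eq_sym. Qed.

Lemma in_word_opp l : {in l, forall r, H r.1 r.2 /\ ~ H0 r.2} ->
  {in word_opp l, forall r, H r.1 r.2 /\ ~ H0 r.2}.
Proof.
move=> lH r; rewrite mem_rev => /mapP[r' /lH[r'H r'0] ->] /=; split; first exact: HV.
by move=> /H0V; rewrite invgK.
Qed.

Lemma alternating_opp l : alternating_word l -> alternating_word (word_opp l).
Proof.
by move=> [lH sl]; split; [exact: in_word_opp | rewrite alternates_types word_opp_types sorted_rev_types -alternates_types].
Qed.

(* Two consecutive symbols for each syllable, so that coset representatives
   of the same type share one more symbol than those of different types. *)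
Definition encode l : seq (bool + G) := flatten [seq [:: inl r.1; inr r.2] | r <- rev l].

Lemma encode_cat a s : encode (a ++ s) = encode s ++ encode a.
Proof. by rewrite /encode rev_cat map_cat flatten_cat. Qed.

Lemma size_encode s : size (encode s) = (size s).*2.
Proof.
rewrite /encode size_flatten /shape -map_comp -[size s]size_rev.
by elim: (rev s) => //= r s' ->; rewrite doubleS.
Qed.

Lemma alternating_prefix a s : alternating_word (a ++ s) -> alternating_word a.
Proof.
move=> [asH ss]; split; last by case/cat_sorted2: ss.
by move=> r ra; apply: asH; rewrite mem_cat ra.
Qed.

(** After cancellation of the common suffix of [l] and [l'], the syllables that meet
    in the middle remain side by side if their types differ. If their types agree,
    they merge into one syllable, which is not in [H0] because the representatives
    are different. *)
Lemma length_quotient_words h l h' l' : H0 h -> normal l -> H0 h' -> normal l' ->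
  (N (h * evalw l * (h' * evalw l')^-1) + common_prefix (encode l) (encode l') = size l + size l')%N.
Proof.
move=> hH [la lc] hH' [la' lc'].
have [a [b [s [lE lE' ab]]]] := common_suffix l l'.
have aw : alternating_word a by apply: (@alternating_prefix a s); rewrite -lE.
have bw : alternating_word b by apply: (@alternating_prefix b s); rewrite -lE'.
have -> : h * evalw l * (h' * evalw l')^-1 = h * ((evalw a * evalw (word_opp b)) * h'^-1).
  by rewrite lE lE' !evalw_cat evalw_opp !invgM !mulgA mulgK.
have h'V := H0V hH'.
rewrite lE lE' !encode_cat common_prefix_cat size_encode !size_cat.
have so : size (word_opp b) = size b by rewrite size_rev size_map.
case: ab => [a0|b0|[a' [x [b' [y [aE bE xy]]]]]].
- rewrite a0 /= mul1g length_word ?so //; first by move: (size b) (size s) => *; lia.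
  exact: alternating_opp.
- rewrite b0 /= mulg1 length_word //.
  by rewrite (_ : common_prefix _ _ = 0%N); [move: (size a) (size s) => *; lia | case: (encode a)].
have xa : x \in a by rewrite aE mem_rcons inE eqxx.
have yb : y \in b by rewrite bE mem_rcons inE eqxx.
have [xH x0] := aw.1 _ xa; have [yH y0] := bw.1 _ yb.
have e0 : common_prefix (encode a) (encode b) = (x.1 == y.1).
  rewrite aE bE /encode !rev_rcons /= (_ : (inl x.1 == inl y.1) = (x.1 == y.1)) //.
  case: eqP => // e; case: eqP => // -[e2].
  by case/eqP: xy; rewrite [x]surjective_pairing e e2 -surjective_pairing.
rewrite e0; have [e|ne] := eqVneq x.1 y.1.
  pose r := (x.1, x.2 * y.2^-1).
  have -> : evalw a * evalw (word_opp b) = evalw (a' ++ r :: word_opp b').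
    rewrite aE bE /word_opp map_rcons rev_rcons evalw_cat /= -!cats1 evalw_cat /=.
    by rewrite mulg1 !mulgA.
  rewrite length_word //; first by rewrite aE bE !size_cat /= !size_rcons size_rev size_map; move: (size a') (size b') (size s) => *; lia.
  split.
    move=> r'; rewrite mem_cat inE => /or3P[ra|/eqP ->|ra] /=.
    - by apply: aw.1; rewrite aE mem_rcons inE ra orbT.
    - split; first by apply: HM => //; rewrite e; exact: HV.
      move=> /coset_rep_eq; rewrite lc ?lE ?mem_cat ?xa // lc' ?lE' ?mem_cat ?yb // => e2.
      by case/eqP: xy; rewrite [x]surjective_pairing e e2 -surjective_pairing.
    - apply: in_word_opp ra => r2 r2b; apply: bw.1.
      by rewrite bE mem_rcons inE r2b orbT.
  rewrite alternates_types map_cat /= sorted_cat_cons word_opp_types.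
  have := aw.2; rewrite alternates_types aE map_rcons => ->.
  have := bw.2; rewrite alternates_types bE map_rcons -sorted_rev_types rev_rcons /= e.
  by [].
rewrite -evalw_cat length_word //; first by rewrite size_cat so; move: (size a) (size b) (size s) => *; lia.
have [bH' bs'] := alternating_opp bw; split.
  by move=> r; rewrite mem_cat => /orP[/aw.1|/bH'].
have := bs'; rewrite !alternates_types map_cat word_opp_types bE map_rcons rev_rcons /=.
rewrite aE map_rcons cat_rcons sorted_cat_cons /= ne => ->.
by rewrite !andbT; have := aw.2; rewrite alternates_types aE map_rcons.
Qed.

Lemma length_quotient f g :
  (N (f * g^-1) + common_prefix (encode (nf f).2) (encode (nf g).2) = N f + N g)%N.
Proof.
have [fH fn] := nf_normal f; have [gH gn] := nf_normal g.
by rewrite -(length_quotient_words fH fn gH gn) -/(eval (nf f)) -/(eval (nf g)) !nfK.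
Qed.

Lemma lengthV g : N g^-1 = N g.
Proof.
have := length_quotient 1 g; rewrite mul1g /N nf1 /=.
by rewrite addn0.
Qed.

(** By [length_quotient], distances are sums of lengths minus the lengths of common
    prefixes, and the four-point condition is the ultrametric inequality for common
    prefixes. *)
Lemma tree_length_amalgam : tree_length N.
Proof.
split; [by rewrite /N nf1 | exact: lengthV|].
move=> x y z w; pose L x y := common_prefix (encode (nf x^-1).2) (encode (nf y^-1).2).
have dE u v : (dist N u v + L u v = N u^-1 + N v^-1)%N.
  by rewrite -(length_quotient u^-1 v^-1) invgK.
have LC u v : L u v = L v u by exact: common_prefix_sym.
have LU u v t : (minn (L u v) (L v t) <= L u t)%N by exact: common_prefix_ultra.
move: (dE x y) (dE z w) (dE x z) (dE y w) (dE x w) (dE y z).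
move: (LU x z y) (LU x w y) (LU z x w) (LU z y w).
rewrite ?(LC y x) ?(LC z x) ?(LC z y) ?(LC w x) ?(LC w y) ?(LC w z).
move: (L x y) (L x z) (L x w) (L y z) (L y w) (L z w).
by nlia N.
Qed.

Lemma length0_amalgam g : N g = 0%N <-> H0 g.
Proof.
split=> [|gH]; last by rewrite /N -[g]mulg1 nf_mul0 // nf1.
have [hH _] := nf_normal g; rewrite /N -{2}(nfK g) /eval.
by case: (nf g).2 => //= _; rewrite mulg1.
Qed.

Lemma length1_amalgam g : (N g <= 1)%N <-> H true g \/ H false g.
Proof.
have le1 i x : H i x -> (N x <= 1)%N.
  move=> xH; rewrite /N -[x]mulg1 (nf_mul _ xH) nf1 /left_mul /attach /=.
  by case: asboolP.
split=> [|[]]; try exact: le1.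
have [hH [aw _]] := nf_normal g; rewrite /N -{2 3}(nfK g) /eval.
case: (nf g) hH aw => h [|[i r] [|//]] /= hH.
  by rewrite mulg1; left; exact: H0H.
move=> /alternating_cons[/= rH _ _ _] _; rewrite mulg1.
by case: i rH => rH; [left|right]; apply: HM => //; exact: H0H.
Qed.

Lemma geodesic_amalgam g : (0 < N g)%N -> exists k, N k = 1%N /\ (N (k^-1 * g)).+1 = N g.
Proof.
have [hH [aw _]] := nf_normal g; rewrite {1 3}/N.
case E: (nf g) hH aw => [h [|r l]] //= hH aw _; exists (h * r.2).
have /alternating_cons[rH r0 _ aw'] := aw; split.
  have := @length_word [:: r] h 1; rewrite /= !mulg1; apply=> //.
  by apply/alternating_cons; split.
have -> : (h * r.2)^-1 * g = 1 * (evalw l * 1).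
  by rewrite -[g]nfK E /eval /= invgM !mulgA mulgVK mulVg mulg1.
by have := length_word aw' H01 H01; rewrite /N E => ->.
Qed.
End Length.

(** In the Bass-Serre tree, [N g] is the number of vertices that separate the base
    edge from its translate by [g]. *)
Theorem amalgam_length : exists N : G -> nat,
  [/\ tree_length N,
    forall g, (0 < N g)%N -> exists k, N k = 1%N /\ (N (k^-1 * g)).+1 = N g,
    forall g, N g = 0%N <-> H0 g,
    forall g, (N g <= 1)%N <-> H true g \/ H false g &
    forall l, alternating_word l -> N (evalw l) = size l].
Proof.
have [nf [nfn nfK nf1 nfM]] := normalize_exists; exists (fun g => size (nf g).2); split.
- exact: tree_length_amalgam.
- exact: geodesic_amalgam.
- exact: length0_amalgam.
- exact: length1_amalgam.
by move=> l aw; have := length_word nfn nf1 nfM aw H01 H01; rewrite mul1g mulg1.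
Qed.
End Amalgam.

(** * The geometric representation of a Coxeter group *)
Section Chebyshev.
Import Order.TTheory GRing.Theory Num.Theory.
Local Open Scope ring_scope.
Variable R : realFieldType.
(** The Chebyshev polynomials of the second kind, with
    [cheb (2 cos t) n = sin (n t) / sin t]. *)
Fixpoint cheb2 (x : R) (n : nat) : R * R :=
  if n is m.+1 then let: (a, b) := cheb2 x m in (b, x * b - a) else (0, 1).
Definition cheb x n : R := (cheb2 x n).1.
Lemma cheb0 x : cheb x 0 = 0. Proof. by []. Qed.
Lemma cheb1 x : cheb x 1 = 1. Proof. by []. Qed.
Lemma chebSS x n : cheb x n.+2 = x * cheb x n.+1 - cheb x n.
Proof. by rewrite /cheb /=; case: (cheb2 x n). Qed.

Lemma cheb_two n : cheb 2 n = n%:R.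
Proof.
suff [] : cheb 2 n = n%:R /\ cheb 2 n.+1 = n.+1%:R by [].
elim: n => [|n [IH1 IH2]]; first by [].
by split=> //; rewrite chebSS IH1 IH2; ring.
Qed.

(** The properties of [x = 2 cos (pi / m)], read as [x = 2] if [m = 0], that the
    geometric representation uses. *)
Definition dihedral_cos (m : nat) (x : R) : Prop :=
  (forall n, (0 < n)%N -> (m == 0)%N || (n < m)%N -> 0 < cheb x n) /\
  ((0 < m)%N -> [/\ (2 <= m)%N, cheb x m = 0 & cheb x m.-1 = 1]).

Lemma dihedral_cos_infinite : dihedral_cos 0 2.
Proof. by split=> // n n0 _; rewrite cheb_two ltr0n. Qed.
End Chebyshev.

Section Alternating.
Variable S : Type.
Fixpoint alt (a b : S) (n : nat) : seq S :=
  if n is n'.+1 then a :: alt b a n' else [::].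
Lemma size_alt a b n : size (alt a b n) = n.
Proof. by elim: n a b => //= n IH a b; rewrite IH. Qed.
Lemma alt_cat a b m n : alt a b (m + n) =
  alt a b m ++ (if odd m then alt b a n else alt a b n).
Proof. by elim: m a b => //= m IH a b; rewrite IH; case: (odd m). Qed.
Lemma take_alt a b m n : m <= n -> take m (alt a b n) = alt a b m.
Proof. by move=> mn; rewrite -(subnKC mn) alt_cat take_size_cat ?size_alt. Qed.
End Alternating.

Section Reflections.
Import Order.TTheory GRing.Theory Num.Theory.
Local Open Scope ring_scope.
Variables (R : realFieldType) (S : finType) (m : S -> S -> nat) (K : S -> S -> R).
Hypothesis KC : forall s t, K s t = K t s.
Hypothesis Kss : forall s, K s s = 2.
Hypothesis Kcos : forall s t, s != t -> dihedral_cos (m s t) (- K s t).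

Local Notation V := {ffun S -> R}.
Implicit Types (v w : V) (u : seq S).

(** The simple roots [sroot s] form a basis, and [K] is the matrix of an invariant
    symmetric form. The value of [m] is 0 if the product of two reflections has
    infinite order. *)
Definition sroot (s : S) : V := [ffun t => (t == s)%:R].
Definition coroot (s : S) v : R := \sum_t K s t * v t.
Definition refl (s : S) v : V := [ffun t => v t - (t == s)%:R * coroot s v].
Definition lin (a : R) v (b : R) w : V := [ffun t => a * v t + b * w t].

Lemma coroot_lin s a v b w : coroot s (lin a v b w) = a * coroot s v + b * coroot s w.
Proof.
rewrite /coroot !mulr_sumr -big_split; apply: eq_bigr => t _.
by rewrite ffunE /=; ring.
Qed.

Lemma coroot_root s t : coroot s (sroot t) = K s t.
Proof.
rewrite /coroot (bigD1 t) //= ffunE eqxx mulr1 big1 ?addr0 // => r /negPf rt.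
by rewrite ffunE rt mulr0.
Qed.

Lemma coroot_refl r s v : coroot r (refl s v) = coroot r v - K r s * coroot s v.
Proof.
have -> : refl s v = lin 1 v (- coroot s v) (sroot s).
  by apply/ffunP => t; rewrite !ffunE; ring.
by rewrite coroot_lin coroot_root; ring.
Qed.

Lemma reflK s : involutive (refl s).
Proof.
by move=> v; apply/ffunP => t; rewrite ffunE coroot_refl Kss ffunE; ring.
Qed.

Lemma refl_lin s a v b w : refl s (lin a v b w) = lin a (refl s v) b (refl s w).
Proof. by apply/ffunP => t; rewrite !ffunE coroot_lin; ring. Qed.

Lemma refl_root s : refl s (sroot s) = lin (-1) (sroot s) 0 (sroot s).
Proof. by apply/ffunP => t; rewrite !ffunE coroot_root Kss; ring. Qed.

(* The letters of a word are applied from the first one to the last one. *)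
Definition act u v : V := foldl (fun v s => refl s v) v u.

Lemma act_cat u1 u2 v : act (u1 ++ u2) v = act u2 (act u1 v).
Proof. by rewrite /act foldl_cat. Qed.

Lemma act_lin u a v b w : act u (lin a v b w) = lin a (act u v) b (act u w).
Proof. by elim: u v w => //= s u IH v w; rewrite refl_lin IH. Qed.

Lemma actK u : cancel (act u) (act (rev u)).
Proof.
elim: u => // s u IH v; rewrite rev_cons -cats1 act_cat.
by rewrite -[act (s :: u) v]/(act u (refl s v)) IH /act /= reflK.
Qed.

Lemma actVK u : cancel (act (rev u)) (act u).
Proof. by move=> v; rewrite -{1}[u]revK actK. Qed.

Definition bform v w : R := \sum_s v s * coroot s w.

Lemma form_root s w : bform (sroot s) w = coroot s w.
Proof.
rewrite /bform (bigD1 s) //= ffunE eqxx mul1r big1 ?addr0 // => r /negPf rt.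
by rewrite ffunE rt mul0r.
Qed.

Lemma form_refl s v w : bform (refl s v) (refl s w) = bform v w.
Proof.
have adj v' w' : bform v' (refl s w') = bform (refl s v') w'.
  transitivity (bform v' w' - coroot s v' * coroot s w').
    rewrite /bform (eq_bigr (fun r => v' r * coroot r w' + (K s r * v' r) * - coroot s w')).
      by rewrite big_split -mulr_suml /= mulrN.
    by move=> r _; rewrite coroot_refl KC; ring.
  rewrite -(form_root s w') /bform mulr_sumr -sumrB; apply: eq_bigr => r _.
  by rewrite !ffunE; ring.
by rewrite -adj reflK.
Qed.

Lemma form_act u v w : bform (act u v) (act u w) = bform v w.
Proof. by elim: u v w => //= s u IH v w; rewrite IH form_refl. Qed.

Lemma refl_plane a b x y : a != b ->
  refl a (lin x (sroot a) y (sroot b)) = lin (- K a b * y - x) (sroot a) y (sroot b).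
Proof.
move=> ab; apply/ffunP => t; rewrite !ffunE coroot_lin !coroot_root Kss.
by ring.
Qed.

Lemma linC a v b w : lin a v b w = lin b w a v.
Proof. by apply/ffunP => t; rewrite !ffunE addrC. Qed.

(** The coordinates of the successive images form a sequence of Chebyshev
    polynomials, which is shifted by one at each reflection. *)
Lemma act_alt a b n k : a != b -> let U := cheb (- K a b) in
  act (alt a b n) (lin (U k) (sroot a) (U k.+1) (sroot b)) =
  if odd n then lin (U (k + n).+1) (sroot a) (U (k + n)%N) (sroot b)
  else lin (U (k + n)%N) (sroot a) (U (k + n).+1) (sroot b).
Proof.
elim: n a b k => [|n IH] a b k ab U; first by rewrite addn0.
rewrite -[LHS]/(act (alt b a n) (refl a (lin (U k) (sroot a) (U k.+1) (sroot b)))).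
rewrite refl_plane // -chebSS linC.
have := IH b a k.+1; rewrite eq_sym KC => /(_ ab) -> /=.
by rewrite -/U addnS addSn; case: (odd n); rewrite linC.
Qed.

Lemma act_alt_max a b : a != b -> (0 < m a b)%N ->
  act (alt a b (m a b)) (sroot a) = lin (-1) (if odd (m a b) then sroot b else sroot a) 0 (sroot a) /\
  act (alt a b (m a b)) (sroot b) = lin (-1) (if odd (m a b) then sroot a else sroot b) 0 (sroot a).
Proof.
move=> ab m0; have [_ /(_ m0)[m2 Um Um1]] := Kcos ab.
have UmS : cheb (- K a b) (m a b).+1 = -1.
  by case: (m a b) m0 Um Um1 => // n _ /= Um Um1; rewrite chebSS Um Um1; ring.
have rootE c d : sroot c = lin (cheb (- K d c) 0) (sroot d) (cheb (- K d c) 1) (sroot c).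
  by apply/ffunP => t; rewrite !ffunE cheb0 cheb1; ring.
split; last first.
  rewrite (rootE b a) act_alt // !add0n Um UmS.
  by case: (odd _); apply/ffunP => t; rewrite !ffunE ?cheb0 ?cheb1; ring.
have -> : alt a b (m a b) = a :: alt b a (m a b).-1 by case: (m a b) m0.
rewrite -[LHS]/(act _ (refl a (sroot a))) refl_root act_lin (rootE a b) act_alt 1?eq_sym // !add0n.
have -> : odd (m a b) = ~~ odd (m a b).-1 by case: (m a b) m0.
rewrite (KC b) Um1 prednK // Um.
by case: (odd _); apply/ffunP => t; rewrite !ffunE ?cheb0 ?cheb1; ring.
Qed.

(** The form is nondegenerate on the plane of the two roots, so every vector is the
    sum of a vector of this plane and a vector fixed by both reflections. *)
Lemma braid_act a b v : a != b -> m b a = m a b -> (0 < m a b)%N ->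
  act (alt a b (m a b)) v = act (alt b a (m a b)) v.
Proof.
move=> ab mC m0; have [pos /(_ m0)[m2 Um Um1]] := Kcos ab.
set c := - K a b in pos Um Um1.
have c_ge0 : 0 <= c.
  move: m2; rewrite leq_eqVlt => /orP[/eqP m2|m2].
    by move: Um; rewrite -m2 chebSS cheb1 cheb0; lra.
  by have := pos 2%N isT; rewrite m2 orbT chebSS cheb1 cheb0 => /(_ isT); lra.
have c_neq2 : c != 2.
  by apply/eqP => c2; move/eqP: Um; rewrite c2 cheb_two pnatr_eq0 -leqn0 leqNgt m0.
have det : 4 - c ^+ 2 != 0.
  by rewrite subr_eq0; apply/eqP => c4; move/eqP: c_neq2; apply; nra.
pose x := (c * coroot b v + 2 * coroot a v) / (4 - c ^+ 2).
pose y := (c * coroot a v + 2 * coroot b v) / (4 - c ^+ 2).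
pose v0 := lin 1 v (-1) (lin x (sroot a) y (sroot b)).
have vE : v = lin 1 v0 1 (lin x (sroot a) y (sroot b)).
  by apply/ffunP => t; rewrite !ffunE; ring.
have v0a : refl a v0 = v0.
  apply/ffunP => t; rewrite ffunE !coroot_lin !coroot_root Kss -[K a b]opprK -/c.
  suff -> : 1 * coroot a v + -1 * (x * 2 + y * - c) = 0 by ring.
  by rewrite /x /y; field.
have v0b : refl b v0 = v0.
  apply/ffunP => t; rewrite ffunE !coroot_lin !coroot_root Kss KC -[K a b]opprK -/c.
  suff -> : 1 * coroot b v + -1 * (x * - c + y * 2) = 0 by ring.
  by rewrite /x /y; field.
have fix0 n a' b' : refl a' v0 = v0 -> refl b' v0 = v0 -> act (alt a' b' n) v0 = v0.
  by elim: n a' b' => //= n IH a' b' h1 h2; rewrite h1 IH.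
rewrite vE !(act_lin _ _ v0) !fix0 // !act_lin.
have [-> ->] := act_alt_max ab m0.
have ba : b != a by rewrite eq_sym.
have [|] := @act_alt_max b a ba; first by rewrite mC.
rewrite mC => -> ->.
by case: (odd _); apply/ffunP => t; rewrite !ffunE; ring.
Qed.

Hypothesis mC : forall a b, m a b = m b a.

Definition nonneg v : Prop := forall t, 0 <= v t.
Definition nonpos v : Prop := forall t, v t <= 0.

Lemma nonneg_lin a v b w : 0 <= a -> 0 <= b -> nonneg v -> nonneg w -> nonneg (lin a v b w).
Proof. by move=> a0 b0 v0 w0 t; rewrite ffunE addr_ge0 // mulr_ge0. Qed.

Definition same_act u u' : Prop := forall v, act u v = act u' v.
Definition reduced u : Prop := forall u', same_act u' u -> (size u <= size u')%N.

Lemma reduced_exists u : exists u', same_act u' u /\ reduced u'.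
Proof.
have exn : exists n, `[< exists u', same_act u' u /\ size u' = n >].
  by exists (size u); apply/asboolP; exists u.
case: (ex_minnP exn) => n /asboolP[u' [u'u u'n]] minn; exists u'; split=> // w wu'.
by rewrite u'n; apply: minn; apply/asboolP; exists w; split=> // v; rewrite wu' u'u.
Qed.

Lemma pair_word_alt a b d : {subset d <= [:: a; b]} ->
  [\/ d = alt a b (size d), d = alt b a (size d) |
   exists2 d', (size d' < size d)%N & same_act d' d].
Proof.
elim: d => [|x d IH] sub; first by apply: Or31.
have subd : {subset d <= [:: a; b]} by move=> y yd; apply: sub; rewrite inE yd orbT.
have [dE|dE|[d' d'd sd]] := IH subd.
- have : x \in [:: a; b] by apply: sub; rewrite inE eqxx.
  rewrite !inE => /orP[]/eqP ->; last by apply: Or32; rewrite /= -dE.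
  case: d dE {IH sub subd} => [|y d] dE; first by apply: Or31.
  apply: Or33; exists d; first by rewrite /= ltnW.
  by move=> v; case: dE => -> _; rewrite /act /= reflK.
- have : x \in [:: a; b] by apply: sub; rewrite inE eqxx.
  rewrite !inE => /orP[]/eqP ->; first by apply: Or31; rewrite /= -dE.
  case: d dE {IH sub subd} => [|y d] dE; first by apply: Or32.
  apply: Or33; exists d; first by rewrite /= ltnW.
  by move=> v; case: dE => -> _; rewrite /act /= reflK.
by apply: Or33; exists (x :: d'); rewrite // => v; exact: sd.
Qed.

(** Induction on the length. If [t] is the first letter of the reduced word [u],
    then [u] is a word [d] in [s] and [t] followed by a word [v] to which the
    induction hypothesis applies for [s] and for [t]. The word [d] alternates and
    is shorter than [m s t], hence maps [sroot s] to a nonnegative combination of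
    [sroot s] and [sroot t]. *)
Lemma root_nonneg n u s : size u = n -> reduced u ->
  (forall u', same_act u' (s :: u) -> (size u <= size u')%N) -> nonneg (act u (sroot s)).
Proof.
elim/ltn_ind: n u s => n IH [|t u0] s un ured sured.
  by move=> t; rewrite ffunE; case: (_ == _).
set u := t :: u0 in un ured sured *.
have ts : t != s.
  apply/eqP => ts; have := sured u0; rewrite ltnn => H.
  suff : false by []; apply: H => v; by rewrite /u ts /act /= reflK.
have exk : exists k, `[< exists (d v : seq S), [/\ {subset d <= [:: t; s]}, size v = k,
    (size d + size v)%N = size u & same_act (d ++ v) u] >].
  exists (size u0); apply/asboolP; exists [:: t], u0; split=> //.
  by move=> x; rewrite !inE => ->.
case: (ex_minnP exk) => k /asboolP[d [v [dts vk dvu dvE]]] mink.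
have ku0 : (k <= size u0)%N.
  apply: mink; apply/asboolP; exists [:: t], u0; split=> //.
  by move=> x; rewrite !inE => ->.
have vred : reduced v.
  move=> v' v'v; have := ured (d ++ v'); rewrite size_cat -dvu leq_add2l; apply.
  by move=> w; rewrite -dvE !act_cat v'v.
have vmin r : r \in [:: t; s] -> forall u', same_act u' (r :: v) -> (size v <= size u')%N.
  move=> rts u' u'v; rewrite leqNgt; apply/negP => lt.
  have E : same_act (rcons d r ++ u') u.
    move=> w; rewrite -dvE -cats1 !act_cat u'v.
    by rewrite /act /= reflK.
  have := ured _ E; rewrite size_cat size_rcons -dvu => le.
  suff : (k <= size u')%N by rewrite -vk; lia.
  apply: mink; apply/asboolP; exists (rcons d r), u'; split=> //.
    by move=> x; rewrite mem_rcons inE => /orP[/eqP ->|/dts].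
  by rewrite size_rcons -dvu; lia.
have nonneg_v r : r \in [:: t; s] -> nonneg (act v (sroot r)).
  move=> rts; apply: (IH (size v)) => //; last exact: vmin.
  by rewrite -un vk /=; lia.
have dred d' : same_act d' d -> (size d <= size d')%N.
  move=> d'd; have := ured (d' ++ v); rewrite size_cat -dvu leq_add2r; apply.
  by move=> w; rewrite -dvE !act_cat d'd.
have dnots d' : (size d' < size d)%N -> ~ same_act (s :: d') d.
  move=> d'd sd; have := sured (d' ++ v); rewrite size_cat -dvu leq_add2r leqNgt d'd => H.
  suff : false by []; apply: H => w.
  by rewrite -[RHS]/(act u (refl s w)) -dvE !act_cat -sd /act /= reflK.
have d0 : (0 < size d)%N by move: dvu; rewrite vk /u /=; lia.
have dE : d = alt t s (size d).
  have [//|dE|[d' d'd sd]] := pair_word_alt dts; last by move: d'd; rewrite ltnNge dred.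
  exfalso; apply: (dnots (alt t s (size d).-1)).
    by rewrite size_alt; case: (size d) d0.
  by rewrite {2}dE; case: (size d) d0.
have ts0 : (m t s == 0)%N || (size d < m t s)%N.
  rewrite -implyNb -lt0n; apply/implyP => m0; rewrite ltnNge; apply/negP => md.
  have dE' : d = alt t s (m t s) ++ drop (m t s) d.
    by rewrite -{1}(cat_take_drop (m t s) d); congr (_ ++ _); rewrite dE take_alt.
  apply: (dnots (behead (alt s t (m t s)) ++ drop (m t s) d)).
    rewrite size_cat size_behead size_alt size_drop; lia.
  move=> w; rewrite [in RHS]dE' act_cat (braid_act _ ts (mC _ _) m0) -act_cat.
  by case: (m t s) m0.
rewrite -/u -dvE.
have -> : act (d ++ v) (sroot s) = act v (act d (sroot s)) by rewrite act_cat.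
have rs : sroot s = lin (cheb (- K t s) 0) (sroot t) (cheb (- K t s) 1) (sroot s).
  by apply/ffunP => r; rewrite !ffunE cheb0 cheb1; ring.
rewrite dE rs act_alt //.
have [pos fin] := Kcos ts.
have cd : 0 <= cheb (- K t s) (size d) by apply/ltW/pos.
have cdS : 0 <= cheb (- K t s) (size d).+1.
  have [/andP[m0 /eqP md]|lt] : (0 < m t s)%N && ((size d).+1 == m t s) \/
      ((m t s == 0)%N || ((size d).+1 < m t s)%N) by lia.
    by rewrite md; have [_ -> _] := fin m0.
  exact/ltW/pos.
by rewrite add0n; case: (odd _); rewrite act_lin; apply: nonneg_lin => //;
  apply: nonneg_v; rewrite !inE eqxx ?orbT.
Qed.

(** If [root_nonneg] does not apply to [u], it applies to a word for [s :: u], which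
    maps [sroot s] to the opposite root. *)
Lemma root_sign u s : nonneg (act u (sroot s)) \/ nonpos (act u (sroot s)).
Proof.
have [u' [u'u ured]] := reduced_exists u; rewrite -u'u => {u u'u}; move: u' ured => u ured.
have [H|] := pselect (forall u', same_act u' (s :: u) -> (size u <= size u')%N).
  by left; exact: root_nonneg H.
move=> /existsNP[u1 /not_implyP[u1E /negP]]; rewrite -ltnNge => lt.
have [w [wu1 wred]] := reduced_exists u1; right.
have wu : (size w < size u)%N by apply: leq_ltn_trans lt; exact: wred.
have : nonneg (act w (sroot s)).
  apply: root_nonneg wred _ => // w' w'E; apply: leq_trans (ltnW wu) _; apply: ured => v.
  by rewrite w'E -[LHS]/(act w (refl s v)) wu1 u1E /act /= reflK.
rewrite wu1 u1E -[act (s :: u) _]/(act u (refl s (sroot s))) refl_root act_lin => pos t.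
by have := pos t; rewrite !ffunE; lra.
Qed.

End Reflections.

(** * Words acting on minimal coset representatives *)
Section AltMore.
Variable S : Type.
Lemma rev_alt (a b : S) n : rev (alt a b n) = if odd n then alt a b n else alt b a n.
Proof.
elim: n a b => // n IH a b /=; rewrite rev_cons -cats1 IH.
have e (c d : S) : alt c d n ++ [:: if odd n then d else c] = alt c d n.+1.
  by rewrite -addn1 alt_cat; case: (odd n).
by case on: (odd n) => /=; have := e b a; have := e a b; rewrite on //= => e1 e2; rewrite ?e1 ?e2.
Qed.
End AltMore.

Section CosetAction.
Import Order.TTheory GRing.Theory Num.Theory.
Local Open Scope ring_scope.
Variables (R : realFieldType) (S : finType) (m : S -> S -> nat) (K : S -> S -> R).
Hypothesis KC : forall s t, K s t = K t s.
Hypothesis Kss : forall s, K s s = 2.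
Hypothesis Kcos : forall s t, s != t -> dihedral_cos (m s t) (- K s t).
Hypothesis mC : forall a b, m a b = m b a.

Local Notation V := {ffun S -> R}.
Local Notation sroot := (@sroot R S).
Local Notation refl := (@refl R S K).
Local Notation act := (@act R S K).

Lemma dihedral_cos_inj n1 n2 (x : R) : dihedral_cos n1 x -> dihedral_cos n2 x -> n1 = n2.
Proof.
have lt k1 k2 : dihedral_cos k1 x -> dihedral_cos k2 x -> (0 < k1)%N ->
    ((k2 == 0)%N || (k1 < k2)%N) -> False.
  move=> [_ /(_ _)] /[swap] -[pos _] + k10 lt => /(_ k10)[_ z _].
  by have := pos _ k10 lt; rewrite z ltxx.
move=> d1 d2; have [l|l|//] := ltngtP n1 n2; exfalso.
  have [n10|n10] := posnP n1; last by apply: (lt n1 n2) => //; rewrite l orbT.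
  by apply: (lt n2 n1) => //; [rewrite -n10 | rewrite n10].
have [n20|n20] := posnP n2; last by apply: (lt n2 n1) => //; rewrite l orbT.
by apply: (lt n1 n2) => //; [rewrite -n20 | rewrite n20].
Qed.

Lemma root_inj : injective sroot.
Proof.
move=> s t /ffunP/(_ s); rewrite !ffunE eqxx; case: eqP => // _ /eqP.
by rewrite oner_eq0.
Qed.

Lemma refl_root_neq s : refl s (sroot s) <> sroot s.
Proof.
by rewrite refl_root // => /ffunP/(_ s); rewrite !ffunE eqxx /=; lra.
Qed.

Lemma form_act_root u s t : bform K (act u (sroot s)) (act u (sroot t)) = K s t.
Proof. by rewrite form_act // form_root coroot_root. Qed.

Lemma act_inj u : injective (act u).
Proof. exact: can_inj (actK Kss u). Qed.

Lemma act_root_multiple u s t x : 0 <= x -> act u (sroot t) = lin x (sroot s) 0 (sroot s) ->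
  act u (sroot t) = sroot s.
Proof.
move=> x0 bE; have := form_act_root u t t; rewrite Kss bE.
have -> : bform K (lin x (sroot s) 0 (sroot s)) (lin x (sroot s) 0 (sroot s)) = 2 * x ^+ 2.
  rewrite /bform (bigD1 s) //= big1 => [|r /negPf rs].
    by rewrite coroot_lin coroot_root Kss !ffunE eqxx /=; ring.
  by rewrite !ffunE rs /=; ring.
move=> x2; have {x2 x0} -> : x = 1 by nra.
by apply/ffunP => r; rewrite !ffunE; ring.
Qed.

(** A reflection permutes the nonnegative roots other than its own. *)
(** The reflection changes only the coordinate [s]. A positive root other than
    [sroot s] has another positive coordinate, so its image is not negative. *)
Lemma refl_nonneg u s t : nonneg (act u (sroot t)) -> act u (sroot t) <> sroot s ->
  nonneg (refl s (act u (sroot t))).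
Proof.
move=> b0 bs.
have [] := root_sign KC Kss Kcos mC (rcons u s) t; rewrite -cats1 act_cat //= => neg.
exfalso; apply: bs; apply: (act_root_multiple (x := act u (sroot t) s)); first exact: b0.
apply/ffunP => r; rewrite !ffunE; have [-> |rs] := eqVneq r s; first by rewrite /=; ring.
have := neg r; have := b0 r; rewrite ffunE (negPf rs) /= => *; lra.
Qed.

Variables (Y : {set S}) (G : groupType) (gen : S -> G).

(** Let [w] be the minimal representative of a coset of [W_Y] in the Coxeter group,
    so that [w] keeps the roots [sroot y] positive. For a letter [s], either [w * s]
    is a minimal representative as well, or [w * s = y * w] for some [y] in [Y], which
    means that [w] takes [sroot y] to [sroot s]. A state [(f, a)] consists of the
    action [f] of [w] and an element [a], which collects the generators [gen y] that
    come out on the left. *)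
Definition state := ((V -> V) * G)%type.
Implicit Types (f : V -> V).

Definition blocker f (s : S) : option S := [pick y in Y | f (sroot y) == sroot s].

Definition step (z : state) (x : S * bool) : state :=
  if blocker z.1 x.1 is Some y
  then (z.1, (z.2 * (if x.2 then gen y else (gen y)^-1))%g)
  else (fun v => refl x.1 (z.1 v), z.2).

Definition minimal f : Prop :=
  (exists u, forall v, f v = act u v) /\ forall y, y \in Y -> nonneg (f (sroot y)).

Lemma minimal_refl f s : minimal f -> blocker f s = None -> minimal (fun v => refl s (f v)).
Proof.
move=> [[u fE] pos]; rewrite /blocker; case: pickP => // nb _; split.
  by exists (rcons u s) => v; rewrite -cats1 act_cat fE.
move=> y yY; rewrite fE; apply: refl_nonneg; rewrite -fE; first exact: pos.
by apply/eqP; have := nb y; rewrite yY /= => ->.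
Qed.

Lemma step_minimal z x : minimal z.1 -> minimal (step z x).1.
Proof. by move=> zm; rewrite /step; case E: blocker => //=; exact: minimal_refl. Qed.

Lemma step_cancel z s b : minimal z.1 -> step (step z (s, b)) (s, ~~ b) = z.
Proof.
move=> zm; rewrite {2}/step; case E: blocker => [y|] /=.
  rewrite /step /= E /=; case: z {zm E} => f a /=; congr (_, _).
  by case: b => /=; rewrite ?mulgK ?mulgVK.
have [[u fE] pos] := zm.
rewrite /step /= (_ : blocker _ s = None) /=.
  by case: z {zm E fE pos} => f a /=; congr (_, _); apply/funext => v; rewrite reflK.
rewrite /blocker; case: pickP => // y /andP[yY /eqP fy].
have : z.1 (sroot y) = refl s (sroot s) by rewrite -fy reflK.
rewrite refl_root // => zy; exfalso; have := pos y yY s; rewrite zy !ffunE eqxx /=; clear E; lra.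
Qed.

Definition run (z : state) (u : seq S) : state := foldl (fun z s => step z (s, true)) z u.

Lemma run_cat z u1 u2 : run z (u1 ++ u2) = run (run z u1) u2.
Proof. exact: foldl_cat. Qed.

(** The root [sroot s] is a combination of [f (sroot y)] and [f (sroot z)]. Applying
    the inverse of [f] gives a root with these coefficients in the basis of simple
    roots, so they have the same sign, and they are nonnegative. Since [sroot s]
    spans an extremal ray of the positive cone, one of them is 0. *)
Lemma plane_hit f s t y z : minimal f -> s != t -> y \in Y -> z \in Y -> y != z ->
  (exists p q, f (sroot y) = lin p (sroot s) q (sroot t)) ->
  (exists p q, f (sroot z) = lin p (sroot s) q (sroot t)) ->
  exists2 y', y' \in Y & f (sroot y') = sroot s.
Proof.
move=> [[u fE] pos] st yY zY yz [p [q fy]] [p' [q' fz]].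
have ts : (t == s) = false by rewrite eq_sym (negPf st).
have p0 : 0 <= p by have := pos y yY s; rewrite fy !ffunE eqxx (negPf st) /=; lra.
have q0 : 0 <= q by have := pos y yY t; rewrite fy !ffunE eqxx ts /=; lra.
have p'0 : 0 <= p' by have := pos z zY s; rewrite fz !ffunE eqxx (negPf st) /=; lra.
have q'0 : 0 <= q' by have := pos z zY t; rewrite fz !ffunE eqxx ts /=; lra.
have indep c d : lin c (f (sroot y)) d (f (sroot z)) = [ffun=> 0] -> c = 0 /\ d = 0.
  have u0 : act u [ffun=> 0] = [ffun=> 0].
    rewrite (_ : [ffun=> 0] = lin 0 (sroot s) 0 (sroot s)) ?act_lin;
    by apply/ffunP => r; rewrite !ffunE !mul0r addr0.
  rewrite !fE -act_lin -[RHS]u0 => /act_inj/ffunP e.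
  split; first by have := e y; rewrite !ffunE eqxx (negPf yz) /=; lra.
  by have := e z; rewrite !ffunE eqxx eq_sym (negPf yz) /=; lra.
set D := p * q' - q * p'.
have D0 : D != 0.
  apply/eqP => D0.
  have [q'z qz] : q' = 0 /\ - q = 0.
    apply: indep; rewrite fy fz; apply/ffunP => r; rewrite !ffunE.
    by transitivity (D * (r == s)%:R); [rewrite /D; ring | rewrite D0 mul0r].
  have [p'z pz] : p' = 0 /\ - p = 0.
    apply: indep; rewrite fy fz; apply/ffunP => r; rewrite !ffunE.
    by transitivity (- D * (r == t)%:R); [rewrite /D; ring | rewrite D0 oppr0 mul0r].
  have [] : (1 : R) = 0 /\ (0 : R) = 0; last by move=> /eqP; rewrite oner_eq0.
  apply: indep; apply/ffunP => r; rewrite fy !ffunE.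
  have -> : p = 0 by lra.
  have -> : q = 0 by lra.
  by ring.
set c := q' / D; set d := - q / D.
have es : sroot s = lin c (f (sroot y)) d (f (sroot z)).
  by rewrite fy fz; apply/ffunP => r; rewrite !ffunE /c /d /D; field.
have es' : act (rev u) (sroot s) = lin c (sroot y) d (sroot z).
  by rewrite es !fE -act_lin actK.
have zy : (z == y) = false by rewrite eq_sym (negPf yz).
have s1 : 1 = c * p + d * p'.
  by move: es => /ffunP/(_ s); rewrite fy fz !ffunE eqxx (negPf st) /=; lra.
have t1 : 0 = c * q + d * q'.
  by move: es => /ffunP/(_ t); rewrite fy fz !ffunE eqxx ts /=; lra.
have [] : 0 <= c /\ 0 <= d.
  have [sg|sg] := root_sign KC Kss Kcos mC (rev u) s.
    split; first by have := sg y; rewrite es' !ffunE eqxx (negPf yz) /=; lra.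
    by have := sg z; rewrite es' !ffunE eqxx zy /=; lra.
  have c0 : c <= 0 by have := sg y; rewrite es' !ffunE eqxx (negPf yz) /=; lra.
  have d0 : d <= 0 by have := sg z; rewrite es' !ffunE eqxx zy /=; lra.
  exfalso; clear - c0 d0 p0 p'0 s1; nra.
move=> c0 d0; have cq : 0 <= c * q by rewrite mulr_ge0.
have dq : 0 <= d * q' by rewrite mulr_ge0.
have cq0 : c * q = 0 by clear -t1 cq dq; lra.
have dq0 : d * q' = 0 by clear -t1 cq dq; lra.
have [c_0|c_n0] := eqVneq c 0; last first.
  exists y => //; rewrite fE; apply: (act_root_multiple (x := p)) => //.
  move/eqP: cq0; rewrite mulf_eq0 (negPf c_n0) /= => /eqP q_0.
  by rewrite -fE fy q_0; apply/ffunP => r; rewrite !ffunE; ring.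
have d_n0 : d != 0.
  by apply/eqP => d_0; move: s1; rewrite c_0 d_0 !mul0r addr0 => /eqP; rewrite oner_eq0.
exists z => //; rewrite fE; apply: (act_root_multiple (x := p')) => //.
move/eqP: dq0; rewrite mulf_eq0 (negPf d_n0) /= => /eqP q_0.
by rewrite -fE fz q_0; apply/ffunP => r; rewrite !ffunE; ring.
Qed.

Section Braid.
Variables (f : V -> V) (a0 : G) (s t : S).
Hypothesis fmin : minimal f.
Hypothesis st : s != t.
Hypothesis m0 : (0 < m s t)%N.

Definition in_plane (v : V) : Prop := exists x y, v = lin x (sroot s) y (sroot t).

Lemma in_planeC_refl r v : r \in [:: s; t] -> in_plane (refl r v) -> in_plane v.
Proof.
move=> rst [x [y e]]; have -> : v = refl r (lin x (sroot s) y (sroot t)) by rewrite -e reflK.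
have ts : t != s by rewrite eq_sym.
move: rst; rewrite !inE => /orP[]/eqP ->; first by rewrite refl_plane //; eexists; eexists.
by rewrite linC refl_plane // linC; eexists; eexists.
Qed.

Lemma root_in_plane r : r \in [:: s; t] -> in_plane (sroot r).
Proof.
rewrite !inE => /orP[]/eqP ->; [exists 1, 0 | exists 0, 1]; apply/ffunP => r';
  by rewrite !ffunE; ring.
Qed.

Lemma braid_free u : {subset u <= [:: s; t]} -> forall g : V -> V,
  (forall y, y \in Y -> ~ in_plane (g (sroot y))) ->
  run (g, a0) u = ((fun v => act u (g v)), a0).
Proof.
elim: u => [|r u IH] sub g ng; first by [].
have rst : r \in [:: s; t] by apply: sub; rewrite inE eqxx.
rewrite /run /= {2}/step /= (_ : blocker g r = None).
  rewrite -/(run _ _) IH // => [x xu|y yY /in_planeC_refl]; first by apply: sub; rewrite inE xu orbT.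
  by move=> /(_ rst); exact: ng.
rewrite /blocker; case: pickP => // y /andP[yY /eqP gy].
by have := ng y yY; rewrite gy => /(_ (root_in_plane rst)).
Qed.

Lemma alt_sub (x y : S) n : {subset alt x y n <= [:: x; y]}.
Proof.
elim: n x y => //= n IH x y r; rewrite inE => /orP[/eqP ->|/IH]; first by rewrite inE eqxx.
by rewrite !inE orbC.
Qed.

Lemma blocker_some g r y : blocker g r = Some y -> y \in Y /\ g (sroot y) = sroot r.
Proof. by rewrite /blocker; case: pickP => // y' /andP[yY /eqP gy] [<-]. Qed.

Lemma blocker_none g r : (forall y, y \in Y -> g (sroot y) <> sroot r) -> blocker g r = None.
Proof. by rewrite /blocker; case: pickP => // y /andP[yY /eqP gy] /(_ y yY). Qed.

(** The orbit of [f] under the two letters, when exactly one root [f (sroot y0)]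
    lies in their plane, is a segment with [m s t] points. The letters move along
    its edges alternately, and a loop labelled [y0] sits at each of its ends. Both
    alternating words of length [m s t] run once through exactly one loop and end
    at the mirror image of their starting point. *)
Section Walk.
Variables (a b y0 : S) (f0 : V -> V).
Hypothesis ab : a != b.
Hypothesis abst : forall v, in_plane v <-> exists x y, v = lin x (sroot a) y (sroot b).
Hypothesis mab : m b a = m s t.
Hypothesis y0Y : y0 \in Y.
Hypothesis f0y0 : f0 (sroot y0) = sroot a.
Hypothesis f0n : forall y, y \in Y -> y != y0 -> ~ in_plane (f0 (sroot y)).

Let M := m s t.
Let U := cheb (- K b a).
Let x i : V -> V := fun v => act (alt b a i) (f0 v).
Let back i := if odd i then b else a.
Let forth i := if odd i then a else b.

Let UM : U M = 0 /\ U M.-1 = 1.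
Proof.
have ba : b != a by rewrite eq_sym.
by have [_] := Kcos ba; rewrite mab => /(_ m0)[].
Qed.

Let Upos i : (0 < i < M)%N -> 0 < U i.
Proof.
case/andP=> i0 iM; have ba : b != a by rewrite eq_sym.
by have [H _] := Kcos ba; apply: H => //; rewrite mab iM orbT.
Qed.

Let xy0 i : x i (sroot y0) = lin (U i) (sroot (forth i)) (U i.+1) (sroot (back i)).
Proof.
have e : sroot a = lin (U 0) (sroot b) (U 1) (sroot a).
  by apply/ffunP => r; rewrite !ffunE /U cheb0 cheb1; ring.
have ba : b != a by rewrite eq_sym.
rewrite /x f0y0 e act_alt // add0n /forth /back -/U.
by case: (odd i); rewrite // linC.
Qed.

Let in_planeE r v : r = a \/ r = b -> in_plane (refl r v) -> in_plane v.
Proof.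
move=> rab /abst[c [d e]]; apply/abst.
have -> : v = refl r (lin c (sroot a) d (sroot b)) by rewrite -e reflK.
have ba : b != a by rewrite eq_sym.
case: rab => ->; first by rewrite refl_plane //; eexists; eexists.
by rewrite linC refl_plane // linC; eexists; eexists.
Qed.

Let x_step i v : x i.+1 v = refl (forth i) (x i v).
Proof. by rewrite /x -addn1 alt_cat act_cat /forth; case: (odd i). Qed.

Let xn i y : y \in Y -> y != y0 -> ~ in_plane (x i (sroot y)).
Proof.
move=> yY yy0; elim: i => [|i IH]; first exact: f0n.
by rewrite x_step => P; apply: IH; apply: in_planeE P; rewrite /forth; case: (odd i); [left | right].
Qed.

Let sroot_plane r : r = a \/ r = b -> in_plane (sroot r).
Proof.
by case=> ->; apply/abst; [exists 1, 0 | exists 0, 1]; apply/ffunP => r'; rewrite !ffunE; ring.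
Qed.

Let backP i : back i = a \/ back i = b.
Proof. by rewrite /back; case: (odd i); [right | left]. Qed.

Let forthP i : forth i = a \/ forth i = b.
Proof. by rewrite /forth; case: (odd i); [left | right]. Qed.

Let fbn i : (forth i == back i) = false.
Proof. by rewrite /forth /back; case: (odd i); rewrite ?(negPf ab) // eq_sym (negPf ab). Qed.

Let blocker_x i r : r = a \/ r = b -> x i (sroot y0) <> sroot r -> blocker (x i) r = None.
Proof.
move=> rab ne; apply: blocker_none => y yY; have [->//|yy0] := eqVneq y y0.
by move=> e; apply: (xn yY yy0 (i := i)); rewrite e; exact: sroot_plane.
Qed.

Let blocker_y0 i r : r = a \/ r = b -> x i (sroot y0) = sroot r -> blocker (x i) r = Some y0.
Proof.
move=> rab e; case E: blocker => [y|]; last first.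
  by move: E; rewrite /blocker; case: pickP => // /(_ y0); rewrite y0Y e eqxx.
have [yY e'] := blocker_some E; have [->//|yy0] := eqVneq y y0.
by case: (xn yY yy0 (i := i)); rewrite e'; exact: sroot_plane.
Qed.

Let forth_free i a1 : (i.+1 < M)%N -> step (x i, a1) (forth i, true) = (x i.+1, a1).
Proof.
move=> iM; rewrite /step /= (blocker_x (forthP i)) /=; first by congr (_, _); apply/funext => v; rewrite x_step.
rewrite xy0 => /ffunP/(_ (back i)); rewrite !ffunE eqxx eq_sym fbn mulr0 mulr1 add0r.
by have := @Upos i.+1; rewrite iM => /(_ isT) /gt_eqF/negbT/eqP.
Qed.

Let forth_loop a1 : step (x M.-1, a1) (forth M.-1, true) = (x M.-1, (a1 * gen y0)%g).
Proof.
rewrite /step /= (blocker_y0 (forthP _)) //= xy0 prednK // !(UM.1, UM.2).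
by apply/ffunP => r; rewrite !ffunE; ring.
Qed.

Let back_free i a1 : (i.+1 < M)%N -> step (x i.+1, a1) (back i.+1, true) = (x i, a1).
Proof.
have bf : back i.+1 = forth i by rewrite /back /forth /=; case: (odd i).
move=> iM; rewrite /step /= (blocker_x (backP _)) /=.
  by congr (_, _); apply/funext => v; rewrite x_step bf reflK.
rewrite xy0 => /ffunP/(_ (forth i.+1)); rewrite !ffunE eqxx fbn mulr0 mulr1 addr0.
by have := @Upos i.+1; rewrite iM => /(_ isT) /gt_eqF/negbT/eqP.
Qed.

Let back_loop a1 : step (x 0, a1) (back 0, true) = (x 0, (a1 * gen y0)%g).
Proof.
by rewrite /step /= (blocker_y0 (backP _)).
Qed.

Let run_forth p j a1 : (p + j < M)%N ->
  run (x p, a1) (alt (forth p) (back p) j) = (x (p + j)%N, a1).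
Proof.
elim: j p => [|j IH] p pj; first by rewrite addn0.
rewrite /run /= forth_free; last by lia.
have -> : back p = forth p.+1 by rewrite /back /forth /=; case: (odd p).
have -> : forth p = back p.+1 by rewrite /back /forth /=; case: (odd p).
by rewrite -/(run _ _) IH addSnnS.
Qed.

Let run_back p j a1 : (j <= p)%N -> (p < M)%N ->
  run (x p, a1) (alt (back p) (forth p) j) = (x (p - j)%N, a1).
Proof.
elim: j p => [|j IH] p jp pM; first by rewrite subn0.
case: p jp pM => // p jp pM.
rewrite /run /= back_free //.
have -> : back p.+1 = forth p by rewrite /back /forth /=; case: (odd p).
have -> : forth p.+1 = back p by rewrite /back /forth /=; case: (odd p).
by rewrite -/(run _ _) IH // ltnW.
Qed.

Lemma run_walk p a1 : (p < M)%N ->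
  run (x p, a1) (alt (forth p) (back p) M) = run (x p, a1) (alt (back p) (forth p) M).
Proof.
move=> pM.
have [r eM] : exists r, M = (r + 1 + p)%N by exists (M - 1 - p)%N; lia.
have [eM' er] : M = (p + 1 + r)%N /\ M.-1 = (p + r)%N by lia.
have -> : run (x p, a1) (alt (back p) (forth p) M) = (x r, (a1 * gen y0)%g).
  rewrite {1}eM' !alt_cat !run_cat run_back // subnn.
  have -> : run (x 0, a1) (if odd p then alt (forth p) (back p) 1 else alt (back p) (forth p) 1)
      = (x 0, (a1 * gen y0)%g).
    by rewrite -back_loop /run; case op: (odd p); rewrite /= /forth /back op.
  have -> : (if odd (p + 1) then alt (forth p) (back p) r else alt (back p) (forth p) r)
      = alt (forth 0) (back 0) r.
    by rewrite addn1 /=; case op: (odd p); rewrite /= /forth /back op.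
  by rewrite run_forth; [rewrite add0n | lia].
rewrite {1}eM !alt_cat !run_cat run_forth; last by lia.
rewrite -er.
have oM : odd M.-1 = odd p (+) odd r by rewrite er oddD.
have -> : run (x M.-1, a1) (if odd r then alt (back p) (forth p) 1 else alt (forth p) (back p) 1)
    = (x M.-1, (a1 * gen y0)%g).
  rewrite -forth_loop /run; case orr: (odd r); rewrite /= /forth /back oM orr;
  by case: (odd p).
have -> : (if odd (r + 1) then alt (back p) (forth p) p else alt (forth p) (back p) p)
    = alt (back M.-1) (forth M.-1) p.
  by rewrite addn1 /= /forth /back oM; case: (odd r); case: (odd p).
by rewrite run_back; [congr (x _, _); lia | lia | lia].
Qed.
End Walk.

Hypothesis braidG : forall (y z : S) (a : G), y != z -> (0 < m y z)%N ->
  foldl (fun a s => (a * gen s)%g) a (alt y z (m y z)) =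
  foldl (fun a s => (a * gen s)%g) a (alt z y (m y z)).

Lemma run_blocked g a1 (y z c d : S) n : blocker g c = Some y -> blocker g d = Some z ->
  run (g, a1) (alt c d n) = (g, foldl (fun a s => (a * gen s)%g) a1 (alt y z n)).
Proof.
elim: n c d y z a1 => // n IH c d y z a1 yc zd.
by rewrite /run /= {2}/step /= yc -/(run _ _) (IH _ _ z y).
Qed.

Lemma in_plane_alt n v : in_plane (act (alt s t n) v) -> in_plane v.
Proof.
elim: n => // n IH; rewrite -addn1 alt_cat act_cat; case: (odd n) => /in_planeC_refl => /(_ _)H;
  by apply/IH/H; rewrite !inE eqxx ?orbT.
Qed.

(** Otherwise all prefixes of the alternating word keep the root positive, but the
    whole word takes the positive roots of the plane to negative ones. *)
Lemma walk_base y u : (forall v, f v = act u v) -> nonneg (f (sroot y)) -> in_plane (f (sroot y)) ->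
  exists2 k, (k < m s t)%N &
    act (alt s t k) (f (sroot y)) = sroot (if odd k then t else s).
Proof.
move=> fE pos [p [q fy]]; apply: contrapT => nk.
have ts : (t == s) = false by rewrite eq_sym (negPf st).
have nn k : (k <= m s t)%N -> nonneg (act (alt s t k) (f (sroot y))).
  elim: k => [//|k IH] kM.
  have -> : act (alt s t k.+1) (f (sroot y)) =
      refl (if odd k then t else s) (act (u ++ alt s t k) (sroot y)).
    by rewrite -addn1 alt_cat !act_cat fE; case: (odd k).
  apply: refl_nonneg; rewrite act_cat -fE; first by apply: IH; exact: ltnW.
  by move=> e; apply: nk; exists k.
have p0 : 0 <= p by have := pos s; rewrite fy !ffunE eqxx (negPf st) /=; lra.
have q0 : 0 <= q by have := pos t; rewrite fy !ffunE eqxx ts /=; lra.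
have := nn (m s t) (leqnn _); rewrite fy act_lin.
have [-> ->] := act_alt_max KC Kss Kcos st m0 => neg.
have [p_0 q_0] : p = 0 /\ q = 0.
  have := neg s; have := neg t; case: (odd _); rewrite !ffunE !eqxx ts (negPf st) /=;
  by split; lra.
have := form_act_root u y y; rewrite -fE fy p_0 q_0 Kss.
rewrite /bform big1 => [|r _]; first by move/eqP; rewrite eq_sym pnatr_eq0.
by rewrite !ffunE; ring.
Qed.

(** Three cases, according to the number of roots [f (sroot y)] in the plane of
    [sroot s] and [sroot t]. Without any, the letters move [f] as in the Coxeter
    group. A single one is the case of [run_walk]. With two of them, both letters are
    blocked by [plane_hit], and they act through generators that satisfy the same
    braid relation. *)
Lemma braid_step : run (f, a0) (alt s t (m s t)) = run (f, a0) (alt t s (m s t)).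
Proof.
have ts : t != s by rewrite eq_sym.
have [[u fE] pos] := fmin.
have [np|] := pselect (forall y, y \in Y -> ~ in_plane (f (sroot y))).
  rewrite !braid_free //; last first.
  - by move=> r /alt_sub.
  - by move=> r /alt_sub; rewrite !inE orbC.
  by congr (_, _); apply/funext => v; exact: (braid_act KC Kss Kcos _ st (mC _ _) m0).
move=> /existsNP[y /not_implyP[yY /contrapT yP]].
have [[z [zY zy zP]]|uniq] := pselect (exists z, [/\ z \in Y, z != y & in_plane (f (sroot z))]).
  have plC v : in_plane v -> exists p q, v = lin p (sroot t) q (sroot s).
    by move=> [p [q ->]]; exists q, p; rewrite linC.
  have [y1 y1Y fy1] := plane_hit fmin st zY yY zy zP yP.
  have [y2 y2Y fy2] := plane_hit fmin ts zY yY zy (plC _ zP) (plC _ yP).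
  have some r y' : y' \in Y -> f (sroot y') = sroot r -> exists2 y'', blocker f r = Some y'' &
      f (sroot y'') = sroot r.
    move=> y'Y fy'; case E: (blocker f r) => [y''|].
      by exists y'' => //; have [] := blocker_some E.
    by move: E; rewrite /blocker; case: pickP => // /(_ y'); rewrite y'Y fy' eqxx.
  have [z1 b1 f1] := some _ _ y1Y fy1; have [z2 b2 f2] := some _ _ y2Y fy2.
  rewrite (run_blocked _ _ b1 b2) (run_blocked _ _ b2 b1).
  have z12 : z1 != z2.
    by apply/eqP => z12; move: f1; rewrite z12 f2 => /root_inj/eqP; rewrite (negPf ts).
  have KE : K z1 z2 = K s t.
    by rewrite -(form_act_root u) -!fE f1 f2 form_root coroot_root.
  have mE : m z1 z2 = m s t.
    by apply: (dihedral_cos_inj (x := - K s t)); [rewrite -KE|]; exact: Kcos.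
  by rewrite -mE braidG // mE.
have [k kM ek] := walk_base fE (pos y yY) yP.
pose f0 v := act (alt s t k) (f v).
pose a := if odd k then t else s; pose b := if odd k then s else t.
have xk : f = (fun v => act (alt b a k) (f0 v)).
  apply/funext => v; rewrite /f0 -[LHS](actK Kss (alt s t k)) rev_alt /a /b.
  by case: (odd k).
have ab : a != b by rewrite /a /b; case: (odd k).
have := @run_walk a b y f0 ab _ _ yY ek _ k a0 kM.
rewrite -xk (_ : (if odd k then a else b) = t); last by rewrite /a /b; case: (odd k).
rewrite (_ : (if odd k then b else a) = s); last by rewrite /a /b; case: (odd k).
move=> -> //.
- move=> v; rewrite /a /b; case: (odd k) => //; split=> -[p [q ->]]; exists q, p; exact: linC.
- by rewrite /a /b; case: (odd k).
- move=> y' y'Y y'y /in_plane_alt y'P; apply: uniq; exists y'; split=> //.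
Qed.
End Braid.

End CosetAction.

Section Cosines.
Import Order.TTheory GRing.Theory Num.Theory.
Local Open Scope ring_scope.
Local Notation R := Rdefinitions.R.

Definition sin_mul (n : nat) (t : R) : R := sin (n%:R * t)%R.

Lemma cheb_sin (t : R) n : cheb (2 * cos t) n * sin t = sin_mul n t.
Proof.
suff [] : cheb (2 * cos t) n * sin t = sin_mul n t /\
    cheb (2 * cos t) n.+1 * sin t = sin_mul n.+1 t by [].
elim: n => [|n [IH1 IH2]].
  by rewrite cheb0 cheb1 /sin_mul mulr0n !mul0r !mul1r; split=> //; rewrite [RHS]sin_0.
split=> //; rewrite chebSS mulrBl -mulrA IH2 IH1 /sin_mul.
have -> : n.+2%:R * t = Rplus (n.+1%:R * t) t by rewrite !(RplusE, RmultE) -(natr1 n.+1); ring.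
have -> : n%:R * t = Rplus (n.+1%:R * t) (Ropp t) by rewrite !(RplusE, RmultE, RoppE) -(natr1 n); ring.
rewrite !sin_plus cos_neg sin_neg !(RplusE, RmultE, RoppE).
by ring.
Qed.

Lemma dihedral_cos_exists m : (m != 1)%N -> exists x : R, dihedral_cos m x.
Proof.
have [-> _|m0 m1] := posnP m.
  by exists (1 + 1); exact: dihedral_cos_infinite.
pose t : R := PI / m%:R.
have mR : (0 : R) < m%:R by rewrite ltr0n.
have PI0 : (0 : R) < PI by apply/RltP; exact: PI_RGT_0.
have mt : m%:R * t = PI by rewrite /t mulrC divfK // gt_eqF.
have sin_pos n : (0 < n)%N -> (n < m)%N -> (0 : R) < sin_mul n t.
  move=> n0 nm; apply/RltP; apply: sin_gt_0; apply/RltP.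
    by rewrite mulr_gt0 ?ltr0n // divr_gt0.
  by rewrite -mt ltr_pM2r ?divr_gt0 // ltr_nat.
have sint : (0 : R) < sin t.
  by have := sin_pos 1%N isT; rewrite /sin_mul mul1r; apply; lia.
exists (2 * cos t); split=> [n n0|_].
  rewrite -leqn0 leqNgt m0 /= => nm.
  by rewrite -(pmulr_lgt0 _ sint) cheb_sin sin_pos.
split; first by lia.
  by apply/(mulIf (lt0r_neq0 sint)); rewrite cheb_sin /sin_mul mt mul0r [LHS]sin_PI.
apply/(mulIf (lt0r_neq0 sint)); rewrite cheb_sin /sin_mul mul1r.
have -> : m.-1%:R * t = Rminus PI t by rewrite RminusE -mt -{2}(prednK m0) -(natr1); ring.
by rewrite sin_PI_x.
Qed.
End Cosines.

(** * Inclusions of parabolic subgroups *)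
Section PresentedAction.
Variables (S : Type) (R : word S -> word S -> Prop) (Z : Type) (step : Z -> S * bool -> Z).
Variable I : Z -> Prop.
Hypothesis step_inv : forall z a, I z -> I (step z a).
Hypothesis step_cancel : forall z a, I z -> step (step z a) (letter_inv a) = z.
Hypothesis step_rel : forall u v z, R u v -> I z -> foldl step z u = foldl step z v.

Lemma foldl_step_inv z u : I z -> I (foldl step z u).
Proof. by elim: u z => //= a u IH z zI; apply/IH/step_inv. Qed.

Lemma pres_eq_foldl u v : pres_eq R u v -> forall z, I z -> foldl step z u = foldl step z v.
Proof.
elim=> {u v} [u v uv z zI|a z zI|//|u v _ IH z zI|u v w _ IH1 _ IH2 z zI|u u' v v' _ IH1 _ IH2 z zI].
- exact: step_rel.
- exact: step_cancel.
- by rewrite IH.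
- by rewrite IH1 // IH2.
- by rewrite !foldl_cat IH1 // IH2 //; exact: foldl_step_inv.
Qed.
End PresentedAction.

Section Subgroups.
Local Open Scope group_scope.
Local Open Scope classical_set_scope.
Variable G : groupType.

Lemma conj_set_subgroup g (P : set G) : is_subgroup P -> is_subgroup (conj_set g P).
Proof.
move=> [P1 PM PV]; split=> [|x y|x]; rewrite !conj_setE.
- by rewrite mulg1 mulVg.
- by move=> px py; have := PM _ _ px py; rewrite !mulgA mulgK.
- by move=> /PV; rewrite !invgM invgK !mulgA.
Qed.

Lemma generated_min (A H : set G) : is_subgroup H -> A `<=` H -> generated A `<=` H.
Proof. by move=> HG AH x; apply. Qed.

Lemma generated_gen (A : set G) : A `<=` generated A.
Proof. by move=> x Ax H [_]; apply. Qed.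

Lemma generated_mono (A B : set G) : A `<=` B -> generated A `<=` generated B.
Proof.
move=> AB; apply: generated_min; first exact: generated_subgroup.
exact: subset_trans AB (@generated_gen _).
Qed.
Lemma conj_generated g (A P : set G) : is_subgroup P ->
  (forall a, A a -> P (g * a * g^-1)) -> conj_set g (generated A) `<=` P.
Proof.
move=> PG AP _ [a + <-]; have := conj_set_subgroup g^-1 PG.
move=> /(@generated_min A) sub /sub; rewrite conj_setE invgK; apply=> b /AP.
by rewrite conj_setE invgK.
Qed.
End Subgroups.

Section ArtinCosets.
Local Open Scope group_scope.
Local Open Scope classical_set_scope.
Variable Gamma : labeledGraph.
Local Notation A := (artin Gamma).

Definition cox (s t : Gamma) : nat :=
  if [set s; t]%SET \in edge Gamma then label [set s; t]%SET else 0.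

Lemma coxC s t : cox s t = cox t s.
Proof. by rewrite /cox finset.setUC. Qed.

Lemma cox_neq1 s t : cox s t != 1%N.
Proof. by rewrite /cox; case: ifP => // /label_ge2; case: (label _) => [|[]]. Qed.

Lemma alternatingE (v w : Gamma) n : alternating v w n = map (fun s => (s, true)) (alt v w n).
Proof.
elim: n v w => // n IH v w; rewrite /= -IH /alternating /mkseq /= -[1%N]add1n iotaDl -map_comp.
by congr (_ :: _); apply: eq_map => i /=; case: (odd i).
Qed.

Lemma foldl_gen (a : A) (u : seq Gamma) :
  foldl (fun a s => a * artin_gen s) a u = a * pres_class _ (map (fun s => (s, true)) u).
Proof.
elim: u a => [|s u IH] a /=; first by rewrite -[LHS]mulg1.
by rewrite IH -mulgA; congr (_ * _); exact: pres_mulE.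
Qed.

Lemma braid_gen (y z : Gamma) (a : A) : y != z -> (0 < cox y z)%N ->
  foldl (fun a s => a * artin_gen s) a (alt y z (cox y z)) =
  foldl (fun a s => a * artin_gen s) a (alt z y (cox y z)).
Proof.
rewrite /cox; case: ifP => // yz _ _; rewrite !foldl_gen -!alternatingE; congr (_ * _).
by apply/pres_classP/pres_rel; exists y, z.
Qed.

Lemma cos_matrix : exists K : Gamma -> Gamma -> Rdefinitions.R,
  [/\ forall s t, K s t = K t s, forall s, K s s = 2%:R%R &
   forall s t, s != t -> dihedral_cos (cox s t) (- K s t)%R].
Proof.
have [c cP] := choice (fun n => dihedral_cos_exists (m := n.+2) isT).
pose x n := if n is n'.+2 then c n' else (1 + 1)%R.
exists (fun s t => if s == t then (1 + 1)%R else (- x (cox s t))%R); split=> [s t|s|s t st].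
- by rewrite eq_sym coxC.
- by rewrite eqxx.
rewrite (negPf st) GRing.opprK; case E: (cox s t) (cox_neq1 s t) => [|[|n]] // _.
exact: dihedral_cos_infinite.
Qed.

Section Cosets.
Variables (K : Gamma -> Gamma -> Rdefinitions.R).
Hypothesis KC : forall s t, K s t = K t s.
Hypothesis Kss : forall s, K s s = 2%:R%R.
Hypothesis Kcos : forall s t, s != t -> dihedral_cos (cox s t) (- K s t)%R.
Variable Y : {set Gamma}.

Local Notation state := (state Rdefinitions.R Gamma A).
Local Notation step := (step K Y (@artin_gen Gamma)).
Local Notation minimal := (minimal K Y).
Local Notation refl := (@refl _ _ K).
Local Notation sroot := (@sroot Rdefinitions.R Gamma).

Definition walk (z : state) (x : A) : state := foldl step z (repr x).

Lemma foldl_step_class u v z : pres_class (@artin_rel Gamma) u = pres_class _ v ->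
  minimal z.1 -> foldl step z u = foldl step z v.
Proof.
move=> /pres_classP uv; apply: (pres_eq_foldl (I := fun z : state => minimal z.1) _ _ _ uv).
- by move=> z' a; exact: (step_minimal KC Kss Kcos coxC).
- by move=> z' [s b]; exact: (step_cancel Kss).
move=> u' v' [f a] [s [t [st -> ->]]] fm.
have cE : cox s t = label [set s; t]%SET by rewrite /cox st.
have mE : label [set s; t]%SET = cox s t by [].
have st' : s != t.
  apply/eqP => st'; have := edge_card2 st; rewrite st' finset.setUid finset.cards1.
  by [].
have m0 : (0 < cox s t)%N by rewrite cE; apply: leq_trans (label_ge2 st).
rewrite mE !alternatingE.
have rm (z' : state) w : foldl step z' (map (fun s => (s, true)) w) = run K Y (@artin_gen Gamma) z' w.
  by elim: w z' => //= r w IH z'; rewrite IH.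
by rewrite !rm; exact: (braid_step KC Kss Kcos coxC a fm st' m0 braid_gen).
Qed.

Lemma walk_class z u : minimal z.1 -> walk z (pres_class _ u) = foldl step z u.
Proof. by move=> zm; apply: foldl_step_class => //; exact: pres_reprK. Qed.

Lemma walk_minimal z x : minimal z.1 -> minimal (walk z x).1.
Proof.
by apply: (foldl_step_inv (I := fun z : state => minimal z.1)) => z' a; exact: (step_minimal KC Kss Kcos coxC).
Qed.

Lemma walkM z x y : minimal z.1 -> walk z (x * y) = walk (walk z x) y.
Proof.
move=> zm; rewrite -[x in LHS]pres_reprK -[y in LHS]pres_reprK.
rewrite (_ : _ * _ = pres_class _ (repr x ++ repr y)); last exact: pres_mulE.
by rewrite walk_class // foldl_cat.
Qed.

Lemma walk1 z : minimal z.1 -> walk z 1 = z.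
Proof. by move=> zm; rewrite -[1]/(pres_class _ [::]) walk_class. Qed.

Lemma walk_gen z s : minimal z.1 -> walk z (artin_gen s) = step z (s, true).
Proof. exact: walk_class. Qed.

Lemma walk_left f a b x : walk (f, b * a) x = ((walk (f, a) x).1, b * (walk (f, a) x).2).
Proof.
rewrite /walk; elim: (repr x) f a => //= c u IH f a.
have -> : step (f, b * a) c = ((step (f, a) c).1, b * (step (f, a) c).2).
  by rewrite /step /=; case: blocker => //= y; rewrite mulgA.
by rewrite IH; case: (step _ _).
Qed.

Lemma minimal_id : minimal id.
Proof. by split=> [|y yY r]; [exists [::] | rewrite ffunE; case: (_ == _)]. Qed.

Lemma walk_parabolic a b : standard_parabolic Y b -> walk (id, a) b = (id, a * b).
Proof.
pose B b := walk (id, 1) b = (id, b).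
suff YB : standard_parabolic Y `<=` B by move=> /YB bB; rewrite -{1}[a]mulg1 walk_left bB.
have gb b' a' : B b' -> walk (id, a') b' = (id, a' * b').
  by move=> bB; rewrite -{1}[a']mulg1 walk_left bB.
apply: generated_min.
  split=> [|x y Bx By|x Bx]; rewrite /B.
  - by rewrite walk1 //; exact: minimal_id.
  - by rewrite walkM ?Bx; [exact: gb | exact: minimal_id].
  have /= := walkM x x^-1 (z := (id, x^-1)) minimal_id.
  by rewrite mulgV (gb x) // mulVg walk1 => [<- //|]; exact: minimal_id.
move=> _ [s sY <-]; rewrite /B walk_gen; last exact: minimal_id.
rewrite /step /blocker; case: pickP => [y /andP[_ /eqP /root_inj ->]|/(_ s)] /=; first by rewrite mul1g.
by rewrite eqxx andbT; move: sY; rewrite /= => ->.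
Qed.

Lemma parabolic_subgroup X : is_subgroup (@standard_parabolic Gamma X).
Proof. exact: generated_subgroup. Qed.

Lemma walk_second g : standard_parabolic Y (walk (id, 1) g).2.
Proof.
have [Y1 YM YV] := parabolic_subgroup Y.
have : standard_parabolic Y (id : {ffun Gamma -> Rdefinitions.R} -> _, 1 : A).2 by [].
rewrite /walk; elim: (repr g) (id, 1) => //= c u IH z z2; apply: IH.
rewrite /step; case E: blocker => [y|] //=; have [yY _] := blocker_some E.
have Yy : standard_parabolic Y (artin_gen y) by apply: generated_gen; exists y.
by apply: YM => //; case: (c.2) => //; exact: YV.
Qed.

(** Let [(f, p)] be the state that [g] reaches from the initial one. For [x] in [X],
    the elements [g * x] and [b * g], where [b = g * x * g^-1] is in [A_Y], reach
    the same state, so [f] is not moved by the letter [x]. Hence the letter is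
    blocked by some [y], and [b = p * y * p^-1]. *)
Lemma parabolic_inclusion_step (g : A) (X : {set Gamma}) :
    conj_set g (standard_parabolic X) `<=` standard_parabolic Y ->
  exists p (Z : {set Gamma}), [/\ standard_parabolic Y p, Z \subset Y, (#|Z| <= #|X|)%N &
    conj_set g (standard_parabolic X) = conj_set p (standard_parabolic Z)].
Proof.
move=> gXY; case E: (walk (id, 1) g) => [f p].
have pY : standard_parabolic Y p by have := walk_second g; rewrite E.
have fm : minimal f by have := @walk_minimal (id, 1) g minimal_id; rewrite E.
have blk x : x \in X -> exists y, [/\ y \in Y, blocker Y f x = Some y &
    g * artin_gen x * g^-1 = p * artin_gen y * p^-1].
  move=> xX; set b := g * artin_gen x * g^-1.
  have bY : standard_parabolic Y b.
    by apply: gXY; exists (artin_gen x) => //; apply: generated_gen; exists x.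
  have e : step (f, p) (x, true) = (f, b * p).
    rewrite -walk_gen // -E -walkM; last exact: minimal_id.
    have -> : g * artin_gen x = b * g by rewrite /b mulgVK.
    rewrite walkM; last exact: minimal_id.
    by rewrite walk_parabolic // mul1g -{1}[b]mulg1 walk_left E.
  move: e; rewrite /step /=; case eb: blocker => [y|] [].
    move=> e; exists y; split=> //; first by case: (blocker_some eb).
    by rewrite e mulgK.
  move=> fE _; exfalso.
  have [[u fu] _] := fm.
  pose v := act K (rev u) (sroot x).
  have fv : f v = sroot x by rewrite fu /v (actVK Kss).
  by have /(congr1 (fun h => h v)) := fE; rewrite fv; exact: (refl_root_neq Kss).
pose Z := [set y | [exists x in X, blocker Y f x == Some y]]%SET.
pose bl x := odflt x (blocker Y f x).
have ZE : Z = [set bl x | x in X]%SET.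
  apply/finset.setP => y; rewrite inE; apply/existsP/imsetP.
    by move=> [x /andP[xX /eqP e]]; exists x => //; rewrite /bl e.
  by move=> [x xX ->]; exists x; have [y' [_ e _]] := blk x xX; rewrite xX /bl e eqxx.
exists p, Z; split=> //.
- apply/fintype.subsetP => y; rewrite inE => /existsP[x /andP[xX /eqP e]].
  by case: (blocker_some e).
- by rewrite ZE leq_imset_card.
rewrite eqEsubset; split.
  apply: conj_generated => [|_ [x xX <-]]; first exact/conj_set_subgroup/parabolic_subgroup.
  have [y [yY e ->]] := blk x xX.
  rewrite conj_setE !mulgA mulVg mul1g -mulgA mulVg mulg1; apply: generated_gen; exists y => //=.
  by rewrite inE; apply/existsP; exists x; rewrite e eqxx andbT.
apply: conj_generated => [|_ [y + <-]]; first exact/conj_set_subgroup/parabolic_subgroup.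
rewrite /= inE => /existsP[x /andP[xX /eqP e]].
have [y' [_ + e']] := blk x xX; rewrite e => -[yy]; rewrite yy -e'.
by exists (artin_gen x) => //; apply: generated_gen; exists x.
Qed.
End Cosets.

Lemma parabolic_inclusion (g h : A) (X Y : {set Gamma}) :
    conj_set g (standard_parabolic X) `<=` conj_set h (standard_parabolic Y) ->
  exists k (Z : {set Gamma}), [/\ Z \subset Y, (#|Z| <= #|X|)%N,
    conj_set g (standard_parabolic X) = conj_set k (standard_parabolic Z) &
    conj_set h (standard_parabolic Y) = conj_set k (standard_parabolic Y)].
Proof.
move=> sub; have [K [KC Kss Kcos]] := cos_matrix.
have [|p [Z [pY ZY ZX e]]] := @parabolic_inclusion_step K KC Kss Kcos Y (h^-1 * g) X.
  move=> x; rewrite conj_setE invgM invgK => xX.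
  have /sub : conj_set g (standard_parabolic X) (h * x * h^-1) by rewrite conj_setE !mulgA in xX *.
  by rewrite conj_setE !mulgA mulVg mul1g mulgVK.
exists (h * p), Z; split=> //.
  by rewrite -(conj_setM h p) -e conj_setM mulgA mulgV mul1g.
rewrite -conj_setM; congr conj_set.
have [Y1 YM YV] := parabolic_subgroup Y.
apply/seteqP; split=> x; rewrite conj_setE => xY.
  by apply: (YM) => //; apply: (YM) => //; exact: (YV).
by have := YM _ _ (YM _ _ pY xY) (YV _ pY); rewrite !mulgA mulgV mul1g mulgK.
Qed.
End ArtinCosets.

(** * Chain conditions and parabolic hulls *)
Section Parabolics.
Local Open Scope group_scope.
Local Open Scope classical_set_scope.
Variable Gamma : labeledGraph.
Local Notation A := (artin Gamma).
Local Notation parabolic := (@parabolic Gamma).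
Local Notation standard_parabolic := (@standard_parabolic Gamma).
Implicit Types (P Q : set A).

Lemma artin_gen_parabolic (s : Gamma) (Y : {set Gamma}) :
  standard_parabolic Y (artin_gen s) <-> s \in Y.
Proof.
split=> [sY|]; last by move=> sY; apply: generated_gen; exists s.
have [K [KC Kss Kcos]] := cos_matrix Gamma.
have := walk_parabolic KC Kss Kcos 1 sY; have idm := @minimal_id _ K Y.
rewrite walk_gen // /step /blocker; case: pickP => [y /andP[yY /eqP/root_inj e] _|_ /= [fE _]].
  by rewrite e in yY.
have /(congr1 (fun h => h (sroot _ s))) := fE.
by move=> e; have := refl_root_neq Kss e.
Qed.

Lemma artin_countable : exists f : nat -> A, forall x, exists n, f n = x.
Proof.
exists (fun n => pres_class _ (odflt [::] (unpickle n))) => x; exists (pickle (repr x)).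
by rewrite pickleK /= pres_reprK.
Qed.

Definition has_rank P n : Prop :=
  exists g X, P = conj_set g (standard_parabolic X) /\ #|X| = n.

Definition parabolic_rank P n : Prop := has_rank P n /\ forall k, has_rank P k -> (n <= k)%N.

Lemma rank_parabolic P n : has_rank P n -> parabolic P.
Proof. by move=> [g [X [PE _]]]; exists g, X. Qed.

Lemma parabolic_rank_exists P : parabolic P -> exists n, parabolic_rank P n.
Proof.
move=> [g [X PE]]; have ex : exists n, `[< has_rank P n >].
  by exists #|X|; apply/asboolP; exists g, X.
case: (ex_minnP ex) => n /asboolP Pn minn; exists n; split=> // k Pk.
by apply: minn; apply/asboolP.
Qed.

(** By [parabolic_inclusion], the larger subgroup has a standard form in which the
    smaller one is given by a subset of the generators. *)
Lemma parabolic_rank_sub P Q n k : parabolic_rank P n -> parabolic_rank Q k ->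
  P `<=` Q -> (n <= k)%N /\ (n = k -> P = Q).
Proof.
move=> [[g [X [PE Xn]]] Pmin] [[h [Y [QE Yk]]] _] PQ.
have := PQ; rewrite PE QE => /parabolic_inclusion[p [Z [ZY ZX e1 e2]]].
have /Pmin nZ : has_rank P #|Z| by exists p, Z; rewrite PE e1.
split; first by rewrite -Yk (leq_trans nZ) // subset_leq_card.
move=> nk; rewrite e1 e2; congr (conj_set _ (standard_parabolic _)).
by apply/eqP; rewrite eqEcard ZY Yk -nk.
Qed.

Lemma parabolic_dcc (P : nat -> set A) : (forall n, parabolic (P n)) ->
  (forall n, P n.+1 `<=` P n) -> exists n, forall m, P n `<=` P m.
Proof.
move=> Ppar dec.
have decD i j : P (j + i)%N `<=` P i by elim: j => // j IH; exact: subset_trans (dec _) IH.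
have [r rP] := choice (fun n => parabolic_rank_exists (Ppar n)).
have ex : exists k, `[< exists n, r n = k >] by exists (r 0%N); apply/asboolP; exists 0%N.
case: (ex_minnP ex) => k /asboolP[n rn] mink; exists n => m.
have [mn|/ltnW nm] := leqP m n; first by rewrite -(subnK mn); exact: decD.
have sub : P m `<=` P n by rewrite -(subnK nm); exact: decD.
have [rmn e] := parabolic_rank_sub (rP m) (rP n) sub.
rewrite e //; apply/eqP; rewrite eqn_leq rmn rn.
by apply: mink; apply/asboolP; exists m.
Qed.

Lemma standard_parabolicT : standard_parabolic [set: Gamma]%SET = setT.
Proof.
apply/seteqP; split=> // x _.
rewrite -[x]pres_reprK; elim: (repr x) => [|[s b] u IH].
  by have [] := parabolic_subgroup [set: Gamma]%SET.
have [_ M V] := parabolic_subgroup [set: Gamma]%SET.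
rewrite (_ : pres_class _ _ = pres_class _ [:: (s, b)] * pres_class _ u); last exact/esym/pres_mulE.
apply: (M) IH; have gs : standard_parabolic [set: Gamma]%SET (artin_gen s).
  by apply/artin_gen_parabolic; rewrite inE.
case: b => //; rewrite (_ : pres_class _ _ = (artin_gen s)^-1); last exact/esym/pres_invE.
exact: (V).
Qed.

Lemma parabolicT : parabolic setT.
Proof. by exists 1, [set: Gamma]%SET; rewrite conj_set1 standard_parabolicT. Qed.

Lemma parabolic_conj g P : parabolic P -> parabolic (conj_set g P).
Proof. by move=> [h [X ->]]; exists (g * h), X; rewrite conj_setM. Qed.

Hypothesis classA : artin_classA Gamma.

(** A parabolic subgroup [P] of minimal rank that contains [F]. Its intersection with
    another one is parabolic and not of smaller rank, hence equal to [P]. *)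
Lemma least_parabolic (F : set A) : exists P, [/\ parabolic P, F `<=` P &
  forall Q, parabolic Q -> F `<=` Q -> P `<=` Q].
Proof.
have ex : exists k, `[< exists P, parabolic_rank P k /\ F `<=` P >].
  have [k kP] := parabolic_rank_exists parabolicT; exists k; apply/asboolP.
  by exists setT.
case: (ex_minnP ex) => k /asboolP[P [Pk FP]] mink.
have Ppar := rank_parabolic Pk.1.
exists P; split=> // Q Qpar FQ; have PQ := classA Ppar Qpar.
have [n PQn] := parabolic_rank_exists PQ.
have [nk e] := parabolic_rank_sub PQn Pk (@subIsetl _ _ _).
rewrite -e; first exact: subIsetr.
apply/eqP; rewrite eqn_leq nk mink //; apply/asboolP; exists (P `&` Q); split=> //.
by move=> x Fx; split; [exact: FP | exact: FQ].
Qed.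

(** The parabolic hulls of the finite subsets of [H] have bounded rank, so that
    one of maximal rank contains [H]. *)
Lemma finitely_generated_hull (H : set A) : exists F : seq A,
  (forall x, x \in F -> H x) /\ exists P, [/\ parabolic P, H `<=` P, (forall x, x \in F -> P x) &
  forall Q, parabolic Q -> (forall x, x \in F -> Q x) -> P `<=` Q].
Proof.
pose hull (F : seq A) P := [/\ parabolic P, [set` F] `<=` P &
  forall Q, parabolic Q -> [set` F] `<=` Q -> P `<=` Q].
pose ok k := exists (F : seq A) P, [/\ forall x, x \in F -> H x, hull F P & parabolic_rank P k].
have ex : exists k, `[< ok k >].
  have [P hP] := least_parabolic [set` ([::] : seq A)]; have [Ppar _ _] := hP.
  by have [k kP] := parabolic_rank_exists Ppar; exists k; apply/asboolP; exists [::], P.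
have bnd k : `[< ok k >] -> (k <= #|Gamma|)%N.
  move=> /asboolP[F [P [_ _ [[g [X [_ <-]]] _]]]]; exact: max_card.
case: (ex_maxnP ex bnd) => k /asboolP[F [P [FH [Ppar FP Pmin] Pk]]] maxk.
exists F; split=> //; exists P; split=> // x Hx.
have [P' [P'par FP' P'min]] := least_parabolic [set` (x :: F)].
have [k' P'k] := parabolic_rank_exists P'par.
have PP' : P `<=` P' by apply: Pmin => // y yF; apply: FP'; rewrite /= inE yF orbT.
have [kk e] := parabolic_rank_sub Pk P'k PP'.
rewrite e; first by apply: FP'; rewrite /= inE eqxx.
apply/eqP; rewrite eqn_leq kk maxk //; apply/asboolP; exists (x :: F), P'; split=> // y.
by rewrite inE => /orP[/eqP ->|/FH].
Qed.
End Parabolics.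

(** * Splittings of Artin groups *)
Section Splitting.
Local Open Scope group_scope.
Local Open Scope classical_set_scope.
Variable Gamma : labeledGraph.
Local Notation A := (artin Gamma).
Local Notation standard_parabolic := (@standard_parabolic Gamma).

Definition independent (s t : Gamma) : Prop := s != t /\ [set s; t]%SET \notin edge Gamma.

Section Pair.
Variables s t : Gamma.
Hypothesis st : independent s t.

Definition factor (i : bool) : set A := standard_parabolic [set~ if i then s else t]%SET.
Definition core : set A := standard_parabolic ([set~ s] :&: [set~ t])%SET.

Lemma core_factor i : core `<=` factor i.
Proof.
apply: generated_mono => _ [v + <-]; rewrite /= !inE => /andP[vs vt]; exists v => //=.
by rewrite !inE; case: i.
Qed.

Lemma factors_generate (P : set A) : is_subgroup P -> (forall i, factor i `<=` P) -> forall x, P x.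
Proof.
move=> PG fP; suff sub : standard_parabolic [set: Gamma]%SET `<=` P.
  by move=> x; apply: sub; rewrite standard_parabolicT.
apply: generated_min => // _ [v _ <-].
by have [vs|vs] := eqVneq v s; [apply: (fP false)|apply: (fP true)]; apply: generated_gen; exists v;
   rewrite //= !inE ?vs //; case: st.
Qed.

Lemma factor_gen i v : factor i (artin_gen v) <-> v != if i then s else t.
Proof. by rewrite -in_setC1; exact: artin_gen_parabolic. Qed.

(* The factor through which a generator acts. *)
Let side (v : Gamma) := v != s.

Lemma gen_factor v : factor (side v) (artin_gen v).
Proof.
apply: generated_gen; exists v => //=; rewrite !inE /side.
by have [->|//] := eqVneq v s; case: st.
Qed.

(** Every edge misses [s] or [t], so the two sides of the corresponding relation are
    words in the generators of one factor. *)
Lemma artin_extends_actions : extends_actions core factor.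
Proof.
move=> Z I rho rhoI rho1 rhoM rho0.
have FG i : is_subgroup (factor i) := generated_subgroup _.
have FV i x : factor i x -> factor i x^-1 by move: (FG i) => [_ _]; apply.
have FM i x y : factor i x -> factor i y -> factor i (x * y) by move: (FG i) => [_ + _]; apply.
pose letter (v : Gamma) b := if b then (artin_gen v)^-1 else artin_gen v.
have letterF v b : factor (side v) (letter v b).
  by have := @gen_factor v; rewrite /letter; case: b => // /FV.
have letter_side i v b z : factor i (artin_gen v) -> I z ->
    rho (side v) (letter v b) z = rho i (letter v b) z.
  move=> vi zI; have [->//|iv] := eqVneq i (side v).
  have vc : core (letter v b).
    have : core (artin_gen v).
      apply: generated_gen; exists v => //=; rewrite !inE.
      move: vi iv => /factor_gen; rewrite /side.
      by case: i; case: (v == s) => //=; case: (v == t).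
    rewrite /letter; case: b => //; have [_ _] := generated_subgroup (standard_gens ([set~ s] :&: [set~ t])%SET).
    exact.
  by case: i {vi} iv; case: (side v) => //= _; rewrite rho0.
pose step z (a : Gamma * bool) := rho (side a.1) (letter a.1 a.2) z.
have stepE i v b z : factor i (artin_gen v) -> I z -> step z (v, b) = rho i (letter v b) z.
  exact: letter_side.
have stepI z a : I z -> I (step z a) by move=> zI; apply: rhoI.
have stepK z a : I z -> step (step z a) (letter_inv a) = z.
  case: a => v b zI; rewrite /step /letter_inv /= -rhoM //.
  rewrite (_ : _ * _ = 1) ?rho1 //.
  by rewrite /letter; case: b => /=; rewrite ?mulVg ?mulgV.
have step_word i u z : (forall v, v \in u -> factor i (artin_gen v)) -> I z ->
    foldl step z (map (fun v => (v, true)) u) = rho i (pres_class _ (map (fun v => (v, true)) u))^-1 z.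
  elim: u z => [|v u IH] z uF zI /=; first by rewrite -[pres_class _ _]/(1 : A) invg1 rho1.
  have uF' w : w \in u -> factor i (artin_gen w) by move=> wu; apply: uF; rewrite inE wu orbT.
  have vF : factor i (artin_gen v) by apply: uF; rewrite inE eqxx.
  rewrite IH //; last exact: stepI.
  rewrite (stepE i) // -rhoM //; last exact: FV.
    by rewrite /letter -invgM; congr (rho _ _^-1 _); exact: pres_mulE.
  apply: FV; elim: (u) uF' => [|w u' IHu] uF'; first by case: (FG i).
  rewrite /= (_ : pres_class _ _ = artin_gen w * pres_class _ (map (fun v => (v, true)) u')); last exact/esym/pres_mulE.
  by apply: (FM); [apply: uF'; rewrite inE eqxx | apply: IHu => x xu; apply: uF'; rewrite inE xu orbT].
have step_rel u v z : artin_rel u v -> I z -> foldl step z u = foldl step z v.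
  move=> [a [b [ab -> ->]]] zI.
  have [i iP] : exists i, forall v, v \in [:: a; b] -> factor i (artin_gen v).
    have nst : ~~ ((a == s) || (b == s)) \/ ~~ ((a == t) || (b == t)).
      apply/orP; rewrite -negb_and; apply/negP => /andP[/orP[]/eqP e1 /orP[]/eqP e2].
      - by case: st => /eqP; rewrite -e1 -e2.
      - by case: st => _ /negP; rewrite -e1 -e2.
      - by case: st => _ /negP; rewrite finset.setUC -e1 -e2.
      - by case: st => /eqP; rewrite -e1 -e2.
    case: nst => nab; [exists true | exists false] => v'; rewrite !inE => v'ab; apply/factor_gen; move: v'ab;
      by move: nab; rewrite negb_or => /andP[na nb] /orP[]/eqP ->.
  have sub (n : nat) (c d v' : Gamma) : v' \in alt c d n -> v' \in [:: c; d] by exact: alt_sub.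
  rewrite !alternatingE !(step_word i) //.
  - by congr (rho _ _^-1 _); rewrite -!alternatingE; apply/pres_classP/pres_rel; exists a, b.
  - by move=> v' /sub; rewrite !inE orbC => v'ab; apply: iP; rewrite !inE.
  - by move=> v' /sub; exact: iP.
have classE u v z : pres_class (@artin_rel Gamma) u = pres_class _ v -> I z ->
    foldl step z u = foldl step z v.
  by move=> /pres_classP uv zI; apply: (pres_eq_foldl stepI stepK step_rel uv zI).
pose act (g : A) z := foldl step z (repr g^-1).
have actI g z : I z -> I (act g z) by exact: foldl_step_inv.
have act1 z : I z -> act 1 z = z.
  by move=> zI; rewrite /act (classE _ [::]) // pres_reprK invg1.
have actM f g z : I z -> act (f * g) z = act f (act g z).
  move=> zI; rewrite /act -foldl_cat; apply: classE => //.
  by rewrite pres_reprK invgM -[g^-1 in LHS]pres_reprK -[f^-1 in LHS]pres_reprK; exact: pres_mulE.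
exists act; split=> // i x z xi zI.
suff sub : factor i `<=` [set x | factor i x /\ forall z, I z -> act x z = rho i x z].
  by have [_ ->] := sub _ xi.
apply: generated_min.
  split=> /= [|x' y [x'F x'P] [yF yP]|y [yF yP]].
  - by split=> [|z' z'I]; [case: (FG i) | rewrite act1 // rho1].
  - split=> [|z' z'I]; first exact: FM.
    by rewrite actM // yP // x'P ?rhoM //; exact: rhoI.
  split=> [|z' z'I]; first exact: FV.
  have yVI : I (rho i y^-1 z') by apply: rhoI => //; exact: FV.
  have e : act y (rho i y^-1 z') = z'.
    by rewrite yP // -rhoM ?mulgV ?rho1 //; exact: FV.
  by rewrite -{1}e -actM // mulVg act1.
move=> _ [v vi <-]; have vF : factor i (artin_gen v) by apply: generated_gen; exists v.
split=> // z' z'I; rewrite /act (classE _ [:: (v, false)]) //=; last first.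
  by rewrite pres_reprK; exact: pres_invE.
by rewrite (stepE i).
Qed.

Definition geodesic (N : A -> nat) : Prop :=
  forall g, (0 < N g)%N -> exists r, N r = 1%N /\ (N (r^-1 * g)).+1 = N g.

Definition splitting_length (N : A -> nat) : Prop :=
  [/\ tree_length N, geodesic N, forall g, N g = 0%N <-> core g &
    forall g, (N g <= 1)%N <-> factor true g \/ factor false g].

Lemma splitting_length_exists : exists N, splitting_length N /\
  ~~ elliptic N (artin_gen t * artin_gen s).
Proof.
have cG : is_subgroup core := generated_subgroup _.
have FG i : is_subgroup (factor i) := generated_subgroup _.
have [N [N1 N2 N3 N4 Nw]] := amalgam_length cG FG core_factor factors_generate artin_extends_actions.
exists N; split=> //.
have sc : ~ core (artin_gen s) by move=> /artin_gen_parabolic; rewrite !inE eqxx.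
have tc : ~ core (artin_gen t) by move=> /artin_gen_parabolic; rewrite !inE eqxx andbF.
have sF : factor false (artin_gen s) by apply/factor_gen; case: st.
have tF : factor true (artin_gen t) by apply/factor_gen; rewrite eq_sym; case: st.
have aw0 : alternating_word core factor [::] by [].
have aw1 : alternating_word core factor [:: (false, artin_gen s)] by apply/alternating_cons; split.
have aw2 : alternating_word core factor [:: (true, artin_gen t); (false, artin_gen s)].
  by apply/alternating_cons; split.
have aw3 : alternating_word core factor [:: (false, artin_gen s); (true, artin_gen t); (false, artin_gen s)].
  by apply/alternating_cons; split.
have aw4 : alternating_word core factor [:: (true, artin_gen t); (false, artin_gen s); (true, artin_gen t); (false, artin_gen s)].
  by apply/alternating_cons; split.
have := Nw _ aw2; have := Nw _ aw4; rewrite /elliptic expgS expg1 /= !mulg1 !mulgA => -> ->.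
by [].
Qed.
End Pair.

(** Let [g A_X g^-1] be the parabolic hull, containing [H], of a finite subset [F] of
    [H]. If [s] and [t] in [X] are not adjacent, then [finite_fixpoint] puts [F], and
    therefore the hull, into a conjugate of a factor, all of whose elements are
    elliptic. But the hull contains a conjugate of the hyperbolic element [t * s]. *)
Lemma elliptic_in_complete (H : set A) : artin_classA Gamma -> is_subgroup H ->
  (forall s t, independent s t -> forall N, splitting_length s t N -> forall h, H h -> elliptic N h) ->
  exists P, complete_parabolic P /\ H `<=` P.
Proof.
move=> classA [H1 HM HV] ell.
have [F [FH [P [[g [X PE]] HP FP Pmin]]]] := finitely_generated_hull classA H.
exists P; split=> //; exists g, X; split=> // s t sX tX st; apply: contraT => nst.
have ind : independent s t by [].
have [N [Nst /negP nell]] := splitting_length_exists ind; case: nell.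
have [NT geo len0 len1] := Nst.
have [_ H1M _] : is_subgroup (factor s t true) by exact: generated_subgroup.
have [_ H2M _] : is_subgroup (factor s t false) by exact: generated_subgroup.
have [_ H0M _] : is_subgroup (core s t) by exact: generated_subgroup.
have ellf i x : factor s t i x -> elliptic N x.
  move=> xi; rewrite /elliptic expgS expg1.
  have x1 : (N x <= 1)%N by apply/len1; case: (i) xi; [left|right].
  have x2 : (N (x * x)%g <= 1)%N.
    by apply/len1; case: (i) xi => xi; [left; exact: H1M|right; exact: H2M].
  have [x0|] := posnP (N x); last by move=> x0; rewrite (leq_trans x2).
  by rewrite x0 leqn0; apply/eqP/len0; have /len0 xc := x0; exact: H0M.
have inP i k : {in F, forall f, factor s t i (k^-1 * f * k)} ->
    elliptic N (artin_gen t * artin_gen s).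
  move=> FK; have PK : P `<=` conj_set k (factor s t i).
    apply: Pmin; first by exists k, [set~ if i then s else t]%SET.
    by move=> f fF; rewrite conj_setE; exact: FK.
  have genP v : v \in X -> factor s t i ((g^-1 * k)^-1 * artin_gen v * (g^-1 * k)).
    move=> vX; have Pv : P (g * artin_gen v * g^-1).
      by rewrite PE; exists (artin_gen v) => //; apply: generated_gen; exists v.
    by have := PK _ Pv; rewrite conj_setE invgM invgK !mulgA.
  move: (g^-1 * k) genP => c genP; rewrite -(elliptic_conj NT c); apply: (ellf i).
  have -> : c^-1 * (artin_gen t * artin_gen s) * c =
    (c^-1 * artin_gen t * c) * (c^-1 * artin_gen s * c) by rewrite !mulgA mulgK.
  by case: (i) genP => genP; [apply: H1M|apply: H2M]; exact: genP.
have := @finite_fixpoint _ N NT geo (core s t) (factor s t true) (factor s t false).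
move=> /(_ _ _ _ _ len0 len1 F)[].
- exact: generated_subgroup.
- exact: generated_subgroup.
- exact: core_factor.
- exact: core_factor.
- by move=> f fF; apply: (ell s t) => //; exact: FH.
- by move=> f1 f2 fF fF'; apply: (ell s t) => //; apply: HM; exact: FH.
by move=> k [|]; exact: inP.
Qed.
End Splitting.

Local Open Scope group_scope.
Local Open Scope classical_set_scope.
Local Open Scope quotient_scope.

(** * Equations over locally compact groups *)
Section Multiplicative.
Variables (G H : groupType) (f : {multiplicative G -> H}).

Lemma hom1 : f 1 = 1.
Proof. by apply: (mulgI (f 1)); rewrite -gmulfM !mulg1. Qed.

Lemma homV x : f x^-1 = (f x)^-1.
Proof. by apply: (mulgI (f x)); rewrite -gmulfM !mulgV hom1. Qed.

Lemma homX x n : f (x ^+ n) = f x ^+ n.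
Proof. by elim: n => [|n IH]; rewrite ?expg0 ?hom1 // !expgS gmulfM IH. Qed.
End Multiplicative.

Section UltraLimit.
Variables (T : topologicalType) (F : set_system nat).
Hypothesis FU : UltraFilter F.

Lemma ultra_limit (K : set T) (w : nat -> T) : compact K -> (forall n, K (w n)) ->
  exists2 p, K p & w @ F --> p.
Proof.
move=> Kc Kw; have FK : (w @ F) K by apply: (@filterE _ F) => n; exact: Kw.
have [p [Kp clp]] := Kc (w @ F) _ FK; exists p => //.
move=> B pB; rewrite nbhs_simpl; have [//|wB] := in_ultra_setVsetC (w @^-1` B) FU.
by have [x [nBx Bx]] := clp (~` B) B wB pB.
Qed.
End UltraLimit.

Lemma ultra_infinity : exists F : set_system nat, UltraFilter F /\ forall m, F [set n | (m <= n)%N].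
Proof.
have [F [FU sub]] := @ultraFilterLemma nat \oo _; exists F; split=> // m.
by apply: sub; exists m.
Qed.

Section TopologicalGroups.
Variable L : topGroupType.
Implicit Types (x y : L) (U V : set L).

Lemma mulg_cvg (T : Type) (F : set_system T) (FF : Filter F) (f g : T -> L) x y :
  f @ F --> x -> g @ F --> y -> (fun t => f t * g t) @ F --> x * y.
Proof. by move=> fx gy; apply: (@continuous2_cvg T L L L F FF f g (fun x y => x * y) x y (@mulg_continuous L (x, y)) fx gy). Qed.

Lemma invg_cvg (T : Type) (F : set_system T) (FF : Filter F) (f : T -> L) x :
  f @ F --> x -> (fun t => (f t)^-1) @ F --> x^-1.
Proof. by move=> fx; apply: continuous_cvg fx; exact: invg_continuous. Qed.

Lemma mulg_left_continuous x : continuous (fun y => x * y).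
Proof. by move=> y; apply: mulg_cvg; [exact: cvg_cst | exact: cvg_id]. Qed.

Lemma nbhs_translate x y U : nbhs (x * y) U -> nbhs y [set u | U (x * u)].
Proof. exact: (@mulg_left_continuous x y). Qed.

Lemma nbhs_mulg x y U : nbhs (x * y) U ->
  exists V W, [/\ nbhs x V, nbhs y W & forall v w, V v -> W w -> U (v * w)].
Proof.
move=> /(@mulg_continuous L (x, y))[[V W] [xV yW] sub]; exists V, W; split=> // v w Vv Ww.
exact: (sub (v, w)).
Qed.

Lemma closure_subgroup (K : set L) : is_subgroup K -> is_subgroup (closure K).
Proof.
move=> [K1 KM KV]; split.
- exact: subset_closure.
- move=> x y Kx Ky B /nbhs_mulg[V [W [xV yW VW]]].
  have [v [Kv Vv]] := Kx _ xV; have [w [Kw Ww]] := Ky _ yW.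
  by exists (v * w); split; [exact: KM | exact: VW].
move=> x Kx B /(@invg_continuous L x) /Kx[v [Kv Bv]].
by exists v^-1; split=> //; exact: KV.
Qed.

Lemma subgroup_open (N : set L) x : is_subgroup N -> nbhs x N -> open N.
Proof.
move=> [N1 NM NV] xN; rewrite openE => y Ny.
have Nx : N x := nbhs_singleton xN.
have : nbhs (x * y^-1 * y) N by rewrite mulgVK.
move=> /nbhs_translate; apply: filterS => z /= Nz.
have := NM _ _ (NM _ _ Ny (NV _ Nx)) Nz.
by rewrite !mulgA mulgVK mulgV mul1g.
Qed.

Hypothesis lcHL : lcH_group L.

Lemma compact_nbhs x U : nbhs x U -> exists V, [/\ nbhs x V, compact V & V `<=` U].
Proof.
move=> xU; have [lc hL] := lcHL; have [Z xZ [Zc Zcl]] := lc x I.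
have {}xZ : nbhs x Z by move: xZ; rewrite /within /=; apply: filterS => z; exact.
have [B xB BU] := compact_regular hL Zc xZ xU.
exists (closure B `&` Z); split.
- by apply: filterI => //; apply: filterS xB; exact: subset_closure.
- apply: (subclosed_compact _ Zc); last by move=> z [].
  by apply: closedI => //; exact: closed_closure.
- by move=> z [/BU].
Qed.

(** If no [C n] has an interior point, there are nested compact neighbourhoods the [n]-th
    of which misses [C n], and a point common to all of them is not covered. *)
Lemma baire (C : nat -> set L) : (forall n, closed (C n)) -> (forall x, exists n, C n x) ->
  exists n x, nbhs x (C n).
Proof.
move=> Ccl Ccov; apply: contrapT => nC.
have step (W : set L) n : exists W' : set L, (exists x, nbhs x W) ->
    [/\ exists x, nbhs x W', compact W', W' `<=` W & forall x, W' x -> ~ C n x].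
  have [[x xW]|nW] := pselect (exists x, nbhs x W); last by exists set0.
  have [x' [Wx' nCx']] : exists x', nbhs x' W /\ ~ C n x'.
    apply: contrapT => nx; apply: nC; exists n, x.
    have := xW; rewrite {1}nbhsE => -[O [oO Ox] OW].
    have nO z : O z -> nbhs z O by move=> Oz; exact: open_nbhs_nbhs.
    apply: (filterS _ (nO _ Ox)) => z Oz.
    apply: contrapT => nz; apply: nx; exists z; split=> //.
    exact: filterS OW (nO _ Oz).
  have [|V [xV Vc VW]] := @compact_nbhs x' (W `&` ~` C n).
    apply: filterI => //; apply: open_nbhs_nbhs; split=> //.
    by rewrite openC; exact: Ccl.
  exists V => _; split=> //; first by exists x'.
    by move=> z /VW[].
  by move=> z /VW[].
have [next nextP] := choice (fun p => step p.1 p.2).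
pose W := fix W n := if n is n'.+1 then next (W n', n') else setT.
have Wn n : exists x, nbhs x (W n).
  elim: n => [|n IH]; first by exists 1; exact: filterT.
  by have [] := nextP (W n, n) IH.
have dec m n : W (m + n)%N `<=` W n.
  elim: m => // m IH; apply: subset_trans IH.
  by have [_ _ sub _] := nextP (W (m + n)%N, (m + n)%N) (Wn _).
have [w wW] := choice Wn; have {}wW n : W n (w n) := nbhs_singleton (wW n).
have [F [FU Finf]] := ultra_infinity.
have [_ W1c _ _] := nextP (W 0%N, 0%N) (Wn 0%N).
have [|p _ wp] := ultra_limit FU (w := fun n => w n.+1) W1c.
  by move=> n; apply: (dec n 1%N); rewrite addn1.
have [n Cn] := Ccov p; have [_ Wc _ nCW] := nextP (W n, n) (Wn n).
apply: (nCW p) => //; apply: (closed_cvg (F := F) _ (compact_closed lcHL.2 Wc) _ _ wp).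
apply: filterS (Finf n) => k /= nk.
have sub : W (k - n + n.+1)%N `<=` W n.+1 by exact: dec.
by apply: sub; rewrite addnS subnK //; exact: (wW k.+1).
Qed.

Section Homomorphism.
Variables (G : groupType) (psi : {multiplicative L -> G}).
Hypothesis countableG : exists f : nat -> G, forall z, exists n, f n = z.

Definition kernel : set L := [set x | psi x = 1].
Definition kernel_closure : set L := closure kernel.
Local Notation N := kernel_closure.

Lemma kernel_subgroup : is_subgroup kernel.
Proof.
split; rewrite /kernel /=; first exact: hom1.
- by move=> x y xK yK; rewrite gmulfM xK yK mulg1.
- by move=> x xK; rewrite homV xK invg1.
Qed.

Lemma kernel_closure_subgroup : is_subgroup N.
Proof. exact/closure_subgroup/kernel_subgroup. Qed.

(** Countably many translates of the closure of the kernel cover [L], one for each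
    value of [psi]. *)
Lemma kernel_closure_open : open N.
Proof.
have [f fP] := countableG.
have exa n : exists a : L, (exists x, psi x = f n) -> psi a = f n.
  have [[x xf]|nx] := pselect (exists x, psi x = f n); first by exists x.
  by exists 1.
have [a aP] := choice exa.
have [|x|n [x xN]] := @baire (fun n => [set x | N ((a n)^-1 * x)]).
- move=> n; apply: (@preimage_closed _ _ (fun x => (a n)^-1 * x)); last exact: closed_closure.
  by move=> x _; exact: mulg_left_continuous.
- have [n fn] := fP (psi x); exists n; apply: subset_closure => /=.
  by rewrite /kernel /= gmulfM homV aP ?fn ?mulVg //; exists x.
apply: (subgroup_open (x := (a n)^-1 * x)) kernel_closure_subgroup _.
have : nbhs (a n * ((a n)^-1 * x)) [set x | N ((a n)^-1 * x)] by rewrite mulgA mulgV mul1g.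
by move=> /nbhs_translate; apply: filterS => z /=; rewrite mulgA mulVg mul1g.
Qed.

(** There is an element [k] of the kernel close to [x], and [k^-1 * x] is close to 1
    and has the same image as [x]. *)
Lemma small_lift x U : N x -> nbhs 1 U -> exists2 u, U u & psi u = psi x.
Proof.
move=> Nx U1; have : nbhs (x^-1 * x)^-1 U by rewrite mulVg invg1.
move=> /(@invg_continuous L) /nbhs_translate /Nx[k [Kk]] /= Uk.
by exists (x^-1 * k)^-1 => //; rewrite homV gmulfM homV Kk mulg1 invgK.
Qed.

(** Constants of the closure of the kernel can be moved close to [1] without
    changing their images, so that the solutions of longer and longer finite
    pieces of a system stay in a compact set and accumulate at a solution. *)
Lemma solve_system (phi : L -> L -> L -> L) (phi' : G -> G -> G -> G) (g c : nat -> G) :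
    continuous (fun z : L * L * L => phi z.1.1 z.1.2 z.2) -> phi 1 1 1 = 1 ->
    (forall a b y, psi (phi a b y) = phi' (psi a) (psi b) (psi y)) ->
    (forall i, [set psi x | x in N] (g i)) -> (forall i, [set psi x | x in N] (c i)) ->
  exists y : nat -> G, forall i, [set psi x | x in N] (y i) /\ y i = phi' (g i) (c i) (y i.+1).
Proof.
move=> phic phi1 phiE gN cN.
have phi_near (U : set L) : nbhs 1 U -> exists2 V, nbhs 1 V &
    forall a b y, V a -> V b -> V y -> U (phi a b y).
  rewrite -{1}phi1 => /(phic ((1, 1), 1))[[V W] [/= [[V1 V2] [/= V11 V21] sub1] W1] sub].
  exists (V1 `&` V2 `&` W) => [|a b y [[V1a _] _] [[_ V2b] _] [_ Wy]].
    by apply: filterI => //; exact: filterI.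
  by apply: (sub ((a, b), y)); split=> //; apply: (sub1 (a, b)).
have [N1 NM NV] := kernel_closure_subgroup.
have nN : nbhs 1 N by apply: open_nbhs_nbhs; split; [exact: kernel_closure_open | ].
have [W0 [W0n W0c W0N]] := compact_nbhs nN.
have exnext (U : set L) : exists V : set L, nbhs 1 U -> nbhs 1 V /\
    forall a b y, V a -> V b -> V y -> U (phi a b y).
  have [U1|nU] := pselect (nbhs 1 U); last by exists setT.
  by have [V V1 VP] := phi_near U U1; exists V.
have [next nextP] := choice exnext.
pose U := fix U i := if i is i'.+1 then next (U i') `&` U i' else W0.
have U1 i : nbhs 1 (U i).
  by elim: i => //= i IH; apply: filterI => //; case: (nextP _ IH).
have UW i : U i `<=` W0 by elim: i => //= i IH z [_ /IH].
have lift (d : nat -> G) : (forall i, [set psi x | x in N] (d i)) ->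
    exists a : nat -> L, forall i, U i.+1 (a i) /\ psi (a i) = d i.
  move=> dN; have exa i : exists u, U i.+1 u /\ psi u = d i.
    have [x Nx <-] := dN i.
    by have [u Uu e] := small_lift Nx (U1 i.+1); exists u.
  by have [a aP] := choice exa; exists a.
have [a aP] := lift g gN; have [b bP] := lift c cN.
(* The component [i] of the solution of a finite piece with [k] further equations,
   the last unknown being 1. *)
pose back := fix back k i := if k is k'.+1 then phi (a i) (b i) (back k' i.+1) else 1.
have backU k i : U i (back k i).
  elim: k i => [|k IH] i /=; first exact: nbhs_singleton (U1 i).
  have [_ nP] := nextP _ (U1 i); apply: nP.
  - by case: (aP i) => -[].
  - by case: (bP i) => -[].
  - by case: (IH i.+1).
have [F [FU Finf]] := ultra_infinity.
have exy i : exists p, W0 p /\ (fun n => back (n - i)%N i) @ F --> p.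
  have [|p Wp pl] := ultra_limit FU (w := fun n => back (n - i)%N i) W0c.
    by move=> n; apply: UW (backU _ _).
  by exists p.
have [y yP] := choice exy.
exists (fun i => psi (y i)) => i; split.
  by exists (y i) => //; apply: W0N; case: (yP i).
have [_ ga] := aP i; have [_ cb] := bP i; rewrite -ga -cb -phiE; congr (psi _).
have [_ li] := yP i; have [_ li1] := yP i.+1.
apply: (cvg_unique lcHL.2 li).
have l2 : (fun n => phi (a i) (b i) (back (n - i.+1)%N i.+1)) @ F --> phi (a i) (b i) (y i.+1).
  apply: (continuous_cvg _ (phic ((a i, b i), y i.+1)) (f := fun n => ((a i, b i), back (n - i.+1)%N i.+1))).
  exact: (cvg_pair (cvg_cst (a i, b i)) li1).
apply: cvg_trans l2; apply: near_eq_cvg; apply: filterS (Finf i.+1) => n /= ni.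
by rewrite -(subnSK ni).
Qed.
End Homomorphism.
End TopologicalGroups.

(** * Images of almost connected groups *)
Section AlmostConnected.
Variables (L : topGroupType) (N : set L).
Hypothesis NG : is_subgroup N.
Hypothesis Nopen : open N.
Hypothesis Nclosed : closed N.

Lemma component_sub : @identity_component L `<=` N.
Proof.
have [N1 _ _] := NG; move=> x [C [C1 _ Cc] Cx].
by have /seteqP[_ /(_ x Cx)[]] : C `&` N = C by apply: Cc; [exists 1 | exists N | exists N].
Qed.

(** The subgroup [N] contains the identity component, so its cosets are unions of
    fibres of the quotient map. The images of the powers of [g] accumulate in the
    compact quotient, hence two powers lie in the same coset of [N]. *)
Lemma power_in_open_subgroup : almost_connected L -> forall g, exists2 k, (0 < k)%N & N (g ^+ k).
Proof.
move=> ac g; have [N1 NM NV] := NG.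
pose C := @identity_component L; pose Q := {eq_quot coset_equiv C}.
pose p (x : L) : Q := (\pi_Q x).
have [|q [_ clq]] := ac ((p (g ^+ n)) @[n --> \oo]) _.
  by apply: filterE.
pose x : L := repr (q : Q).
pose B : set (coset_space C) := [set r | N (x^-1 * repr (r : Q))].
have NB y : B (p y) <-> N (x^-1 * y).
  have e : left_coset C (repr (p y)) = left_coset C y.
    by have /eqmodP/asboolP := reprK (p y).
  have C1 : C 1 by exists [set 1] => //; split=> //; exact: connected1.
  have [h /component_sub Nh yE] : left_coset C (repr (p y)) y.
    by rewrite e; exists 1; rewrite ?mulg1.
  rewrite /B /= -{2}yE; split=> [Nr|Nr]; first by rewrite mulgA; exact: NM.
  by have := NM _ _ Nr (NV _ Nh); rewrite mulgA mulgK.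
have Bo : open B.
  rewrite /open /= /quotient_open (_ : _ @^-1` _ = (fun y => x^-1 * y) @^-1` N); last first.
    by apply/seteqP; split=> y /= /NB.
  by apply: open_comp => // y _; exact: mulg_left_continuous.
have Bq : nbhs q B.
  by apply: open_nbhs_nbhs; split=> //; rewrite /B /= mulVg.
have hit m : exists n, (m <= n)%N /\ N (x^-1 * g ^+ n).
  have [|_ [[n mn <-] /NB Nn]] := clq [set p (g ^+ n) | n in [set n | (m <= n)%N]] B _ Bq.
    by exists m => // n mn; exists n.
  by exists n.
have [n0 [_ N0]] := hit 0%N; have [n1 [n01 Nn1]] := hit n0.+1.
exists (n1 - n0)%N; first by rewrite subn_gt0.
have := NM _ _ (NV _ N0) Nn1; rewrite invgM invgK !mulgA mulgK.
by rewrite -{1}(subnKC (ltnW n01)) expgnDr mulgA mulVg mul1g.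
Qed.
End AlmostConnected.

Section Artin.
Variables (Gamma : labeledGraph) (classA : artin_classA Gamma).
Variables (L : topGroupType) (psi : {multiplicative L -> artin Gamma}).
Hypothesis lcHL : lcH_group L.
Local Notation N := (kernel_closure psi).
Local Notation image := [set psi x | x in N].

Lemma image_subgroup : is_subgroup image.
Proof.
have [N1 NM NV] := kernel_closure_subgroup psi; split.
- by exists 1; rewrite ?hom1.
- by move=> _ _ [x Nx <-] [y Ny <-]; exists (x * y); rewrite ?gmulfM //; exact: NM.
- by move=> _ [x Nx <-]; exists x^-1; rewrite ?homV //; exact: NV.
Qed.

Lemma image_elliptic s t l : independent s t -> splitting_length s t l ->
  forall h, image h -> elliptic l h.
Proof.
move=> st [lT geo l0 l1]; have solve := solve_system lcHL (@artin_countable Gamma).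
have c1 : continuous (fun z : L * L * L => z.1.1).
  by move=> z; apply: (@continuous_comp _ _ _ fst fst); exact: cvg_fst.
have c2 : continuous (fun z : L * L * L => z.1.2).
  by move=> z; apply: (@continuous_comp _ _ _ fst snd); [exact: cvg_fst | exact: cvg_snd].
have c3 : continuous (fun z : L * L * L => z.2) by move=> z; exact: cvg_snd.
have cM (f f' : L * L * L -> L) : continuous f -> continuous f' -> continuous (fun z => f z * f' z).
  by move=> fc f'c z; apply: mulg_cvg; [exact: fc | exact: f'c].
apply: (no_hyperbolic lT geo (par := parabolic (Gamma := Gamma))).
- exact: parabolic_conj.
- exact: classA.
- exact: parabolic_dcc.
- exists 1, ([set~ s] :&: [set~ t])%SET; rewrite conj_set1.
  by apply/seteqP; split=> g /l0.
- exact: image_subgroup.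
- move=> g c gN cN.
  pose phi (G : groupType) (a b y : G) := a * y * b * y^-1.
  have [|||||y yP] := @solve psi (@phi L) (@phi _) g c.
  + apply: (cM); last by move=> z; apply: invg_cvg; exact: c3.
    by apply: (cM) => //; exact: (cM).
  + by rewrite /phi !mulg1 mulgV.
  + by move=> a b y; rewrite !gmulfM homV.
  + exact: gN.
  + exact: cN.
  by exists y => i; have [_] := yP i.
move=> g n gN; pose phi (G : groupType) (a b y : G) := a * (y ^+ 2) ^+ n.
have cX (f : L * L * L -> L) k : continuous f -> continuous (fun z => f z ^+ k).
  move=> fc; elim: k => [|k IH]; first by move=> z; exact: cvg_cst.
  rewrite (_ : (fun z => _) = (fun z => f z * f z ^+ k)); first exact: (cM).
  by apply/funext => z; rewrite expgS.
have [|||||y yP] := @solve psi (@phi L) (@phi _) (fun=> g) (fun=> g).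
- by apply: (cM) => //; do 2!apply: (cX).
- by rewrite /phi !expg1n mulg1.
- by move=> a b y; rewrite !gmulfM !homX.
- by [].
- by [].
by exists y => i; have [] := yP i.
Qed.

Lemma image_complete : exists P, complete_parabolic P /\ image `<=` P.
Proof.
apply: elliptic_in_complete => //; first exact: image_subgroup.
by move=> s t st l lst; exact: image_elliptic lst.
Qed.

(** Some power of an element of [L] lies in the closure of the kernel, and the powers
    of a hyperbolic element are hyperbolic. *)
Lemma range_complete : almost_connected L ->
  exists P, complete_parabolic P /\ range psi `<=` P.
Proof.
move=> ac; apply: elliptic_in_complete => //.
  split; first by exists 1; rewrite ?hom1.
  - by move=> _ _ [x _ <-] [y _ <-]; exists (x * y); rewrite ?gmulfM.
  - by move=> _ [x _ <-]; exists x^-1; rewrite ?homV.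
move=> s t st l lst _ [x _ <-]; apply: contraT => /[dup] hyp; rewrite -ltnNge => lt.
have [lT _ _ _] := lst.
have [[|k] // _ Nk] := power_in_open_subgroup (kernel_closure_subgroup psi)
  (kernel_closure_open lcHL psi (@artin_countable Gamma)) (@closed_closure _ _) ac x.
have := image_elliptic st lst (ex_intro2 _ _ _ Nk erefl).
rewrite homX /elliptic -expgnA muln2 doubleS.
rewrite (length_hyperbolicX lT k.*2.+1 lt) (length_hyperbolicX lT k lt).
by rewrite leq_add2l leq_pmul2r ?subn_gt0 // -addnn ltnNge leq_addr.
Qed.
End Artin.

(** * Slenderness *)
Definition subgroup_space (L : topGroupType) (K : set L) : Type :=
  initial_topology (\val : generated_group K -> L).

Section SubgroupSpace.
Variables (L : topGroupType) (K : set L).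
Local Notation S := (subgroup_space K).
HB.instance Definition _ := Group.copy S (generated_group K).
HB.instance Definition _ := Topological.copy S (initial_topology (\val : generated_group K -> L)).

Definition incl (x : S) : L := \val (x : generated_group K).

Lemma incl_inj : injective incl.
Proof. exact: val_inj. Qed.

Lemma incl_continuous : continuous incl.
Proof. exact: initial_continuous. Qed.

Lemma inclM x y : incl (x * y) = incl x * incl y.
Proof. by []. Qed.

Lemma incl_generated x : generated K (incl x).
Proof. by case: x => x xK; apply: set_mem. Qed.

Lemma incl_cvg (T : Type) (F : set_system T) (FF : Filter F) (f : T -> S) x :
  incl \o f @ F --> incl x -> f @ F --> x.
Proof.
move=> fx A [_ [[B Bo <-] Bx] sub]; rewrite nbhs_filterE.
have : nbhs (incl x) B by apply: open_nbhs_nbhs.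
by move=> /fx; apply: (@filterS _ F) => t; exact: sub.
Qed.

Lemma subgroup_mulg_continuous : continuous (fun x : S * S => x.1 * x.2).
Proof.
move=> [x y]; apply: (@incl_cvg _ (nbhs (x, y)) (nbhs_filter _) (fun z => z.1 * z.2)).
apply: (@mulg_cvg L _ (nbhs (x, y)) (nbhs_filter _) (incl \o fst) (incl \o snd)).
  by apply: continuous_comp; [exact: cvg_fst | exact: incl_continuous].
by apply: continuous_comp; [exact: cvg_snd | exact: incl_continuous].
Qed.

Lemma subgroup_invg_continuous : continuous (fun x : S => x^-1).
Proof. by move=> x; apply: (@incl_cvg _ (nbhs x) (nbhs_filter _) (fun z => z^-1)); apply: (@invg_cvg L _ (nbhs x) (nbhs_filter _) incl); exact: incl_continuous. Qed.

HB.instance Definition _ :=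
  isTopologicalGroup.Build S subgroup_mulg_continuous subgroup_invg_continuous.

Lemma subgroup_lcH : is_subgroup K -> closed K -> lcH_group L -> lcH_group S.
Proof.
move=> KG Kcl lcHL; have [lc hL] := lcHL.
have inK (z : S) : K (incl z) by exact: (generated_min KG (@subset_refl _ K)) (incl_generated z).
have hS : hausdorff_space S.
  move=> x y xy; apply: incl_inj; apply: hL => A B xA yB.
  have [z [Az Bz]] := xy _ _ (incl_continuous xA) (incl_continuous yB).
  by exists (incl z).
split=> // x _; have [V [xV Vc _]] := compact_nbhs lcHL (@filterT _ (nbhs (incl x)) _).
have cV : compact (incl @^-1` V).
  rewrite compact_ultra => F FU FV.
  have FVi : (incl @ F) (V `&` K).
    by apply: (@filterS _ F _ (incl @^-1` V) _ _ FV) => z Vz; split; [exact: Vz | exact: inK].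
  have [p [[Vp Kp] clp]] := subclosed_compact (closedI (compact_closed hL Vc) Kcl) Vc (@subIsetl _ _ _) _ FVi.
  have pK : p \in generated K by apply: mem_set; exact: generated_gen.
  exists (exist _ p pK : S); split; first exact: Vp.
  have pl : incl @ F --> p.
    move=> B pB; rewrite nbhs_filterE.
    have [//|wB] := in_ultra_setVsetC (incl @^-1` B) FU.
    by have [z [nBz Bz]] := clp (~` B) B wB pB.
  exact: (@incl_cvg _ F _ id).
exists (incl @^-1` V); last by split=> //; exact: compact_closed.
have xV' : nbhs x (incl @^-1` V) := incl_continuous xV.
by apply: (@filterS _ (nbhs x) _ _ _ _ xV').
Qed.
End SubgroupSpace.

Lemma continuous_to_discrete (L : topGroupType) (G : groupType) (psi : {multiplicative L -> G}) :
  nbhs 1 (kernel psi) -> continuous (psi : L -> discrete_topology G).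
Proof.
move=> k1 x A /principal_filterP Ax.
have : nbhs (x^-1 * x) (kernel psi) by rewrite mulVg.
move=> /nbhs_translate kx; rewrite nbhs_filterE; apply: (@filterS _ (nbhs x) _ _ _ _ kx) => y /=.
rewrite /kernel /= gmulfM homV => e; have -> // : psi y = psi x.
by apply: (mulgI (psi x)^-1); rewrite e mulVg.
Qed.

Section Slender.
Variables (Gamma : labeledGraph) (classA : artin_classA Gamma).
Hypothesis slender : forall X : {set Gamma}, free_of_infinity X ->
  lcH_slender (standard_parabolic_group X).
Variables (L : topGroupType) (psi : {multiplicative L -> artin Gamma}).
Hypothesis lcHL : lcH_group L.
Local Notation N := (kernel_closure psi).
Local Notation S := (subgroup_space N).

(** Composed with a conjugation, the restriction of [psi] to the closure of its kernel
    is a homomorphism from an open subgroup of [L] to a slender group. *)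
Lemma kernel_nbhs : nbhs 1 (kernel psi).
Proof.
have [P [[g [X [Xfree PE]]] NP]] := image_complete classA psi lcHL.
have NG := kernel_closure_subgroup psi.
have Nopen := kernel_closure_open lcHL psi (@artin_countable Gamma).
have inN (z : S) : N (incl z) by exact: (generated_min NG (@subset_refl _ N)) (incl_generated z).
have inX (z : S) : g^-1 * psi (incl z) * g \in generated (standard_gens X).
  by apply: mem_set; rewrite -[generated _ _]conj_setE -PE; apply: NP; exists (incl z).
pose theta (z : S) : standard_parabolic_group X :=
  exist (fun x => x \in generated (standard_gens X)) _ (inX z).
have thetaM : {morph theta : x y / x * y}.
  by move=> x y; apply: val_inj; rewrite /= inclM gmulfM !mulgA mulgK.
pose hom : {multiplicative S -> standard_parabolic_group X} :=
  HB.pack theta (isMultiplicative.Build _ _ theta thetaM).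
have cont := @slender X Xfree S hom (subgroup_lcH NG (@closed_closure _ _) lcHL).
have n1 : nbhs (hom 1 : discrete_topology _) [set 1] by apply/principal_filterP; exact: hom1.
have [_ [[B Bo <-] B1] sub] := cont 1 _ n1.
have nB : nbhs 1 (B `&` N).
  apply: filterI; first by apply: open_nbhs_nbhs; split.
  by apply: open_nbhs_nbhs; split=> //; case: NG.
apply: (@filterS _ (nbhs 1) _ _ _ _ nB) => u [Bu Nu].
have uN : u \in generated N by apply: mem_set; exact: generated_gen.
have /(congr1 val) /= := sub (exist (fun x => x \in generated N) u uN : S) Bu.
move=> e; rewrite /kernel /=; apply: (mulgI g^-1); apply: (mulIg g).
by rewrite e mulg1 mulVg.
Qed.
End Slender.

Theorem theorem1p7 (Gamma : labeledGraph) (classA : artin_classA Gamma) :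
  (forall (L : topGroupType) (psi : {multiplicative L -> artin Gamma}),
      lcH_group L -> almost_connected L ->
      exists P : set (artin Gamma), complete_parabolic P /\ range psi `<=` P)
  /\
  ((forall X : {set Gamma}, free_of_infinity X ->
      lcH_slender (standard_parabolic_group X)) ->
   lcH_slender (artin Gamma)).
Proof.
split=> [L psi lcHL ac|slender L psi lcHL]; first exact: range_complete.
exact/continuous_to_discrete/kernel_nbhs.
Qed.
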